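(* Let $H$ be either the Hardy space $H^2$ (put $\gamma=1$) or a weighted Bergman space $A^2_\alpha$, $\alpha>-1$ (put $\gamma=\alpha+2$), on the open unit disk $\mathbb{D}$. Let $\varphi\in\mathrm{Aut}(\mathbb{D})$ with $\varphi(a)=0$, $a\in\mathbb{D}$. Assume that $\psi$ is analytic on $\overline{\mathbb{D}}$ and $\psi\not\equiv0$, and put $w(z)=(1-\overline{a}z)^\gamma\psi(z)$. If $C_{\psi,\varphi}$ is normal on $H$, then $w$ is an eigenvector for the operator $C_\varphi$ and the corresponding $C_\varphi$-eigenvalue for $w$ is $1$.
   Context: $H^2$ is the space of analytic $f=\sum \hat f(n)z^n$ on $\mathbb{D}$ with $\|f\|^2=\sum|\hat f(n)|^2<\infty$; $A^2_\alpha$ is the space of analytic $f$ on $\mathbb{D}$ with $\|f\|^2=\int_{\mathbb{D}}|f(z)|^2(\alpha+1)(1-|z|^2)^\alpha\,dA(z)<\infty$, $dA$ normalized area measure. Analytic on $\overline{\mathbb{D}}$ means analytic on some open set containing $\overline{\mathbb{D}}$. $\mathrm{Aut}(\mathbb{D})$ is the set of one-to-one analytic maps of $\mathbb{D}$ onto itself. $C_\varphi f=f\circ\varphi$ and $C_{\psi,\varphi}f=\psi\cdot(f\circ\varphi)$. A bounded operator $T$ is normal if $TT^*=T^*T$. *)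

(* Defs.v *)
From HB Require Import structures.
From mathcomp Require Import all_boot all_order all_algebra.
From mathcomp Require Import all_classical all_reals all_analysis.
From mathcomp Require Import complex.

Set Implicit Arguments.
Unset Strict Implicit.
Unset Printing Implicit Defensive.
Import Order.TTheory GRing.Theory Num.Theory.
Import numFieldNormedType.Exports.

Local Open Scope classical_set_scope.
Local Open Scope ring_scope.
Local Open Scope complex_scope.

(* Functions on the disk are represented by total functions R[i] -> R[i] whose
   values outside the disk are irrelevant: every notion below only inspects the
   values on [disk], and equality of elements of the function spaces is [eqD].
   The alias R[i]^o carries the usual topology of the complex plane. *)

Definition disk (R : realType) : set R[i] := [set z | `|z| < 1].

Definition closed_disk (R : realType) : set R[i] := [set z | `|z| <= 1].

Definition eqD (R : realType) (f g : R[i] -> R[i]) : Prop :=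
  forall z, disk z -> f z = g z.

Definition modulus (R : realType) (z : R[i]) : R := Normc.normc z.

Definition has_sum (R : realType) (u : nat -> R[i]) (s : R[i]) : Prop :=
  series (u : nat -> R[i]^o) @ \oo --> (s : R[i]^o).

Definition analytic_on (R : realType) (U : set R[i]) (f : R[i] -> R[i]) : Prop :=
  forall z0 : R[i], U z0 -> exists c : nat -> R[i],
    \forall z \near (z0 : R[i]^o), has_sum (fun n => c n * (z - z0) ^+ n) (f z).

Definition analytic_on_closed_disk (R : realType) (f : R[i] -> R[i]) : Prop :=
  exists U : set R[i],
    [/\ open (U : set R[i]^o), @closed_disk R `<=` U & analytic_on U f].

Definition is_automorphism (R : realType) (phi : R[i] -> R[i]) : Prop :=
  analytic_on (@disk R) phi /\ set_bij (@disk R) (@disk R) phi.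

(* The sequence of coefficients of the expansion of f on the disk; the default
   value is only used when f has no such expansion. *)
Definition taylor (R : realType) (f : R[i] -> R[i]) : nat -> R[i] :=
  xget (fun=> 0) [set c : nat -> R[i] |
    forall z, disk z -> has_sum (fun n => c n * z ^+ n) (f z)].

Definition of_plane (R : realType) (p : measurableTypeR R * measurableTypeR R) : R[i] := (p.1 : R) +i* (p.2 : R).

Definition plane_disk (R : realType) : set (measurableTypeR R * measurableTypeR R) :=
  [set p | disk (of_plane p)].

Lemma invpi_ge0 (R : realType) : 0 <= (pi : R)^-1.
Proof. by rewrite invr_ge0 pi_ge0. Qed.

Definition area (R : realType) : {measure set (measurableTypeR R * measurableTypeR R) -> \bar R} :=
  mscale (NngNum (invpi_ge0 R))
    (@lebesgue_measure R \x @lebesgue_measure R)%E.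

Variant disk_space (R : realType) :=
  | Hardy
  | Bergman (alpha : R) of -1 < alpha.
Arguments Hardy {R}.

Definition space_exponent (R : realType) (H : disk_space R) : R :=
  match H with
  | Hardy => 1
  | Bergman alpha _ => alpha + 2
  end.

Definition bergman_weight (R : realType) (alpha : R) (z : R[i]) : R :=
  (alpha + 1) * (1 - modulus z ^+ 2) `^ alpha.

Definition sqnorm (R : realType) (H : disk_space R) (f : R[i] -> R[i]) : \bar R :=
  match H with
  | Hardy => (\sum_(0 <= n <oo) (modulus (taylor f n) ^+ 2)%:E)%E
  | Bergman alpha _ =>
      (\int[@area R]_(p in @plane_disk R)
        (modulus (f (of_plane p)) ^+ 2 * bergman_weight alpha (of_plane p))%:E)%E
  end.

Definition in_space (R : realType) (H : disk_space R) (f : R[i] -> R[i]) : Prop :=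
  analytic_on (@disk R) f /\ (sqnorm H f < +oo)%E.

Definition space_norm (R : realType) (H : disk_space R) (f : R[i] -> R[i]) : R :=
  Num.sqrt (fine (sqnorm H f)).

Definition complex_integral (R : realType) (F : R[i] -> R[i]) : R[i] :=
  Rintegral (@area R) (@plane_disk R) (fun p => complex.Re (F (of_plane p)))
  +i* Rintegral (@area R) (@plane_disk R) (fun p => complex.Im (F (of_plane p))).

Definition inner (R : realType) (H : disk_space R) (f g : R[i] -> R[i]) : R[i] :=
  match H with
  | Hardy =>
      limn (series ((fun n => taylor f n * (taylor g n)^*) : nat -> R[i]^o))
  | Bergman alpha _ =>
      complex_integral (fun z => f z * (g z)^* * (bergman_weight alpha z)%:C)
  end.

Definition operator (R : realType) := (R[i] -> R[i]) -> (R[i] -> R[i]).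

Definition bounded_operator (R : realType) (H : disk_space R) (T : operator R)
    : Prop :=
  [/\ forall f, in_space H f -> in_space H (T f),
      forall (c : R[i]) f g, in_space H f -> in_space H g ->
        eqD (T (fun z => c * f z + g z)) (fun z => c * T f z + T g z)
    & exists M : R, forall f, in_space H f ->
        space_norm H (T f) <= M * space_norm H f].

Definition is_adjoint (R : realType) (H : disk_space R) (T S : operator R)
    : Prop :=
  bounded_operator H S /\
  forall f g, in_space H f -> in_space H g -> inner H (T f) g = inner H f (S g).

Definition normal_operator (R : realType) (H : disk_space R) (T : operator R)
    : Prop :=
  bounded_operator H T /\
  exists S : operator R, is_adjoint H T S /\
    forall f, in_space H f -> eqD (T (S f)) (S (T f)).

Definition composition_op (R : realType) (phi : R[i] -> R[i]) : operator R :=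
  fun f z => f (phi z).

Definition weighted_composition_op (R : realType) (psi phi : R[i] -> R[i])
    : operator R :=
  fun f z => psi z * f (phi z).

Definition is_eigenvector (R : realType) (H : disk_space R) (T : operator R)
    (lambda : R[i]) (w : R[i] -> R[i]) : Prop :=
  [/\ in_space H w, ~ eqD w (fun=> 0) & eqD (T w) (fun z => lambda * w z)].

(* Principal argument, in ]-pi, pi], and principal branch of the power with real
   exponent; for z in the disk, 1 - a^* z lies in the open right half-plane, so
   this branch of (1 - a^* z)^gamma is analytic with value 1 at z = 0. *)
Definition arg (R : realType) (z : R[i]) : R :=
  if 0 <= complex.Im z then acos (complex.Re z / modulus z)
  else - acos (complex.Re z / modulus z).

Definition cpowr (R : realType) (z : R[i]) (gamma : R) : R[i] :=
  (modulus z `^ gamma)%:C * (cos (gamma * arg z) +i* sin (gamma * arg z)).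

(* Main.v *)
Require Import Defs.
From HB Require Import structures.
From mathcomp Require Import all_boot all_order all_algebra.
From mathcomp Require Import cyclic cyclotomic separable.
From mathcomp Require Import all_classical all_reals all_analysis.
From mathcomp Require Import measurable_realfun.
From mathcomp Require Import complex ring lra.
Import Order.TTheory GRing.Theory Num.Theory.
Import numFieldNormedType.Exports.

(** The function [w] turns out to be constant on the disk, which makes it a fixed vector of the
    composition operator.

    By the Schwarz lemma ([automorphism_form]), [phi] is a unimodular multiple of the Blaschke
    factor of [a]. Both kinds of spaces have reproducing kernels proportional to
    [K_x(y) = (1 - conj(x) y) ^ (- gamma)] ([hardy_reproducing], [bergman_reproducing]), and these
    are covariant under automorphisms ([kernel_automorphism]). Normality, tested on kernels, says
    that the inner product of [w K_u] and [w K_v] is the one of [K_u] and [K_v] times the product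
    of [conj(w (phi u))] and [w (phi v)], up to the common normalization of the space
    ([symbol_kernel_inner]). Projecting [w K_u] to [K_u] gives [|w(u)| <= |w(phi u)|], and a single
    case of equality forces [w] to be constant ([symbol_le]).

    On the Hardy space, where multiplication by [z] is isometric, the same identity applied to
    [w K_u - w K_0 = conj(u) z w K_u] shows directly that [w o phi] is constant
    ([isometry_symbol_constant]).

    On a Bergman space, suppose that the inequality is strict everywhere in the disk. The
    normalized kernels concentrate at boundary points ([concentration]), so the norm identity
    degenerates there to [|w(phi x)| = |w(x)|] for [|x| = 1] ([boundary_modulus]). The strict
    increase leaves no fixed point in the disk, so [phi] fixes a point of the circle; sending it
    to infinity conjugates [phi] to a map [t |-> A t + B] with [A > 0] ([affine_conjugate]). All
    forward orbits that avoid a second fixed point therefore have the same limit, and so do all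
    backward orbits. The value of [|w|] at the two limits is the same because of the orbits on the
    circle, and different because of the orbits in the disk ([no_strict_increase]).

    Everything rests on a development of analytic functions as sums of power series. Roots of
    unity replace contour integrals ([cauchy_estimate]), and compactness yields an expansion on
    the whole disk ([disk_expansion]). The principal power is expanded along rays
    ([binomial_series]). The reproducing property on the Bergman spaces comes from the
    orthogonality of the monomials, by rotation invariance of the area, and from a recursion for
    the moments of the weight ([cint_monomial], [moment_limit]). *)

Set Implicit Arguments.
Unset Strict Implicit.
Unset Printing Implicit Defensive.

Local Open Scope classical_set_scope.
Local Open Scope ring_scope.
Local Open Scope complex_scope.
Local Open Scope ring_scope.

(** * The complex modulus and the topology of the plane *)

Section Modulus.
Variable R : realType.
Implicit Types z w : R[i].

Lemma modulusE z : modulus z ^+ 2 = complex.Re z ^+ 2 + complex.Im z ^+ 2.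
Proof. by case: z => x y; rewrite /modulus /= sqr_sqrtr // addr_ge0 ?sqr_ge0. Qed.

Lemma modulus_ge0 z : 0 <= modulus z.
Proof. by case: z => x y; rewrite /modulus /= sqrtr_ge0. Qed.

Lemma normcE z : `|z| = (modulus z)%:C.
Proof. by case: z. Qed.

Lemma modulusM z w : modulus (z * w) = modulus z * modulus w.
Proof. exact: Normc.normcM. Qed.

Lemma modulusD z w : modulus (z + w) <= modulus z + modulus w.
Proof. exact: le_normcD. Qed.

Lemma modulusN z : modulus (- z) = modulus z.
Proof. exact: normcN. Qed.

Lemma modulusV z : modulus z^-1 = (modulus z)^-1.
Proof. exact: Normc.normcV. Qed.

Lemma modulus0 : modulus (0 : R[i]) = 0.
Proof. exact: Normc.normc0. Qed.

Lemma modulus1 : modulus (1 : R[i]) = 1.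
Proof. exact: Normc.normc1. Qed.

Lemma modulus_eq0 z : (modulus z == 0) = (z == 0).
Proof. by apply/eqP/eqP => [/Normc.eq0_normc //|->]; rewrite modulus0. Qed.

Lemma modulus_gt0 z : (0 < modulus z) = (z != 0).
Proof. by rewrite lt_def modulus_ge0 andbT modulus_eq0. Qed.

Lemma modulusX z n : modulus (z ^+ n) = modulus z ^+ n.
Proof. by elim: n => [|n IH]; rewrite ?expr0 ?modulus1 // !exprS modulusM IH. Qed.

Lemma modulusC (x : R) : modulus x%:C = `|x|.
Proof. by rewrite /modulus /= expr0n /= addr0 sqrtr_sqr. Qed.

Lemma modulus_nat n : modulus (n%:R : R[i]) = n%:R.
Proof. by rewrite -(rmorph_nat (real_complex R)) modulusC ger0_norm ?ler0n. Qed.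

Lemma modulus_conj z : modulus z^* = modulus z.
Proof. by case: z => x y; rewrite /modulus /= sqrrN. Qed.

Lemma modulusB z w : modulus (z - w) = modulus (w - z).
Proof. by rewrite -modulusN opprB. Qed.

Lemma modulus_subD z w : modulus z <= modulus (z - w) + modulus w.
Proof. by rewrite -{1}(subrK w z) modulusD. Qed.

Lemma modulus_sub z w : modulus z - modulus w <= modulus (z - w).
Proof. by rewrite lerBlDr modulus_subD. Qed.

Lemma modulus_dist z w : `|modulus z - modulus w| <= modulus (z - w).
Proof. by rewrite ler_norml modulus_sub andbT lerNl opprB modulusB modulus_sub. Qed.

Lemma modulus_triangle z u w : modulus (z - w) <= modulus (z - u) + modulus (u - w).
Proof. by apply: le_trans (modulusD _ _); rewrite addrA subrK. Qed.

Lemma modulus_sum (I : Type) (r : seq I) (P : pred I) (F : I -> R[i]) :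
  modulus (\sum_(i <- r | P i) F i) <= \sum_(i <- r | P i) modulus (F i).
Proof.
elim/big_rec2: _ => [|i x y _ h]; first by rewrite modulus0.
by apply: le_trans (modulusD _ _) _; rewrite lerD2l.
Qed.

Lemma normRe_le z : `|complex.Re z| <= modulus z.
Proof.
by rewrite -(@ler_pXn2r _ 2) ?nnegrE ?modulus_ge0 // modulusE real_normK ?num_real // lerDl sqr_ge0.
Qed.

Lemma normIm_le z : `|complex.Im z| <= modulus z.
Proof.
by rewrite -(@ler_pXn2r _ 2) ?nnegrE ?modulus_ge0 // modulusE real_normK ?num_real // lerDr sqr_ge0.
Qed.

Lemma modulus_le_ReIm z : modulus z <= `|complex.Re z| + `|complex.Im z|.
Proof.
rewrite -(@ler_pXn2r _ 2) ?nnegrE ?modulus_ge0 ?addr_ge0 // modulusE.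
rewrite sqrrD !real_normK ?num_real //.
by rewrite addrAC lerDl mulrn_wge0 // mulr_ge0.
Qed.

Lemma mulcJ z : z * z^* = (modulus z ^+ 2)%:C.
Proof. by rewrite modulusE; case: z => x y /=; apply/eqP; rewrite eq_complex /=; apply/andP; split; apply/eqP; ring. Qed.

Lemma diskP z : disk z <-> modulus z < 1.
Proof. by rewrite /disk /= normcE -ltcR. Qed.

Lemma ReD z w : complex.Re (z + w) = complex.Re z + complex.Re w.
Proof. by case: z; case: w. Qed.
Lemma ImD z w : complex.Im (z + w) = complex.Im z + complex.Im w.
Proof. by case: z; case: w. Qed.
Lemma ReN z : complex.Re (- z) = - complex.Re z. Proof. by case: z. Qed.
Lemma ImN z : complex.Im (- z) = - complex.Im z. Proof. by case: z. Qed.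
Lemma ReM z w : complex.Re (z * w) = complex.Re z * complex.Re w - complex.Im z * complex.Im w.
Proof. by case: z; case: w. Qed.
Lemma ImM z w : complex.Im (z * w) = complex.Re z * complex.Im w + complex.Im z * complex.Re w.
Proof. by case: z => a b; case: w. Qed.
Lemma complex_eq z w : complex.Re z = complex.Re w -> complex.Im z = complex.Im w -> z = w.
Proof. by case: z; case: w => a b c d /= -> ->. Qed.

Lemma gt0c_real (e : R[i]) : 0 < e -> exists2 r : R, 0 < r & e = r%:C.
Proof.
case: e => x y; rewrite ltcE /= => /andP[/eqP -> x0]; exists x => //.
Qed.

(** The theory of power series below is written with explicit real bounds on the modulus; this
    and the next lemma translate the topological notions of the definitions. *)
Lemma nearC (z0 : R[i]) (P : R[i] -> Prop) :
  (\forall z \near (z0 : R[i]^o), P z) <->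
  exists2 e : R, 0 < e & forall z, modulus (z - z0) < e -> P z.
Proof.
split.
  move/nbhs_normP => [e /= /gt0c_real [r r0 ->] h]; exists r => // z zr.
  by apply: h; rewrite /= /ball_ /= normcE ltcR modulusB.
case=> e e0 h; apply/nbhs_normP; exists e%:C => /=; first by rewrite ltcR.
by move=> z; rewrite /= /ball_ /= normcE ltcR modulusB => /h.
Qed.

Lemma cvgC_seq (u : nat -> R[i]) (s : R[i]) :
  ((u : nat -> R[i]^o) @ \oo --> (s : R[i]^o)) <->
  forall e : R, 0 < e -> exists N, forall n, (N <= n)%N -> modulus (u n - s) < e.
Proof.
split.
  move=> /cvgrPdist_lt h e e0.
  have /h : 0 < e%:C :> R[i] by rewrite ltcR.
  move=> [N _ hN]; exists N => n /= Nn.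
  by have /= := hN n Nn; rewrite normcE ltcR modulusB.
move=> h; apply/cvgrPdist_lt => e /gt0c_real [r r0 ->].
have [N hN] := h _ r0; exists N => // n /= Nn.
by rewrite normcE ltcR modulusB hN.
Qed.

(** Compactness of the closed disk, used through the square that contains it. Boundedness of
    continuous functions, attainment of extrema, properness of automorphisms and the existence
    of common radii of convergence are all instances. *)
Lemma closed_disk_uniform (r : R) (P : nat -> R[i] -> Prop) :
  (forall z, modulus z <= r -> exists2 e : R, 0 < e &
     exists N, forall z' n, modulus (z' - z) < e -> (N <= n)%N -> P n z') ->
  exists N, forall n z, (N <= n)%N -> modulus z <= r -> P n z.
Proof.
move=> h.
pose K : set (R * R) := (`[- r, r] `*` `[- r, r])%classic.
have : compact K by apply: compact_setX; exact: segment_compact.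
move/compact_near_coveringP/near_covering_withinP.
move=> /(_ nat \oo (fun n p => modulus (p.1 +i* p.2) <= r -> P n (p.1 +i* p.2))).
case.
- move=> [x y] _ /=.
  have [hr|hr] := leP (modulus (x +i* y)) r.
    have [e e0 [N hN]] := h _ hr.
    exists (ball (x : R) (e / 2) `*` ball (y : R) (e / 2), [set n | (N <= n)%N]).
      split; last by exists N.
      by exists (ball (x : R) (e / 2), ball (y : R) (e / 2)) => //=; split; apply: nbhsx_ballx; rewrite divr_gt0.
    case=> [[x' y'] n] [[/= hx hy] Nn] _ _; apply: hN => //.
    apply: le_lt_trans (modulus_le_ReIm _) _ => /=.
    rewrite [e]splitr ltrD //.
      by rewrite distrC; exact: hx.
    by rewrite distrC; exact: hy.
  pose e := modulus (x +i* y) - r.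
  have e0 : 0 < e by rewrite subr_gt0.
  exists (ball (x : R) (e / 2) `*` ball (y : R) (e / 2), setT).
    split; last exact: filterT.
    by exists (ball (x : R) (e / 2), ball (y : R) (e / 2)) => //=; split; apply: nbhsx_ballx; rewrite divr_gt0.
  case=> [[x' y'] n] [[/= hx hy] _] _ hr'; exfalso.
  have := modulus_subD (x +i* y) (x' +i* y').
  apply/negP; rewrite -ltNge; apply: (@lt_le_trans _ _ (e + r)); last by rewrite /e subrK.
  apply: ltr_leD => //.
  apply: le_lt_trans (modulus_le_ReIm _) _ => /=.
  by rewrite [e]splitr ltrD.
move=> N _ hN; exists N => n z Nn zr.
have := hN n Nn (complex.Re z, complex.Im z); case: z zr => x y zr /=; apply => //.
by split; rewrite /= in_itv /= -ler_norml; apply: le_trans zr; [exact: (normRe_le (x +i* y))|exact: (normIm_le (x +i* y))].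
Qed.

End Modulus.

(** * Series of complex numbers *)

Section Series.
Variable R : realType.
Implicit Types (u v : nat -> R[i]) (s t z : R[i]).

Lemma has_sumP u s : has_sum u s <->
  forall e : R, 0 < e -> exists N, forall n, (N <= n)%N -> modulus (\sum_(i < n) u i - s) < e.
Proof.
rewrite /has_sum; split.
  move/cvgC_seq => h e /h [N hN]; exists N => n /hN; by rewrite /series /= big_mkord.
by move=> h; apply/cvgC_seq => e /h [N hN]; exists N => n /hN; rewrite /series /= big_mkord.
Qed.

Lemma le_modulus_cvg (w : nat -> R[i]) s (B : R) :
  (forall e : R, 0 < e -> exists N, forall n, (N <= n)%N -> modulus (w n - s) < e) ->
  (forall n, modulus (w n) <= B) -> modulus s <= B.
Proof.
move=> h hB; apply/ler_addgt0Pr => e /h [N /(_ N (leqnn _)) hN].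
by apply: le_trans (modulus_subD _ (w N)) _; rewrite addrC lerD // modulusB ltW.
Qed.

Lemma has_sum_unique u s t : has_sum u s -> has_sum u t -> s = t.
Proof.
move=> /has_sumP hs /has_sumP ht; apply/eqP; rewrite -subr_eq0 -modulus_eq0.
rewrite eq_le modulus_ge0 andbT; apply/ler_addgt0Pr => e e0; rewrite add0r.
have e2 : 0 < e / 2 by rewrite divr_gt0.
have [N1 h1] := hs _ e2; have [N2 h2] := ht _ e2.
set n := maxn N1 N2.
have l1 := h1 n (leq_maxl _ _); have l2 := h2 n (leq_maxr _ _).
apply: le_trans (modulus_triangle s (\sum_(i < n) u i) t) _.
by rewrite [e]splitr lerD // ltW // modulusB.
Qed.

(** The real and imaginary parts converge absolutely. *)
Lemma has_sum_dominated u (v : nat -> R) (B : R) :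
  (forall n, modulus (u n) <= v n) -> (forall n, \sum_(i < n) v i <= B) ->
  exists2 s, has_sum u s & modulus s <= B.
Proof.
move=> uv vB.
have v0 n : 0 <= v n by apply: (le_trans _ (uv n)); exact: modulus_ge0.
have cv : cvgn (series v).
  apply: nondecreasing_is_cvgn.
    by apply/nondecreasing_seqP => n; rewrite !seriesEnat /= big_nat_recr //= lerDl.
  by exists B => _ [n _ <-]; rewrite seriesEnat /= big_mkord.
have cr : cvgn (series (fun n => complex.Re (u n))).
  apply: normed_cvg; apply: series_le_cvg cv => n /=; rewrite ?normr_ge0 ?v0 //; apply: (le_trans _ (uv n)); exact: normRe_le.
have ci : cvgn (series (fun n => complex.Im (u n))).
  apply: normed_cvg; apply: series_le_cvg cv => n /=; rewrite ?normr_ge0 ?v0 //; apply: (le_trans _ (uv n)); exact: normIm_le.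
pose s := limn (series (fun n => complex.Re (u n))) +i* limn (series (fun n => complex.Im (u n))).
have Re_sum n : complex.Re (\sum_(i < n) u i) = \sum_(i < n) complex.Re (u i).
  by elim/big_ind2: _ => //= x1 x2 y1 y2 <- <-; rewrite ReD.
have Im_sum n : complex.Im (\sum_(i < n) u i) = \sum_(i < n) complex.Im (u i).
  by elim/big_ind2: _ => //= x1 x2 y1 y2 <- <-; rewrite ImD.
have hs : forall e : R, 0 < e ->
    exists N, forall n, (N <= n)%N -> modulus (\sum_(i < n) u i - s) < e.
  move=> e e0.
  have e2 : 0 < e / 2 by rewrite divr_gt0.
  have /cvgrPdist_lt /(_ _ e2) [N1 _ h1] := cr.
  have /cvgrPdist_lt /(_ _ e2) [N2 _ h2] := ci.
  exists (maxn N1 N2) => n; rewrite geq_max => /andP[n1 n2].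
  apply: le_lt_trans (modulus_le_ReIm _) _; rewrite [e]splitr.
  rewrite ReD ImD ReN ImN Re_sum Im_sum /= ltrD //.
    by have := h1 n n1; rewrite /= seriesEnat /= big_mkord distrC.
  by have := h2 n n2; rewrite /= seriesEnat /= big_mkord distrC.
exists s; first exact/has_sumP.
apply: le_modulus_cvg hs _ => n; apply: le_trans (modulus_sum _ _ _) _.
by apply: (le_trans _ (vB n)); apply: ler_sum.
Qed.

Lemma geo_sum_le (q : R) n : 0 <= q -> q < 1 -> \sum_(i < n) q ^+ i <= (1 - q)^-1.
Proof.
move=> q0 q1; have h : 0 < 1 - q by rewrite subr_gt0.
rewrite -[leRHS]mul1r ler_pdivlMr //.
have -> : (\sum_(i < n) q ^+ i) * (1 - q) = 1 - q ^+ n.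
  rewrite mulrC -[1 - q ^+ n]opprB subrX1 -mulNr opprB //.
by rewrite lerBlDr lerDl exprn_ge0.
Qed.

Lemma has_sum_geo u (M q : R) : 0 <= q -> q < 1 -> (forall n, modulus (u n) <= M * q ^+ n) ->
  exists2 s, has_sum u s & modulus s <= M / (1 - q).
Proof.
move=> q0 q1 hu; apply: (has_sum_dominated (v := fun n => M * q ^+ n)) => // n.
have M0 : 0 <= M by have := hu 0%N; rewrite expr0 mulr1; apply: le_trans; exact: modulus_ge0.
by rewrite -mulr_sumr ler_wpM2l // geo_sum_le.
Qed.

Lemma eq_has_sum u v s : has_sum u s -> u =1 v -> has_sum v s.
Proof. by move=> h /funext <-. Qed.

Lemma has_sum0 : has_sum (fun=> 0) (0 : R[i]).
Proof. by apply/has_sumP => e e0; exists 0%N => n _; rewrite big1 // subr0 modulus0. Qed.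

Lemma has_sumD u v s t : has_sum u s -> has_sum v t -> has_sum (fun n => u n + v n) (s + t).
Proof.
move=> /has_sumP hs /has_sumP ht; apply/has_sumP => e e0.
have e2 : 0 < e / 2 by rewrite divr_gt0.
have [N1 h1] := hs _ e2; have [N2 h2] := ht _ e2.
exists (maxn N1 N2) => n; rewrite geq_max => /andP[n1 n2].
rewrite big_split /= opprD addrACA; apply: le_lt_trans (modulusD _ _) _.
by rewrite [e]splitr ltrD ?h1 ?h2.
Qed.

Lemma has_sumZ c u s : has_sum u s -> has_sum (fun n => c * u n) (c * s).
Proof.
have [->|c0] := eqVneq c 0.
  move=> _; rewrite mul0r; apply: (eq_has_sum has_sum0) => n /=; by rewrite mul0r.
move=> /has_sumP hs; apply/has_sumP => e e0.
have hc : 0 < modulus c by rewrite modulus_gt0.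
have [N h] := hs _ (divr_gt0 e0 hc); exists N => n /h.
by rewrite -mulr_sumr -mulrBr modulusM ltr_pdivlMr // mulrC.
Qed.

Lemma has_sumN u s : has_sum u s -> has_sum (fun n => - u n) (- s).
Proof.
move=> h; have := has_sumZ (c := -1) h; rewrite mulN1r => h'.
by apply: (eq_has_sum h') => n; rewrite mulN1r.
Qed.

Lemma has_sum_conj u s : has_sum u s -> has_sum (fun n => (u n)^*) s^*.
Proof.
move=> /has_sumP hs; apply/has_sumP => e /hs [N hN]; exists N => n /hN.
by rewrite -rmorph_sum -rmorphB modulus_conj.
Qed.

Lemma has_sum_sum (u : nat -> nat -> R[i]) (s : nat -> R[i]) K :
  (forall k, (k < K)%N -> has_sum (u k) (s k)) ->
  has_sum (fun n => \sum_(k < K) u k n) (\sum_(k < K) s k).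
Proof.
elim: K => [_|K IH h].
  by rewrite big_ord0; apply: (eq_has_sum has_sum0) => n /=; rewrite big_ord0.
rewrite big_ord_recr /=.
apply: (eq_has_sum (u := fun n => \sum_(k < K) u k n + u K n)); last by move=> n; rewrite big_ord_recr.
by apply: has_sumD; [apply: IH => k kK; apply: h; rewrite ltnS ltnW|apply: h].
Qed.

Lemma has_sum_shift u s K :
  has_sum u s <-> has_sum (fun n => u (n + K)%N) (s - \sum_(i < K) u i).
Proof.
have key n : \sum_(i < n) u (i + K)%N - (s - \sum_(i < K) u i) = \sum_(i < n + K) u i - s.
  have -> : \sum_(i < n + K) u i = \sum_(i < K) u i + \sum_(i < n) u (i + K)%N.
    rewrite addnC big_split_ord /=; congr (_ + _); apply: eq_bigr => i _; by rewrite addnC.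
  by ring.
split=> /has_sumP h; apply/has_sumP => e /h [N hN].
  by exists N => n Nn; rewrite key hN // (leq_trans Nn) // leq_addr.
exists (N + K)%N => n NKn; have Kn : (K <= n)%N by rewrite (leq_trans _ NKn) // leq_addl.
by rewrite -(subnK Kn) -key hN // leq_subRL // addnC.
Qed.

Lemma has_sum_bounded u s : has_sum u s -> exists2 M : R, 0 < M & forall n, modulus (u n) <= M.
Proof.
move=> /has_sumP /(_ 1 ltr01) [N hN].
pose M := 2 + \sum_(i < N) modulus (u i).
have S0 : 0 <= \sum_(i < N) modulus (u i) by apply: sumr_ge0 => i _; exact: modulus_ge0.
have M0 : 0 < M by rewrite /M; lra.
exists M => // n; have [nN|Nn] := ltnP n N.
  rewrite /M (bigD1 (Ordinal nN)) //=.
  have : 0 <= \sum_(i < N | i != Ordinal nN) modulus (u i) by apply: sumr_ge0 => i _; exact: modulus_ge0.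
  lra.
have h1 := hN n Nn; have h2 := hN n.+1 (leqW Nn).
have -> : u n = (\sum_(i < n.+1) u i - s) - (\sum_(i < n) u i - s).
  by rewrite big_ord_recr /=; ring.
have := modulusD (\sum_(i < n.+1) u i - s) (- (\sum_(i < n) u i - s)).
rewrite modulusN /M; lra.
Qed.

(** The tail is again geometrically dominated, now with first term [M q ^ K]. *)
Lemma has_sum_tail u s (M q : R) K : 0 <= q -> q < 1 ->
  (forall n, (K <= n)%N -> modulus (u n) <= M * q ^+ n) -> has_sum u s ->
  modulus (s - \sum_(i < K) u i) <= M * q ^+ K / (1 - q).
Proof.
move=> q0 q1 hu /(has_sum_shift u s K) hs.
have [|t ht hb] := has_sum_geo (u := fun n => u (n + K)%N) (M := M * q ^+ K) q0 q1.
  by move=> n; rewrite -mulrA -exprD addnC hu // leq_addr.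
by rewrite (has_sum_unique hs ht).
Qed.

Lemma geo_cvg0 (M q : R) (e : R) : 0 <= q -> q < 1 -> 0 < e ->
  exists N, forall n, (N <= n)%N -> M * q ^+ n < e.
Proof.
move=> q0 q1 e0.
have hq : `|q| < 1 by rewrite ger0_norm.
have /cvgrPdist_lt := cvg_expr hq.
have M1 : 0 < `|M| + 1 by rewrite ltr_wpDl.
move=> /(_ _ (divr_gt0 e0 M1)) [N _ hN]; exists N => n Nn.
have := hN n Nn; rewrite /= sub0r normrN ltr_pdivlMr // mulrC => h.
apply: le_lt_trans h; rewrite (ger0_norm (exprn_ge0 _ q0)).
by rewrite ler_wpM2r ?exprn_ge0 // (le_trans (ler_norm _)) // lerDl.
Qed.

Lemma has_sum_approx u s (M q : R) : 0 <= q -> q < 1 ->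
  (forall K, modulus (s - \sum_(i < K) u i) <= M * q ^+ K) -> has_sum u s.
Proof.
move=> q0 q1 h; apply/has_sumP => e e0.
have [N hN] := geo_cvg0 M q0 q1 e0.
by exists N => n /hN; apply: le_lt_trans; rewrite modulusB.
Qed.

End Series.

(** * Power series and the Cauchy estimate *)

Section PowerSeries.
Variable R : realType.
Implicit Types (c d : nat -> R[i]) (z : R[i]).

(** Convergence of a power series at a point of modulus [r] gives such a bound, and the bound
    gives geometric convergence at all points of smaller modulus. *)
Definition power_bound c (r M : R) := forall n, modulus (c n) * r ^+ n <= M.

Lemma power_bound_ge0 c r M : 0 < r -> power_bound c r M -> 0 <= M.
Proof. by move=> r0 /(_ 0%N); rewrite expr0 mulr1; apply: le_trans; exact: modulus_ge0. Qed.

Lemma power_bound_le c (r r' M : R) : 0 <= r' -> r' <= r -> power_bound c r M -> power_bound c r' M.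
Proof.
move=> r0 rr h n; apply: (le_trans _ (h n)).
by rewrite ler_wpM2l ?modulus_ge0 // lerXn2r ?nnegrE // (le_trans r0).
Qed.

Lemma term_bound c (r M : R) (x : R) n : 0 < r -> power_bound c r M -> 0 <= x ->
  modulus (c n) * x ^+ n <= M * (x / r) ^+ n.
Proof.
move=> r0 h x0; have := h n => hn.
have -> : x ^+ n = r ^+ n * (x / r) ^+ n by rewrite -exprMn mulrCA divff ?mulr1 ?gt_eqF.
by rewrite mulrA ler_wpM2r // exprn_ge0 // divr_ge0 // ltW.
Qed.

Lemma has_sum_power c (r M : R) z : 0 < r -> power_bound c r M -> modulus z < r ->
  exists s, has_sum (fun n => c n * z ^+ n) s.
Proof.
move=> r0 h zr.
have [||n|s hs _] := has_sum_geo (u := fun n => c n * z ^+ n) (M := M) (q := modulus z / r).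
- by rewrite divr_ge0 ?modulus_ge0 // ltW.
- by rewrite ltr_pdivrMr // mul1r.
- by rewrite modulusM modulusX term_bound // modulus_ge0.
by exists s.
Qed.

Lemma binomial_term_le (a b : R) n k : 0 <= a -> 0 <= b ->
  'C(n, k)%:R * a ^+ (n - k) * b ^+ k <= (a + b) ^+ n.
Proof.
move=> a0 b0; have [kn|nk] := leqP k n; last by rewrite bin_small // !mul0r exprn_ge0 // addr_ge0.
rewrite exprDn (bigD1 (inord k)) //= inordK ?ltnS // -[X in _ <= X + _]mulr_natl mulrA lerDl.
by apply: sumr_ge0 => i _; rewrite mulrn_wge0 // mulr_ge0 // exprn_ge0.
Qed.

(** Expand [(z1 + h) ^ n] and collect the powers of [h]. The double series is not rearranged:
    for each [K], the sum and its first [K] collected terms differ only through the indices [n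
    >= K], so the error is at most the tail of a geometric series of ratio [(|z1| + |h|) / r]. *)
Lemma recenter c (r M : R) z1 : 0 < r -> power_bound c r M -> modulus z1 < r ->
  exists d, [/\
    forall k, has_sum (fun n => 'C(n, k)%:R * c n * z1 ^+ (n - k)) (d k),
    forall h : R, 0 <= h -> modulus z1 + h < r ->
      power_bound d h (M / (1 - (modulus z1 + h) / r)) &
    forall h s, modulus z1 + modulus h < r ->
      has_sum (fun n => c n * (z1 + h) ^+ n) s -> has_sum (fun k => d k * h ^+ k) s].
Proof.
move=> r0 pb z1r.
have z10 := modulus_ge0 z1.
have q0 h : 0 <= h -> 0 <= (modulus z1 + h) / r by move=> h0; rewrite divr_ge0 ?addr_ge0 // ltW.
have q1 h : modulus z1 + h < r -> (modulus z1 + h) / r < 1 by move=> h0; rewrite ltr_pdivrMr // mul1r.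
have tb (h : R) n k : 0 <= h ->
    modulus ('C(n, k)%:R * c n * z1 ^+ (n - k)) * h ^+ k <= M * ((modulus z1 + h) / r) ^+ n.
  move=> h0; apply: le_trans (term_bound (x := modulus z1 + h) n r0 pb (addr_ge0 z10 h0)).
  rewrite !modulusM modulusX modulus_nat [_%:R * _]mulrC -!mulrA ler_wpM2l ?modulus_ge0 //.
  by rewrite mulrA binomial_term_le.
have [h0 h0_gt0 h0r] : exists2 h : R, 0 < h & modulus z1 + h < r.
  by exists ((r - modulus z1) / 2); lra.
have ex k : exists s, has_sum (fun n => 'C(n, k)%:R * c n * z1 ^+ (n - k)) s.
  have hk : 0 < h0 ^+ k by rewrite exprn_gt0.
  have [n|s hs _] := has_sum_geo (M := M / h0 ^+ k) (u := fun n => 'C(n, k)%:R * c n * z1 ^+ (n - k)) (q0 _ (ltW h0_gt0)) (q1 _ h0r).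
    by rewrite [leRHS]mulrAC ler_pdivlMr // tb // ltW.
  by exists s.
have [d hd] := choice ex.
exists d; split=> // [h h_ge0 hr k|h s hr hs].
  have hs := has_sumZ (c := (h ^+ k)%:C) (hd k).
  have [n|s hs' hb] := has_sum_geo (M := M) (u := fun n => (h ^+ k)%:C * ('C(n, k)%:R * c n * z1 ^+ (n - k))) (q0 _ h_ge0) (q1 _ hr).
    by rewrite modulusM modulusC ger0_norm ?exprn_ge0 // mulrC tb.
  rewrite -(has_sum_unique hs hs') modulusM modulusC ger0_norm ?exprn_ge0 // in hb.
  by rewrite mulrC.
set q := (modulus z1 + modulus h) / r.
have h_ge0 := modulus_ge0 h.
apply: (has_sum_approx (M := M / (1 - q)) (q0 _ h_ge0) (q1 _ hr)) => K.
pose t n i : R[i] := 'C(n, i)%:R * z1 ^+ (n - i) * h ^+ i.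
have tE n : (z1 + h) ^+ n = \sum_(0 <= i < n.+1) t n i.
  by rewrite exprDn big_mkord; apply: eq_bigr => i _; rewrite -mulr_natl /t mulrA.
have hv : has_sum (fun n => \sum_(k < K) c n * t n k) (\sum_(k < K) d k * h ^+ k).
  apply: (has_sum_sum (u := fun k n => c n * t n k) (s := fun k => d k * h ^+ k)) => k _.
  have hs' := has_sumZ (c := h ^+ k) (hd k); rewrite [d k * _]mulrC.
  by apply: (eq_has_sum hs') => n; rewrite /t; ring.
have hw := has_sumD hs (has_sumN hv).
have w0 n : (n < K)%N -> c n * (z1 + h) ^+ n - \sum_(k < K) c n * t n k = 0.
  move=> nK; rewrite -mulr_sumr -mulrBr tE -(big_mkord xpredT (t n)).
  rewrite [X in _ - X](@big_cat_nat _ _ _ n.+1) //=.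
  have -> : \sum_(n.+1 <= i < K) t n i = 0.
    rewrite big_nat_cond big1 // => i /andP[/andP[ni _] _]; by rewrite /t bin_small // !mul0r.
  by rewrite addr0 subrr mulr0.
have wb n : (K <= n)%N ->
    modulus (c n * (z1 + h) ^+ n - \sum_(k < K) c n * t n k) <= M * q ^+ n.
  move=> Kn; rewrite -mulr_sumr -mulrBr tE -(big_mkord xpredT (t n)).
  rewrite [X in X - _](@big_cat_nat _ _ _ K) //=; last exact: leqW.
  rewrite addrAC subrr add0r modulusM.
  apply: le_trans (term_bound (x := modulus z1 + modulus h) n r0 pb (addr_ge0 z10 h_ge0)).
  rewrite ler_wpM2l ?modulus_ge0 //; apply: le_trans (modulus_sum _ _ _) _.
  have -> : (modulus z1 + modulus h) ^+ n = \sum_(0 <= i < n.+1) modulus (t n i).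
    rewrite exprDn big_mkord; apply: eq_bigr => i _.
    by rewrite -mulr_natl /t mulrA !modulusM !modulusX modulus_nat.
  rewrite [leRHS](@big_cat_nat _ _ _ K) //=; last exact: leqW.
  by rewrite lerDr sumr_ge0 // => i _; exact: modulus_ge0.
have := has_sum_tail (q0 _ h_ge0) (q1 _ hr) wb hw.
rewrite [X in _ - X]big1 ?subr0; last by move=> i _; exact: w0.
by rewrite mulrAC.
Qed.

(** The factor two is the sum of a geometric series of ratio at most one half. *)
Lemma power_tail c (r M : R) z s K : 0 < r -> power_bound c r M -> modulus z <= r / 2 ->
  has_sum (fun n => c n * z ^+ n) s ->
  modulus (s - \sum_(i < K) c i * z ^+ i) <= 2 * M / r ^+ K * modulus z ^+ K.
Proof.
move=> r0 pb zr hs.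
have z0 := modulus_ge0 z.
have q0 : 0 <= modulus z / r by rewrite divr_ge0 // ltW.
have q2 : modulus z / r <= 1 / 2 by rewrite ler_pdivrMr //; lra.
have M0 := power_bound_ge0 r0 pb.
have q1 : modulus z / r < 1 by lra.
apply: le_trans (has_sum_tail (M := M) (K := K) q0 q1 _ hs) _.
  by move=> n _; rewrite modulusM modulusX term_bound.
have -> : 2 * M / r ^+ K * modulus z ^+ K = M * (modulus z / r) ^+ K * 2.
  by rewrite exprMn exprVn; ring.
rewrite ler_wpM2l // ?mulr_ge0 ?exprn_ge0 //.
by rewrite -[leRHS]invrK lef_pV2 ?posrE ?invr_gt0 //; lra.
Qed.

(** Near the origin, the first nonzero coefficient would be at most a multiple of [|z|]. *)
Lemma power_zero c (r M e : R) : 0 < r -> power_bound c r M -> 0 < e ->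
  (forall z, modulus z < e -> has_sum (fun n => c n * z ^+ n) 0) -> forall n, c n = 0.
Proof.
move=> r0 pb e0 h; elim/ltn_ind => m IH; apply/eqP; rewrite -modulus_eq0 eq_le modulus_ge0 andbT.
have M0 := power_bound_ge0 r0 pb.
set A := 2 * M / r ^+ m.+1.
have A0 : 0 <= A by rewrite /A divr_ge0 ?mulr_ge0 ?exprn_ge0 // ltW.
have key t : 0 < t -> t < e -> t <= r / 2 -> modulus (c m) <= A * t.
  move=> t0 te tr; have mt : modulus (t%:C : R[i]) = t by rewrite modulusC gtr0_norm.
  have := power_tail m.+1 r0 pb (z := t%:C) _ (h _ _); rewrite mt => /(_ tr te).
  rewrite big_ord_recr big1 /=; last by move=> i _; rewrite IH ?mul0r.
  rewrite sub0r add0r modulusN modulusM modulusX mt -/A exprS mulrA ler_pM2r //.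
  by rewrite exprn_gt0.
apply/ler_addgt0Pr => eps eps0; rewrite add0r.
set t := Num.min (Num.min (e / 2) (r / 2)) (eps / (A + 1)).
have A1 : 0 < A + 1 by lra.
have t0 : 0 < t by rewrite !lt_min !divr_gt0.
have te : t <= e / 2 by rewrite !ge_min lexx.
have tr : t <= r / 2 by rewrite !ge_min lexx orbT.
have tp : t <= eps / (A + 1) by rewrite !ge_min lexx orbT.
apply: le_trans (key t t0 _ tr) _; first lra.
apply: (@le_trans _ _ ((A + 1) * t)); first by rewrite ler_wpM2r ?lerDl // ltW.
by rewrite mulrC -ler_pdivlMr.
Qed.

Lemma power_unique c d (r r' M M' e : R) (f : R[i] -> R[i]) :
  0 < r -> power_bound c r M -> 0 < r' -> power_bound d r' M' -> 0 < e ->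
  (forall z, modulus z < e -> has_sum (fun n => c n * z ^+ n) (f z)) ->
  (forall z, modulus z < e -> has_sum (fun n => d n * z ^+ n) (f z)) -> c = d.
Proof.
move=> r0 pb r'0 pb' e0 hc hd; apply/funext => n; apply/eqP; rewrite -subr_eq0; apply/eqP.
set rr := Num.min r r'.
have rr0 : 0 < rr by rewrite lt_min r0.
have pc : power_bound c rr M by apply: power_bound_le pb; rewrite ?(ltW rr0) // ge_min lexx.
have pd : power_bound d rr M' by apply: power_bound_le pb'; rewrite ?(ltW rr0) // ge_min lexx orbT.
apply: (power_zero (c := fun n => c n - d n) (M := M + M') rr0 _ e0) => [k|z ze].
  have := pc k; have := pd k; have := modulusD (c k) (- d k); rewrite modulusN => h1 h2 h3.
  apply: (@le_trans _ _ ((modulus (c k) + modulus (d k)) * rr ^+ k)).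
    by rewrite ler_wpM2r // exprn_ge0 // ltW.
  by rewrite mulrDl lerD.
have := has_sumD (hc z ze) (has_sumN (hd z ze)); rewrite subrr => h.
by apply: (eq_has_sum h) => k /=; rewrite mulrBl.
Qed.

Lemma has_sum_power_bound c z s : has_sum (fun n => c n * z ^+ n) s ->
  exists2 M, 0 < M & power_bound c (modulus z) M.
Proof.
move=> /has_sum_bounded [M M0 h]; exists M => // n.
by rewrite -modulusX -modulusM.
Qed.

(** The polynomial [X ^ n - 1] is separable, so it has [n] distinct roots. *)
Lemma primitive_root_exists n : (0 < n)%N -> exists w : R[i], n.-primitive_root w.
Proof.
move=> n0; have [rs] := closed_field_poly_normal ('X^n - 1 : {poly R[i]}).
have /monicP -> : ('X^n - 1 : {poly R[i]}) \is monic by rewrite monicXnsubC.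
rewrite scale1r => E.
have rs_uniq : uniq rs by rewrite -separable_prod_XsubC -E separable_Xn_sub_1 // pnatr_eq0 -lt0n.
have rs_size : (n <= size rs)%N by rewrite -ltnS -(size_prod_XsubC rs id) -E size_XnsubC.
have rs_root : all n.-unity_root rs by apply/allP => z; rewrite -root_prod_XsubC -E.
by have /hasP[w _] := has_prim_root n0 rs_root rs_uniq rs_size; exists w.
Qed.

Lemma modulus_root_unity n (w : R[i]) : (0 < n)%N -> w ^+ n = 1 -> modulus w = 1.
Proof.
move=> n0 wn; apply/eqP; rewrite -(@pexpr_eq1 _ _ n) ?modulus_ge0 //.
by rewrite -modulusX wn modulus1.
Qed.

(** Averaging over the [N]-th roots of unity, times a character, isolates the coefficients of
    index congruent to [n] modulo [N]; for large [N] those other than the [n]-th are negligible.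
    This discrete form replaces the contour integral. *)
Lemma cauchy_estimate c (r M rho B : R) n : 0 < rho -> rho < r -> power_bound c r M ->
  (forall z s, modulus z = rho -> has_sum (fun n => c n * z ^+ n) s -> modulus s <= B) ->
  modulus (c n) * rho ^+ n <= B.
Proof.
move=> rho0 rhor pb hB.
have r0 : 0 < r by exact: lt_trans rhor.
set q := rho / r.
have q0 : 0 <= q by rewrite divr_ge0 // ltW.
have q1 : q < 1 by rewrite ltr_pdivrMr // mul1r.
apply/ler_addgt0Pr => e e0.
have [N0 hN0] := geo_cvg0 (M / (1 - q)) q0 q1 e0.
(* Larger than [n], so that the average keeps the [n]-th coefficient, and large enough to make
   the tail smaller than [e]. *)
set N := maxn N0 n.+1.
have nN : (n < N)%N by rewrite /N leq_maxr.
have N_gt0 : (0 < N)%N by apply: leq_trans nN.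
have NC : (N%:R : R[i]) != 0 by rewrite pnatr_eq0 -lt0n.
have [w pw] := primitive_root_exists N_gt0.
have wN := prim_expr_order pw.
have mw : modulus w = 1 by exact: modulus_root_unity wN.
have w0 : w != 0 by rewrite -modulus_eq0 mw oner_eq0.
pose z j : R[i] := rho%:C * w ^+ j.
have mz j : modulus (z j) = rho by rewrite modulusM modulusX mw expr1n mulr1 modulusC gtr0_norm.
have ex j : exists s, has_sum (fun m => c m * z j ^+ m) s.
  by apply: has_sum_power r0 pb _; rewrite mz.
have [s hs] := choice ex.
have sB j : modulus (s j) <= B by apply: hB (hs j); exact: mz.
have hS : has_sum (fun m => N%:R^-1 * \sum_(j < N) (w ^- n) ^+ j * (c m * z j ^+ m))
    (N%:R^-1 * \sum_(j < N) (w ^- n) ^+ j * s j).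
  apply: has_sumZ; apply: (has_sum_sum (u := fun j m => (w ^- n) ^+ j * (c m * z j ^+ m)) (s := fun j => (w ^- n) ^+ j * s j)) => j _.
  exact: has_sumZ.
set S := (X in has_sum _ X) in hS; set u := (X in has_sum X _) in hS.
have mwn j : modulus ((w ^- n) ^+ j) = 1 by rewrite modulusX modulusV modulusX mw expr1n invr1 expr1n.
have NR : 0 < (N%:R : R) by rewrite ltr0n.
have SB : modulus S <= B.
  rewrite /S modulusM modulusV modulus_nat mulrC ler_pdivrMr //.
  apply: le_trans (modulus_sum _ _ _) _.
  apply: (@le_trans _ _ (\sum_(j < N) B)).
    by apply: ler_sum => j _; rewrite modulusM mwn mul1r.
  by rewrite sumr_const card_ord mulr_natr.
have uE m : u m = c m * rho%:C ^+ m * (N%:R^-1 * \sum_(j < N) (w ^+ m / w ^+ n) ^+ j).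
  rewrite /u [LHS]mulrC [RHS]mulrCA [RHS]mulrC; congr (_ * _); rewrite mulr_sumr.
  apply: eq_bigr => j _; rewrite /z !exprMn -!exprM [(j * m)%N]mulnC; ring.
have ub m : modulus (u m) <= M * q ^+ m.
  apply: le_trans (term_bound m r0 pb (ltW rho0)).
  rewrite uE !modulusM modulusX modulusC gtr0_norm // ler_piMr ?mulr_ge0 ?modulus_ge0 ?exprn_ge0 ?(ltW rho0) //.
  rewrite modulusV modulus_nat mulrC ler_pdivrMr // mul1r.
  apply: le_trans (modulus_sum _ _ _) _.
  apply: (@le_trans _ _ (\sum_(j < N) 1)); last by rewrite sumr_const card_ord.
  by apply: ler_sum => j _; rewrite !modulusX modulusM modulusV !modulusX mw !expr1n invr1 mulr1 expr1n.
have uN : \sum_(m < N) u m = c n * rho%:C ^+ n.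
  rewrite (bigD1 (Ordinal nN)) //= big1 ?addr0 => [|m mn].
    rewrite uE divff ?expf_neq0 // (eq_bigr (fun=> 1)) => [|j _]; last by rewrite expr1n.
    by rewrite sumr_const card_ord mulVf // mulr1.
  rewrite uE; set x := w ^+ m / w ^+ n.
  have x1 : x != 1.
    rewrite -subr_eq0 /x -[X in _ - X](divff (x := w ^+ n)) ?expf_neq0 // -mulrBl mulf_neq0 ?invr_eq0 ?expf_neq0 //.
    rewrite subr_eq0 (eq_prim_root_expr pw) !modn_small //.
  have : (x - 1) * (\sum_(j < N) x ^+ j) = 0.
    by rewrite -subrX1 /x exprMn exprVn -!exprM ![(_ * N)%N]mulnC !exprM wN !expr1n invr1 mulr1 subrr.
  by move/eqP; rewrite mulf_eq0 subr_eq0 (negbTE x1) /= => /eqP ->; rewrite !mulr0.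
have := has_sum_tail (K := N) q0 q1 (fun m _ => ub m) hS; rewrite uN => hT.
have := hN0 N (leq_maxl _ _); rewrite mulrAC => hN.
have -> : modulus (c n) * rho ^+ n = modulus (c n * rho%:C ^+ n).
  by rewrite modulusM modulusX modulusC gtr0_norm.
apply: le_trans (modulus_subD _ S) _; rewrite addrC lerD //.
by rewrite modulusB; apply: le_trans hT (ltW hN).
Qed.

End PowerSeries.

(** * Local expansions of analytic functions *)

Section Analytic.
Variable R : realType.
Implicit Types (c d : nat -> R[i]) (z : R[i]) (f g : R[i] -> R[i]).

(** The radius and the bound are part of the notion because expansions at different centres have
    to be compared uniformly. *)
Definition expands f z0 c (r M : R) :=
  [/\ 0 < r, power_bound c r M &
      forall z, modulus (z - z0) < r -> has_sum (fun n => c n * (z - z0) ^+ n) (f z)].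

Definition analytic_at f z0 := exists c r M, expands f z0 c r M.

Lemma expands_near f z0 c (e : R) : 0 < e ->
  (forall z, modulus (z - z0) < e -> has_sum (fun n => c n * (z - z0) ^+ n) (f z)) ->
  exists M, expands f z0 c (e / 2) M.
Proof.
move=> e0 h; have e2 : 0 < e / 2 by rewrite divr_gt0.
have m2 : modulus (((e / 2)%:C : R[i])) = e / 2 by rewrite modulusC gtr0_norm.
have [|M M0 pb] := has_sum_power_bound (c := c) (z := (e / 2)%:C) (s := f (z0 + (e / 2)%:C)).
  have := h (z0 + (e / 2)%:C); rewrite addrAC subrr add0r m2; apply; lra.
by exists M; split=> // [|z ze]; [rewrite -m2|apply: h; lra].
Qed.

Lemma analytic_onP (U : set R[i]) f :
  analytic_on U f <-> forall z, U z -> analytic_at f z.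
Proof.
split=> h z0 /h.
  move=> [c /nearC [e e0 he]]; have [M hM] := expands_near e0 he.
  by exists c, (e / 2), M.
by move=> [c [r [M [r0 _ hr]]]]; exists c; apply/nearC; exists r.
Qed.

Lemma expands_recenter f z0 c (r M : R) z1 : expands f z0 c r M -> modulus (z1 - z0) < r ->
  exists d, [/\
    forall k, has_sum (fun n => 'C(n, k)%:R * c n * (z1 - z0) ^+ (n - k)) (d k),
    forall h : R, 0 <= h -> modulus (z1 - z0) + h < r ->
      power_bound d h (M / (1 - (modulus (z1 - z0) + h) / r)) &
    forall z, modulus (z1 - z0) + modulus (z - z1) < r ->
      has_sum (fun k => d k * (z - z1) ^+ k) (f z)].
Proof.
move=> [r0 pb hf] z1r; have [d [hd pd sd]] := recenter r0 pb z1r.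
exists d; split=> // z zr; apply: sd => //.
have -> : z1 - z0 + (z - z1) = z - z0 by ring.
apply: hf; have := modulus_triangle z z1 z0; lra.
Qed.

Lemma expands_unique f z0 c d (r M r' M' : R) :
  expands f z0 c r M -> expands f z0 d r' M' -> c = d.
Proof.
move=> [r0 pb hc] [r'0 pb' hd].
have m0 : 0 < Num.min r r' by rewrite lt_min r0.
apply: (power_unique r0 pb r'0 pb' m0 (f := fun z => f (z0 + z))) => z; rewrite lt_min => /andP[zr zr'].
  by have := hc (z0 + z); rewrite addrAC subrr add0r => /(_ zr).
by have := hd (z0 + z); rewrite addrAC subrr add0r => /(_ zr').
Qed.

Lemma disk_series_expands f c : (forall z, disk z -> has_sum (fun n => c n * z ^+ n) (f z)) ->
  forall r : R, 0 < r -> r < 1 -> exists M, expands f 0 c r M.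
Proof.
move=> h r r0 r1; have mr : modulus (r%:C : R[i]) = r by rewrite modulusC gtr0_norm.
have [|M M0 pb] := @has_sum_power_bound _ c r%:C (f r%:C).
  by apply/h/diskP; rewrite mr.
exists M; split=> // [|z]; first by rewrite -mr.
by rewrite subr0 => zr; apply/h/diskP; apply: lt_trans r1.
Qed.

Lemma disk_series_analytic f c : (forall z, disk z -> has_sum (fun n => c n * z ^+ n) (f z)) ->
  analytic_on (@disk R) f.
Proof.
move=> h; apply/analytic_onP => z1 /diskP z11.
have z10 := modulus_ge0 z1.
have r0 : 0 < (1 + modulus z1) / 2 by lra.
have r1 : (1 + modulus z1) / 2 < 1 by lra.
have [M hM] := disk_series_expands h r0 r1.
have [|d [_ _ sd]] := expands_recenter (z1 := z1) hM; first by rewrite subr0; lra.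
have e0 : 0 < (1 - modulus z1) / 2 by lra.
have [z ze|M' hM'] := expands_near (f := f) (z0 := z1) (c := d) e0.
  apply: sd; rewrite subr0; lra.
by exists d, ((1 - modulus z1) / 2 / 2), M'.
Qed.

Lemma mul_succ_geo (q t : R) m : 0 < t -> q = (1 + t)^-1 -> m.+1%:R * q ^+ m <= 1 + t^-1.
Proof.
move=> t0 ->; rewrite exprVn ler_pdivrMr ?exprn_gt0 //; last lra.
have h : 1 + m%:R * t <= (1 + t) ^+ m.
  elim: m => [|m IH]; first by rewrite mul0r addr0 expr0.
  rewrite exprSr; apply: (@le_trans _ _ ((1 + m%:R * t) * (1 + t))).
    have : 0 <= m%:R * t * t by rewrite !mulr_ge0 // ltW.
    rewrite -natr1; nra.
  by rewrite ler_wpM2r //; lra.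
apply: (@le_trans _ _ ((1 + t^-1) * (1 + m%:R * t))); last by rewrite ler_wpM2l // addr_ge0 // invr_ge0 ltW.
have ti : 0 < t^-1 by rewrite invr_gt0.
have -> : (1 + t^-1) * (1 + m%:R * t) = 1 + m%:R * t + t^-1 + m%:R * (t^-1 * t) by ring.
rewrite mulVf ?gt_eqF // -natr1 mulr1; have : 0 <= m%:R * t by rewrite mulr_ge0 // ltW.
lra.
Qed.

(** The [k]-th coefficient of the expansion at a point [z] of the circle is the sum over [m] of
    [C(m,k) c_m z ^ (m - k)], as a function of [z] another power series. Cauchy's estimate
    bounds [C(m,k) |c_m| rho ^ (m - k) delta ^ k] by [B], and summing over [k <= m] gives the
    result. *)
Lemma coefficient_bound f c (r M rho delta B : R) :
  expands f 0 c r M -> 0 < rho -> rho < r -> 0 < delta ->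
  (forall z, modulus z = rho -> exists d, expands f z d delta B) ->
  forall m, modulus (c m) * (rho + delta) ^+ m <= m.+1%:R * B.
Proof.
move=> hc rho0 rhor d0 hB m; have [r0 pb _] := hc.
have hk k : (k <= m)%N -> 'C(m, k)%:R * modulus (c m) * rho ^+ (m - k) * delta ^+ k <= B.
  move=> km; rewrite -ler_pdivlMr ?exprn_gt0 //.
  pose e n := 'C(n + k, k)%:R * c (n + k)%N.
  have he z s : modulus z < r -> has_sum (fun n => 'C(n, k)%:R * c n * z ^+ (n - k)) s ->
      has_sum (fun n => e n * z ^+ n) s.
    move=> zr /(has_sum_shift _ _ k); rewrite big1 ?subr0 => [h|i _]; last by rewrite bin_small // !mul0r.
    by apply: (eq_has_sum h) => n; rewrite /e addnK.
  pose rho' := (rho + r) / 2.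
  have mr' : modulus (rho'%:C : R[i]) = rho' by rewrite modulusC ger0_norm // /rho'; lra.
  have r'r : modulus (rho'%:C : R[i]) < r by rewrite mr' /rho'; lra.
  have [d' [hd' _ _]] := recenter r0 pb r'r.
  have [M' _ pe] := has_sum_power_bound (he _ _ r'r (hd' k)).
  have -> : 'C(m, k)%:R * modulus (c m) * rho ^+ (m - k) = modulus (e (m - k)%N) * rho ^+ (m - k).
    by rewrite /e subnK // modulusM modulus_nat.
  apply: cauchy_estimate pe _ => //; first by rewrite mr' /rho'; lra.
  move=> z s zrho hs.
  have [d hd] := hB z zrho; have [_ pd _] := hd.
  have zr : modulus (z - 0) < r by rewrite subr0 zrho.
  have [d2 [hd2 _ sd2]] := expands_recenter hc zr.
  have e0 : 0 < r - rho by rewrite subr_gt0.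
  have [w we|M2 h2] := expands_near (f := f) (z0 := z) (c := d2) e0.
    by apply: sd2; rewrite subr0 zrho; lra.
  have E := expands_unique hd h2; subst d2.
  have := hd2 k; rewrite subr0 => /he -/(_ _); rewrite zrho => /(_ rhor) hs'.
  by rewrite (has_sum_unique hs hs') ler_pdivlMr ?exprn_gt0 // pd.
have -> : modulus (c m) * (rho + delta) ^+ m =
    \sum_(k < m.+1) 'C(m, k)%:R * modulus (c m) * rho ^+ (m - k) * delta ^+ k.
  rewrite exprDn mulr_sumr; apply: eq_bigr => k _.
  by rewrite -mulr_natl; ring.
apply: (@le_trans _ _ (\sum_(k < m.+1) B)).
  by apply: ler_sum => k _; apply: hk; rewrite -ltnS.
by rewrite sumr_const card_ord mulr_natl.
Qed.

End Analytic.

(** * The global expansion on the disk *)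

Section Taylor.
Variable R : realType.
Implicit Types (c d : nat -> R[i]) (z : R[i]) (f g : R[i] -> R[i]).

(** Recentering an expansion gives expansions at the nearby points with comparable radius and
    bound; compactness makes both uniform. *)
Lemma uniform_expansions f (r : R) : (forall z, modulus z <= r -> analytic_at f z) ->
  exists delta B : R, 0 < delta /\ forall z, modulus z <= r -> exists d, expands f z d delta B.
Proof.
move=> hf.
(* A single natural number bounds both the inverse of the radius and the coefficients. *)
pose P (n : nat) z := exists d, expands f z d (n.+1%:R^-1) n.+1%:R.
have [z0 /hf [c [r0 [M0 hc]]]|N hN] := @closed_disk_uniform R r P; last first.
  exists (N.+1%:R^-1), N.+1%:R; rewrite invr_gt0 ltr0n; split=> // z zr.
  exact: hN N z (leqnn _) zr.
have [r00 pb _] := hc.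
have M00 := power_bound_ge0 r00 pb.
have e0 : 0 < r0 / 4 by rewrite divr_gt0.
exists (r0 / 4) => //.
have [N hN] : exists N, 4 / r0 + 2 * M0 <= N%:R.
  exists (Num.truncn (4 / r0 + 2 * M0)).+1.
  by apply: ltW; rewrite truncnS_gt // num_real.
exists N => z' n zz Nn.
have n1 : 4 / r0 + 2 * M0 <= n.+1%:R.
  by apply: le_trans hN _; rewrite ler_nat; exact: leqW.
have p4 : 0 < 4 / r0 by rewrite divr_gt0.
have zr : modulus (z' - z0) < r0 by lra.
have [d [_ pd sd]] := expands_recenter hc zr.
exists d; have dn : n.+1%:R^-1 <= r0 / 4.
  by rewrite -[leRHS]invrK lef_pV2 ?posrE ?invr_gt0 ?divr_gt0 // invf_div; lra.
have d0 : 0 < (n.+1%:R^-1 : R) by rewrite invr_gt0.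
move: dn d0; set u := n.+1%:R^-1 => dn d0.
split=> // [k|w wz]; last by apply: sd; lra.
apply: le_trans (pd _ (ltW d0) _ k) _; first lra.
move: n1; set v := n.+1%:R => n1.
rewrite ler_pdivrMr.
  have : (modulus (z' - z0) + u) / r0 <= 1 / 2 by rewrite ler_pdivrMr //; lra.
  nra.
by rewrite subr_gt0 ltr_pdivrMr //; lra.
Qed.

(** The local expansions have a common radius [delta] on the closed disk of radius [r], so that
    [coefficient_bound], on a circle of radius closer to [r] than [delta], makes the series
    converge beyond [r]. Its sum agrees there with [f], because recentering it at a point inside
    the smaller disk gives the local expansion of [f], by uniqueness. *)
Lemma expansion_extends f c (r : R) : analytic_on (@disk R) f -> 0 < r -> r < 1 ->
  (forall z, modulus z < r -> has_sum (fun n => c n * z ^+ n) (f z)) ->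
  exists2 r' : R, r < r' & forall z, modulus z < r' -> has_sum (fun n => c n * z ^+ n) (f z).
Proof.
move=> /analytic_onP af r0 r1 hc.
have [|delta [B [d0 hB]]] := @uniform_expansions f r.
  by move=> z zr; apply/af/diskP; lra.
(* Close enough to [r] for [rho + delta] to exceed [r]. *)
pose rho := Num.max (r / 2) (r - delta / 2).
have rho0 : 0 < rho by rewrite lt_max; apply/orP; left; lra.
have rhor : rho < r by rewrite gt_max; apply/andP; split; lra.
have rhod : r - delta / 2 <= rho by rewrite le_max lexx orbT.
pose rho' := (rho + r) / 2.
have rho'r : rho' < r by rewrite /rho'; lra.
have rho'0 : rho < rho' by rewrite /rho'; lra.
have rho'p : 0 < rho' by lra.
have mr : modulus (rho'%:C : R[i]) = rho' by rewrite modulusC gtr0_norm.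
have [|M M0 pb] := @has_sum_power_bound _ c rho'%:C (f rho'%:C).
  by apply: hc; rewrite mr.
rewrite mr in pb.
have hexp : expands f 0 c rho' M.
  by split=> // z; rewrite subr0 => zr; apply: hc; lra.
have cb m : modulus (c m) * (rho + delta) ^+ m <= m.+1%:R * B.
  apply: (coefficient_bound hexp) => // z hz; apply: hB; rewrite hz; exact: ltW.
pose T := rho + delta; pose r2 := (r + T) / 2.
have rT : r < T by rewrite /T; lra.
have r2T : r2 < T by rewrite /r2; lra.
have rr2 : r < r2 by rewrite /r2; lra.
have r20 : 0 < r2 by lra.
have T0 : 0 < T by lra.
pose t := T / r2 - 1.
have t0 : 0 < t by rewrite subr_gt0 ltr_pdivlMr // mul1r.
have B0 : 0 <= B.
  by have := cb 0%N; rewrite expr0 mulr1 mul1r; apply: le_trans; exact: modulus_ge0.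
have pb2 : power_bound c r2 (B * (1 + t^-1)).
  move=> m; have -> : r2 ^+ m = T ^+ m * (r2 / T) ^+ m by rewrite -exprMn mulrCA divff ?mulr1 ?gt_eqF.
  rewrite mulrA; apply: (@le_trans _ _ (m.+1%:R * B * (r2 / T) ^+ m)).
    by rewrite ler_wpM2r // exprn_ge0 // divr_ge0 // ltW.
  rewrite mulrAC mulrC ler_wpM2l //; apply: mul_succ_geo => //.
  by rewrite /t addrC subrK invf_div.
exists r2 => // z zr2.
have [zr|rz] := ltP (modulus z) r; first exact: hc.
have z0 : 0 < modulus z by lra.
have zC : ((modulus z)%:C : R[i]) != 0 by rewrite -modulus_eq0 modulusC normr_eq0 gt_eqF.
pose z1 : R[i] := (rho / modulus z)%:C * z.
have mz1 : modulus z1 = rho.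
  by rewrite modulusM modulusC ger0_norm ?divr_ge0 ?ltW // divfK // gt_eqF.
have mzz1 : modulus (z - z1) = modulus z - rho.
  have -> : z - z1 = (1 - rho / modulus z)%:C * z by rewrite /z1 rmorphB rmorph1 mulrBl mul1r.
  rewrite modulusM modulusC ger0_norm.
    by rewrite mulrBl mul1r divfK // gt_eqF.
  by rewrite subr_ge0 ler_pdivrMr // mul1r; lra.
have [s hs] := has_sum_power r20 pb2 zr2.
have z1r : modulus (z1 - 0) < rho' by rewrite subr0 mz1.
have [d2 [hd2 _ sd2]] := expands_recenter hexp z1r.
have [|d hd] := hB z1; first by rewrite mz1 ltW.
have e0 : 0 < rho' - rho by lra.
have [w we|M2 h2] := expands_near (f := f) (z0 := z1) (c := d2) e0.
  by apply: sd2; rewrite subr0 mz1; lra.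
have E := expands_unique hd h2; subst d2.
have [_ _ /(_ z)] := hd; rewrite mzz1 => /(_ _) h3.
have z1r2 : modulus z1 < r2 by lra.
have [d3 [hd3 _ sd3]] := recenter r20 pb2 z1r2.
have E : d3 = d.
  apply/funext => k; apply: has_sum_unique (hd3 k) _.
  by have := hd2 k; rewrite subr0.
subst d3.
have zz1 : z1 + (z - z1) = z by ring.
have := sd3 (z - z1) s; rewrite zz1 mz1 mzz1 => /(_ _ hs) h4.
have <- // : s = f z.
by apply: has_sum_unique (h4 _) (h3 _); rewrite /T in r2T; lra.
Qed.

(** The supremum of the radii on which the expansion at the origin represents [f] can be
    increased as long as it is smaller than one. *)
Lemma disk_expansion f : analytic_on (@disk R) f ->
  exists c, forall z, disk z -> has_sum (fun n => c n * z ^+ n) (f z).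
Proof.
move=> af; have /analytic_onP af' := af.
have [|c [r0 [M0 [r00 _ hc]]]] := af' 0; first by apply/diskP; rewrite modulus0.
exists c.
pose S := [set r : R | 0 < r <= 1 /\ forall z, modulus z < r -> has_sum (fun n => c n * z ^+ n) (f z)].
pose r1 := Num.min r0 1.
have r10 : 0 < r1 by rewrite lt_min r00 ltr01.
have Sr1 : S r1.
  split; first by rewrite r10 ge_min lexx orbT.
  by move=> z; rewrite lt_min => /andP[zr _]; have := hc z; rewrite subr0; apply.
have supS : has_sup S.
  by split; [exists r1|exists 1 => r [/andP[_ ->]]].
have hsup z : modulus z < sup S -> has_sum (fun n => c n * z ^+ n) (f z).
  move=> zs; have e0 : 0 < sup S - modulus z by rewrite subr_gt0.
  have [r [_ hr] sr] := sup_adherent e0 supS.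
  by apply: hr; lra.
have s0 : 0 < sup S by apply: lt_le_trans r10 _; apply: ub_le_sup Sr1; case: supS.
have [s1|s1] := ltP (sup S) 1.
  have [r' rr' hr'] := expansion_extends af s0 s1 hsup.
  exfalso; have : S (Num.min r' 1).
    split; first by rewrite ge_min lexx orbT lt_min ltr01 (lt_trans s0).
    by move=> z; rewrite lt_min => /andP[zr _]; exact: hr'.
  case: supS => _ us /(ub_le_sup us); rewrite leNgt => /negP; apply.
  by rewrite lt_min rr' s1.
by move=> z /diskP z1; apply: hsup; lra.
Qed.

Lemma disk_series_unique f c d :
  (forall z, disk z -> has_sum (fun n => c n * z ^+ n) (f z)) ->
  (forall z, disk z -> has_sum (fun n => d n * z ^+ n) (f z)) -> c = d.
Proof.
move=> hc hd; have h2 : (1 / 2 : R) < 1 by lra. have h0 : 0 < (1 / 2 : R) by lra.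
have [M hM] := disk_series_expands hc h0 h2; have [M' hM'] := disk_series_expands hd h0 h2.
exact: expands_unique hM hM'.
Qed.

Lemma taylorE f c : (forall z, disk z -> has_sum (fun n => c n * z ^+ n) (f z)) -> taylor f = c.
Proof.
move=> hc; rewrite /taylor; case: xgetP => [d -> /= hd|/(_ c) []//].
exact: disk_series_unique hd hc.
Qed.

Lemma taylorP f : analytic_on (@disk R) f ->
  forall z, disk z -> has_sum (fun n => taylor f n * z ^+ n) (f z).
Proof. by move=> /disk_expansion [c hc]; rewrite (taylorE hc). Qed.

Lemma analytic_continuous f z0 (e : R) : analytic_at f z0 -> 0 < e ->
  exists2 r : R, 0 < r & forall z, modulus (z - z0) < r -> modulus (f z - f z0) < e.
Proof.
move=> [c [r [M [r0 pb hf]]]] e0.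
have M0 := power_bound_ge0 r0 pb.
have f0 : f z0 = c 0%N.
  have h0 : has_sum (fun n => c n * (z0 - z0) ^+ n) (f z0) by apply: hf; rewrite subrr modulus0.
  have m0 : modulus (0 : R[i]) <= r / 2 by rewrite modulus0; lra.
  rewrite subrr in h0; have := power_tail 1 r0 pb m0 h0.
  rewrite big_ord1 expr0 mulr1 modulus0 expr1 mulr0 => h.
  by apply/eqP; rewrite -subr_eq0 -modulus_eq0 eq_le h modulus_ge0.
have A0 : 0 <= 2 * M / r by rewrite divr_ge0 ?mulr_ge0 // ltW.
exists (Num.min (r / 2) (e / (2 * M / r + 1))).
  by rewrite lt_min !divr_gt0 //; lra.
move=> z; rewrite lt_min => /andP[zr ze].
have zr' : modulus (z - z0) < r by lra.
have := power_tail 1 r0 pb (ltW zr) (hf z zr').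
rewrite big_ord1 expr0 mulr1 -f0 !expr1 => h; apply: le_lt_trans h _.
rewrite ltr_pdivlMr in ze; last lra.
have := modulus_ge0 (z - z0); nra.
Qed.

(** The term [k (z - z0) ^ l] is the first nonconstant one of the expansion. *)
Lemma analytic_local f z0 : analytic_at f z0 ->
  (exists2 e : R, 0 < e & forall z, modulus (z - z0) < e -> f z = f z0) \/
  exists l k (C e : R), [/\ (0 < l)%N, k != 0, 0 < e, 0 <= C & forall z, modulus (z - z0) < e ->
    modulus (f z - f z0 - k * (z - z0) ^+ l) <= C * modulus (z - z0) ^+ l.+1].
Proof.
move=> [c [r [M [r0 pb hf]]]].
have M0 := power_bound_ge0 r0 pb.
have f0 : f z0 = c 0%N.
  have h0 : has_sum (fun n => c n * (z0 - z0) ^+ n) (f z0) by apply: hf; rewrite subrr modulus0.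
  have m0 : modulus (0 : R[i]) <= r / 2 by rewrite modulus0; lra.
  rewrite subrr in h0; have := power_tail 1 r0 pb m0 h0.
  rewrite big_ord1 expr0 mulr1 modulus0 expr1 mulr0 => h.
  by apply/eqP; rewrite -subr_eq0 -modulus_eq0 eq_le h modulus_ge0.
have [h|h] := pselect (exists n, (0 < n)%N && (c n != 0)); last first.
  left; exists r => // z zr; have := hf z zr => hs.
  apply: has_sum_unique hs _; rewrite f0.
  apply/has_sumP => e e0; exists 1%N => -[//|n] _.
  rewrite big_ord_recl big1 /= ?addr0 ?expr0 ?mulr1 ?subrr ?modulus0 // => i _.
  have [->|ci] := eqVneq (c (bump 0 i)) 0; first by rewrite mul0r.
  by exfalso; apply: h; exists (bump 0 i).
right; case: (ex_minnP h) => l /andP[l0 cl] lmin.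
exists l, (c l), (2 * M / r ^+ l.+1), (r / 2); split=> //; first lra.
  by rewrite divr_ge0 ?mulr_ge0 ?exprn_ge0 // ltW.
move=> z zr; have zr' : modulus (z - z0) < r by lra.
have := power_tail l.+1 r0 pb (ltW zr) (hf z zr').
rewrite big_ord_recr /= (bigD1 (Ordinal l0)) //= big1 ?addr0 => [|i].
  by rewrite expr0 mulr1 -f0 opprD addrA.
rewrite -val_eqE /= => i0; have [->|ci] := eqVneq (c i) 0; first by rewrite mul0r.
by have := lmin i; rewrite lt0n i0 ci => /(_ isT); rewrite leqNgt ltn_ord.
Qed.

End Taylor.

(** * Zeros and extrema of analytic functions *)

Section LocalTheory.
Variable R : realType.
Implicit Types (c d : nat -> R[i]) (z : R[i]) (f g : R[i] -> R[i]).

Lemma analytic_at_near f z0 c (e : R) : 0 < e ->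
  (forall z, modulus (z - z0) < e -> has_sum (fun n => c n * (z - z0) ^+ n) (f z)) ->
  analytic_at f z0.
Proof. by move=> e0 /(expands_near e0) [M h]; exists c, (e / 2), M. Qed.

Lemma eq_analytic_at f g z0 (e : R) : 0 < e -> (forall z, modulus (z - z0) < e -> f z = g z) ->
  analytic_at f z0 -> analytic_at g z0.
Proof.
move=> e0 fg [c [r [M [r0 pb hf]]]].
apply: (@analytic_at_near _ _ c (Num.min e r)); first by rewrite lt_min e0.
by move=> z; rewrite lt_min => /andP[ze zr]; rewrite -fg //; exact: hf.
Qed.

Lemma analytic_at_mul_linear f z0 (A B : R[i]) :
  analytic_at f z0 -> analytic_at (fun z => (A + B * z) * f z) z0.
Proof.
move=> [c [r [M [r0 pb hf]]]].
pose e n := (A + B * z0) * c n + B * (if n is n'.+1 then c n' else 0).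
apply: (@analytic_at_near _ _ e r) => // z zr.
have h1 := has_sumZ (c := A + B * z0) (hf z zr).
have h2 : has_sum (fun n => B * (if n is n'.+1 then c n' else 0) * (z - z0) ^+ n) (B * (z - z0) * f z).
  apply/(has_sum_shift _ _ 1); rewrite big_ord1 mulr0 mul0r subr0.
  apply: (eq_has_sum (has_sumZ (c := B * (z - z0)) (hf z zr))) => n.
  by rewrite addn1 exprS; ring.
have -> : (A + B * z) * f z = (A + B * z0) * f z + B * (z - z0) * f z by ring.
by apply: (eq_has_sum (has_sumD h1 h2)) => n; rewrite /e; ring.
Qed.

Lemma analytic_at_mul_linearX f z0 (A B : R[i]) m :
  analytic_at f z0 -> analytic_at (fun z => (A + B * z) ^+ m * f z) z0.
Proof.
move=> af; elim: m => [|m IH].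
  by apply: (eq_analytic_at (ltr01 : (0 : R) < 1)) af => z _; rewrite expr0 mul1r.
apply: (eq_analytic_at (ltr01 : (0 : R) < 1)) (analytic_at_mul_linear A B IH) => z _ /=.
by rewrite exprS mulrA.
Qed.

(** The coefficients of the quotient solve a linear recursion. *)
Lemma analytic_at_div_linear f z0 a : z0 != a -> analytic_at f z0 ->
  analytic_at (fun z => f z / (a - z)) z0.
Proof.
move=> z0a [c [r0 [M [r00 pb0 hf]]]].
set s := a - z0; have s0 : s != 0 by rewrite subr_eq0 eq_sym.
have ms : 0 < modulus s by rewrite modulus_gt0.
pose r := Num.min r0 (modulus s / 2).
have r_gt0 : 0 < r by rewrite lt_min r00 divr_gt0.
have rs : r < modulus s by rewrite gt_min; apply/orP; right; lra.
have pb : power_bound c r M by apply: power_bound_le pb0; rewrite ?(ltW r_gt0) // ge_min lexx.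
pose e := fix e n := if n is n'.+1 then (e n' + c n) / s else c 0%N / s.
pose B := M / (modulus s - r).
have B0 : 0 <= B by rewrite divr_ge0 ?(power_bound_ge0 r_gt0 pb) // subr_ge0 ltW.
have BE : B * r + M = B * modulus s.
  by rewrite -[M in LHS](divfK (x := modulus s - r)) ?subr_eq0 ?gt_eqF // -/B; ring.
have pe : power_bound e r B.
  elim=> [|n IH].
    rewrite expr0 mulr1 /= modulusM modulusV ler_pdivrMr // -BE.
    by have := pb 0%N; rewrite expr0 mulr1; have := mulr_ge0 B0 (ltW r_gt0); lra.
  rewrite /= modulusM modulusV mulrAC ler_pdivrMr // -BE.
  apply: (@le_trans _ _ ((modulus (e n) + modulus (c n.+1)) * r ^+ n.+1)).
    by rewrite ler_wpM2r ?modulusD // exprn_ge0 // ltW.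
  rewrite mulrDl lerD // exprSr mulrA ler_wpM2r // ltW //.
apply: (@analytic_at_near _ _ e r) => // z zr.
have [t ht] := has_sum_power r_gt0 pe zr.
have az : a - z != 0.
  rewrite -modulus_gt0; have := modulus_sub s (z - z0).
  have -> : s - (z - z0) = a - z by rewrite /s; ring.
  lra.
suff E : (a - z) * t = f z by rewrite -E mulrC mulKf.
have z1 : modulus (z - z0) < r0 by apply: lt_le_trans zr _; rewrite ge_min lexx.
apply: has_sum_unique (hf z z1).
have -> : (a - z) * t = s * t + (- 1) * ((z - z0) * t) by rewrite /s; ring.
have h1 := has_sumZ (c := s) ht.
have h2 : has_sum (fun n => (if n is n'.+1 then e n' else 0) * (z - z0) ^+ n) ((z - z0) * t).
  apply/(has_sum_shift _ _ 1); rewrite big_ord1 mul0r subr0.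
  apply: (eq_has_sum (has_sumZ (c := z - z0) ht)) => n.
  by rewrite addn1 exprS; ring.
apply: (eq_has_sum (has_sumD h1 (has_sumZ (c := -1) h2))) => -[|n].
  by rewrite /= mul0r mulr0 addr0 expr0 !mulr1 mulrC divfK.
rewrite /= mulrA [s * _]mulrC divfK // mulN1r mulrDl; ring.
Qed.

Lemma analytic_at_div_linearX f z0 a m : z0 != a -> analytic_at f z0 ->
  analytic_at (fun z => f z / (a - z) ^+ m) z0.
Proof.
move=> z0a af; elim: m => [|m IH].
  by apply: (eq_analytic_at (ltr01 : (0 : R) < 1)) af => z _; rewrite expr0 divr1.
apply: (eq_analytic_at (ltr01 : (0 : R) < 1)) (analytic_at_div_linear z0a IH) => z _ /=.
by rewrite exprS invfM mulrA mulrAC.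
Qed.

(** Factoring out the first nonzero term of the expansion. The factor is [a - z] to match the
    numerator of a Blaschke factor. *)
Lemma analytic_at_zero f a : analytic_at f a -> f a = 0 ->
  (forall e : R, 0 < e -> exists2 z, modulus (z - a) < e & f z != 0) ->
  exists m g (e : R), [/\ (0 < m)%N, analytic_at g a, g a != 0, 0 < e &
     forall z, modulus (z - a) < e -> f z = (a - z) ^+ m * g z].
Proof.
move=> [c [r [M [r0 pb hf]]]] fa0 fnz.
have ex : exists n, c n != 0.
  apply: contrapT => h; have [z zr] := fnz r r0; apply/negP; rewrite negbK; apply/eqP.
  apply: has_sum_unique (hf z zr) _.
  apply: (eq_has_sum (@has_sum0 R)) => n; apply/esym.
  have [->|cn] := eqVneq (c n) 0; first by rewrite mul0r.
  by exfalso; apply: h; exists n.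
case: (ex_minnP ex) => m cm mmin.
have h0 i : (i < m)%N -> c i = 0.
  by move=> im; apply/eqP; apply: contraTT im => /mmin; rewrite -leqNgt.
pose e n := (-1) ^+ m * c (n + m)%N.
have pe : power_bound e r (M / r ^+ m).
  move=> n; rewrite modulusM modulusX modulusN modulus1 expr1n mul1r ler_pdivlMr ?exprn_gt0 //.
  by rewrite -mulrA -exprD.
have hg z : modulus (z - a) < r -> exists s, has_sum (fun n => e n * (z - a) ^+ n) s.
  exact: has_sum_power r0 pe.
pose g z := xget 0 [set s | has_sum (fun n => e n * (z - a) ^+ n) s].
have gs z : modulus (z - a) < r -> has_sum (fun n => e n * (z - a) ^+ n) (g z).
  by move=> /hg [s hs]; rewrite /g; case: xgetP => [x _ //|/(_ s)].
have fg z : modulus (z - a) < r -> f z = (a - z) ^+ m * g z.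
  move=> zr; apply: has_sum_unique (hf z zr) _.
  apply/(has_sum_shift _ _ m); rewrite big1 ?subr0 => [|i _]; last by rewrite h0 // mul0r.
  apply: (eq_has_sum (has_sumZ (c := (a - z) ^+ m) (gs z zr))) => n.
  rewrite /e exprD -[a - z]opprB -[- (z - a)]mulN1r exprMn.
  have : (-1 : R[i]) ^+ m * (-1) ^+ m = 1 by rewrite -exprMn mulrNN mulr1 expr1n.
  move: ((-1 : R[i]) ^+ m) => x xx; rewrite -[RHS]mul1r -xx; ring.
have maa : modulus (a - a) < r by rewrite subrr modulus0.
have gm : g a = e 0%N.
  apply: has_sum_unique (gs a maa) _.
  apply/has_sumP => eps eps0; exists 1%N => -[//|n] _.
  rewrite big_ord_recl big1 /= ?addr0 ?expr0 ?mulr1 ?subrr ?modulus0 // => i _.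
  by rewrite expr0n /= mulr0.
have ga : g a != 0 by rewrite gm /e add0n mulf_neq0 // signr_eq0.
exists m, g, r; split=> //.
  case: m cm {mmin h0 e pe hg g gs fg gm ga} => // c0; move: fa0.
  have : f a = c 0%N.
    apply: has_sum_unique (hf a maa) _.
    apply/has_sumP => eps eps0; exists 1%N => -[//|n] _.
    rewrite big_ord_recl big1 /= ?addr0 ?expr0 ?mulr1 ?subrr ?modulus0 // => i _.
    by rewrite expr0n /= mulr0.
  by move=> ->  ec; rewrite ec eqxx in c0.
exact: analytic_at_near gs.
Qed.

(** Take [z - z0] to be a small real multiple of an [l]-th root of [v / k], where [k (z - z0) ^
    l] is the leading term: then [g z - g z0] is close to a positive multiple of [v], and [v]
    may be chosen to be [g z0] or its opposite. *)
Lemma local_extremum g z0 : analytic_at g z0 ->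
  (exists2 e : R, 0 < e & forall z, modulus (z - z0) < e -> g z = g z0) \/
  forall e : R, 0 < e ->
    (exists2 z, modulus (z - z0) < e & modulus (g z0) < modulus (g z)) /\
    (g z0 != 0 -> exists2 z, modulus (z - z0) < e & modulus (g z) < modulus (g z0)).
Proof.
case/analytic_local => [|[l [k [C [e0 [l0 k0 e0_gt0 C0 hg]]]]]]; first by left.
right=> e e_gt0.
have key (v : R[i]) : v != 0 -> exists w, exists t : R, [/\ 0 < t < 1,
     modulus (t%:C * w) < e & modulus (g (z0 + t%:C * w) - (g z0 + (t ^+ l)%:C * v)) < t ^+ l * modulus v].
  move=> v0; exists (l.-root (v / k)); set w := l.-root _.
  have wl : w ^+ l = v / k by rewrite rootCK.
  have mv : 0 < modulus v by rewrite modulus_gt0.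
  have mw := modulus_ge0 w.
  pose D := C * modulus w ^+ l.+1 + 1.
  have D0 : 0 < D by rewrite /D ltr_pwDr // mulr_ge0 // exprn_ge0.
  pose t := Num.min (Num.min (1/2) (modulus v / D)) (Num.min e e0 / (modulus w + 1) / 2).
  have w1 : 0 < modulus w + 1 by lra.
  have ee0 : 0 < Num.min e e0 by rewrite lt_min e_gt0.
  have t0 : 0 < t.
    by rewrite !lt_min; apply/andP; split; [apply/andP; split; [lra|exact: divr_gt0]|rewrite !divr_gt0].
  have t1 : t <= 1 / 2 by rewrite !ge_min lexx.
  have tv : t <= modulus v / D by rewrite !ge_min lexx orbT.
  have tw : t <= Num.min e e0 / (modulus w + 1) / 2 by rewrite ge_min lexx orbT.
  have mtw : modulus (t%:C * w) < Num.min e e0.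
    rewrite modulusM modulusC gtr0_norm //.
    have : t * (modulus w + 1) <= Num.min e e0 / 2.
      by rewrite -ler_pdivlMr // mulrAC.
    lra.
  exists t; split; first by rewrite t0; lra.
    by apply: lt_le_trans mtw _; rewrite ge_min lexx.
  have E : z0 + t%:C * w - z0 = t%:C * w by ring.
  have := hg (z0 + t%:C * w); rewrite E => /(_ (lt_le_trans mtw _)) hgt.
  apply: le_lt_trans (_ : _ <= C * modulus (t%:C * w) ^+ l.+1) _.
    have Ev : (t ^+ l)%:C * v = k * (t%:C * w) ^+ l.
      by rewrite exprMn wl rmorphXn [k * _]mulrC -mulrA divfK.
    rewrite Ev opprD addrA; apply: hgt; by rewrite ge_min lexx orbT.
  rewrite modulusM modulusC gtr0_norm // exprMn exprSr.
  have tl : 0 < t ^+ l by rewrite exprn_gt0.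
  have h : t * D <= modulus v by rewrite -ler_pdivlMr.
  rewrite /D in h.
  have -> : C * (t ^+ l * t * modulus w ^+ l.+1) = t ^+ l * (t * (C * modulus w ^+ l.+1)) by ring.
  rewrite ltr_pM2l //; move: h; rewrite mulrDr mulr1; lra.
have key' (v : R[i]) : v != 0 -> exists (t : R) z, [/\ 0 < t < 1, modulus (z - z0) < e &
     modulus (g z - (g z0 + t%:C * v)) < t * modulus v].
  move=> /key [w [t [/andP[t0 t1] h1 h2]]]; exists (t ^+ l), (z0 + t%:C * w).
  rewrite exprn_gt0 //= addrAC subrr add0r; split=> //.
  by rewrite exprn_ilt1 // ?ltW // -lt0n.
split.
  have [g0|g0] := eqVneq (g z0) 0.
    have [t [z [/andP[t0 t1] h1 h2]]] := key' 1 (oner_neq0 _).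
    exists z => //; rewrite g0 modulus0 modulus_gt0; apply: contraTneq h2 => ->.
    rewrite g0 mulr1 !add0r modulusN modulusC modulus1 mulr1 gtr0_norm // ltxx //.
  have [t [z [/andP[t0 t1] h1 h2]]] := key' _ g0; exists z => //.
  have := modulus_sub (g z0 + t%:C * g z0) (g z); rewrite modulusB.
  have -> : g z0 + t%:C * g z0 = (1 + t)%:C * g z0 by rewrite rmorphD rmorph1; ring.
  rewrite modulusM modulusC ger0_norm; last lra.
  have -> : (1 + t)%:C * g z0 = g z0 + t%:C * g z0 by rewrite rmorphD rmorph1; ring.
  rewrite mulrDl mul1r; lra.
move=> g0; have [|t [z [/andP[t0 t1] h1 h2]]] := key' (- g z0); first by rewrite oppr_eq0.
exists z => //.
have := modulus_subD (g z) (g z0 + t%:C * - g z0).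
have {2}-> : g z0 + t%:C * - g z0 = (1 - t)%:C * g z0 by rewrite rmorphB rmorph1; ring.
rewrite [X in _ + X]modulusM modulusC ger0_norm; last lra.
rewrite modulusN in h2.
rewrite mulrBl mul1r; lra.
Qed.

(** If the infimum of [h] were not attained, [h] would locally, hence uniformly, exceed it by
    some [1 / n]. *)
Lemma extreme_value (K : R[i] -> Prop) (h : R[i] -> R) (r : R) :
  (exists z, K z) -> (forall z, K z -> modulus z <= r) ->
  (forall z, ~ K z -> exists2 e : R, 0 < e & forall z', modulus (z' - z) < e -> ~ K z') ->
  (forall z, K z -> forall e : R, 0 < e -> exists2 d : R, 0 < d &
     forall z', K z' -> modulus (z' - z) < d -> `|h z' - h z| < e) ->
  exists2 p, K p & forall z, K z -> h p <= h z.
Proof.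
move=> [z0 Kz0] Kr Kc hc.
have [|N0 hN0] := @closed_disk_uniform R r (fun n z => K z -> - n%:R <= h z).
  move=> z zr; have [Kz|/Kc [e e0 he]] := pselect (K z); last first.
    by exists e => //; exists 0%N => z' n /he.
  have [d d0 hd] := hc z Kz 1 ltr01; exists d => //.
  exists (Num.truncn (`|h z| + 1)).+1 => z' n z'd nn Kz'.
  have := hd z' Kz' z'd; rewrite ltr_norml => /andP[h1 _].
  have : `|h z| + 1 < n%:R.
    apply: (@lt_le_trans _ _ (Num.truncn (`|h z| + 1)).+1%:R); last by rewrite ler_nat.
    by rewrite truncnS_gt // num_real.
  have := ler_norm (- h z); rewrite normrN; lra.
pose S := [set h z | z in K].
have S0 : has_inf S.
  split; first by exists (h z0); exists z0.
  by exists (- N0%:R) => _ [z Kz <-]; apply: hN0 (leqnn _) (Kr _ Kz) Kz.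
apply: contrapT => hn.
have hlt z : K z -> inf S < h z.
  move=> Kz; rewrite lt_neqAle; apply/andP; split; last first.
    by apply: ge_inf; [case: S0|exists z].
  apply: contra_not_neq hn => E; exists z => // w Kw; rewrite -E.
  by apply: ge_inf; [case: S0|exists w].
have [|N hN] := @closed_disk_uniform R r (fun n z => K z -> inf S + n.+1%:R^-1 <= h z).
  move=> z zr; have [Kz|/Kc [e e0 he]] := pselect (K z); last first.
    by exists e => //; exists 0%N => z' n /he.
  have g0 : 0 < (h z - inf S) / 2 by have := hlt z Kz; lra.
  have [d d0 hd] := hc z Kz _ g0; exists d => //.
  exists (Num.truncn (((h z - inf S) / 2)^-1)) => z' n z'd nn Kz'.
  have := hd z' Kz' z'd; rewrite ltr_norml => /andP[h1 _].
  have : n.+1%:R^-1 <= (h z - inf S) / 2.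
    rewrite -[leRHS]invrK lef_pV2 ?posrE ?invr_gt0 // ltW //.
    apply: (@lt_le_trans _ _ (Num.truncn (((h z - inf S) / 2)^-1)).+1%:R); last by rewrite ler_nat.
    by rewrite truncnS_gt // num_real.
  move: (n.+1%:R^-1) => x; lra.
have e0 : 0 < (N.+1%:R^-1 : R) by rewrite invr_gt0.
have [_ [z Kz <-]] := inf_adherent e0 S0.
by rewrite ltNge; move/negP; apply; apply: hN (leqnn _) (Kr _ Kz) Kz.
Qed.

End LocalTheory.

(** * Modulus principles and bijections of the disk *)

Section Automorphisms.
Variable R : realType.
Implicit Types (z w a : R[i]) (f g phi : R[i] -> R[i]).

(** The values near the circle being large, the minimum is attained on a compact subset, and so
    is the largest modulus of a point where it is attained. *)
Lemma farthest_minimum (h : R[i] -> R) (B rho : R) z0 :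
  (forall z, disk z -> forall e : R, 0 < e -> exists2 d : R, 0 < d &
     forall z', modulus (z' - z) < d -> `|h z' - h z| < e) ->
  disk z0 -> h z0 < B -> rho < 1 -> (forall z, disk z -> rho < modulus z -> B <= h z) ->
  exists p, [/\ disk p, forall z, disk z -> h p <= h z &
     forall z, disk z -> modulus p < modulus z -> h p < h z].
Proof.
move=> hc dz0 hz0 rho1 hB.
pose r := Num.max rho (modulus z0).
have r1 : r < 1 by rewrite gt_max rho1 -/(is_true _); apply/diskP.
have rd z : modulus z <= r -> disk z by move=> zr; apply/diskP; lra.
have hc' z : modulus z <= r -> forall e : R, 0 < e -> exists2 d : R, 0 < d &
     forall z', modulus z' <= r -> modulus (z' - z) < d -> `|h z' - h z| < e.
  by move=> /rd dz e e0; have [d d0 hd] := hc z dz e e0; exists d => // z' _; exact: hd.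
have far z : ~ modulus z <= r -> exists2 e : R, 0 < e & forall z', modulus (z' - z) < e -> ~ modulus z' <= r.
  move=> /negP; rewrite -ltNge => rz; exists (modulus z - r); first by rewrite subr_gt0.
  by move=> z' zz; apply/negP; rewrite -ltNge; have := modulus_sub z z'; rewrite modulusB; lra.
have z0r : modulus z0 <= r by rewrite le_max lexx orbT.
have [p1 p1r hp1] : exists2 p, modulus p <= r & forall z, modulus z <= r -> h p <= h z.
  by apply: (@extreme_value R (fun z => modulus z <= r) h r) => //; exists z0.
have gmin z : disk z -> h p1 <= h z.
  move=> dz; have [zr|rz] := leP (modulus z) r; first exact: hp1.
  apply: le_trans (hp1 _ z0r) _; apply: le_trans (ltW hz0) _; apply: hB => //.
  by apply: le_lt_trans rz; rewrite le_max lexx.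
have [||||p [pr hp] pmax] := @extreme_value R (fun z => modulus z <= r /\ h z <= h p1) (fun z => - modulus z) r.
- by exists p1.
- by move=> z [].
- move=> z hz; have [zr|/far [e e0 he]] := pselect (modulus z <= r); last first.
    by exists e => // z' /he h1 [/h1].
  have hzp : 0 < h z - h p1.
    by rewrite subr_gt0 ltNge; apply/negP => h1; apply: hz.
  have [d d0 hd] := hc z (rd _ zr) _ hzp; exists d => // z' /hd.
  by rewrite ltr_norml => /andP[h1 _] [_ h2]; lra.
- move=> z _ e e0; exists e => // z' _ zz; rewrite -opprD normrN.
  exact: le_lt_trans (modulus_dist _ _) zz.
exists p; split=> [|z dz|z dz pz]; first exact: rd.
  by apply: le_trans hp (gmin z dz).
have [zr|rz] := leP (modulus z) r.
  rewrite ltNge; apply/negP => hzp.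
  have := pmax z (conj zr (le_trans hzp hp)); lra.
apply: le_lt_trans hp _; apply: le_lt_trans (hp1 _ z0r) _; apply: lt_le_trans hz0 _; apply: hB => //.
by apply: le_lt_trans rz; rewrite le_max lexx.
Qed.

(** Maximum and minimum principles. If the minimum of [|g|] over the disk were less than one, it
    would be attained, by the behaviour of [|g|] at the circle. At an extremal point farthest
    from the origin the function cannot be locally constant, since a neighbourhood contains
    points farther away; this avoids any argument by connectedness. *)
Lemma modulus_one g : analytic_on (@disk R) g -> (forall z, disk z -> g z != 0) ->
  (forall e : R, 0 < e -> exists2 rho, rho < 1 &
     forall z, disk z -> rho < modulus z -> 1 - e <= modulus (g z) <= 1 + e) ->
  forall z, disk z -> modulus (g z) = 1.
Proof.
move=> /analytic_onP ag g0 gb z0 dz0.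
have cont z : disk z -> forall e : R, 0 < e -> exists2 d : R, 0 < d &
     forall z', modulus (z' - z) < d -> `|modulus (g z') - modulus (g z)| < e.
  move=> /ag az e e0; have [d d0 hd] := analytic_continuous az e0; exists d => // z' /hd.
  by apply: le_lt_trans; exact: modulus_dist.
have cont' z : disk z -> forall e : R, 0 < e -> exists2 d : R, 0 < d &
     forall z', modulus (z' - z) < d -> `|- modulus (g z') - - modulus (g z)| < e.
  move=> dz e e0; have [d d0 hd] := cont z dz e e0; exists d => // z' /hd.
  by rewrite -opprD normrN.
(* a point further from the origin, still close to [p] *)
have further p (e : R) : disk p -> 0 < e -> exists z, [/\ disk z, modulus (z - p) < e & modulus p < modulus z].
  move=> /diskP dp e0; pose t := Num.min (e / 2) ((1 - modulus p) / 2).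
  have t0 : 0 < t by rewrite lt_min; apply/andP; split; lra.
  have te : t <= e / 2 by rewrite ge_min lexx.
  have t1 : t <= (1 - modulus p) / 2 by rewrite ge_min lexx orbT.
  have [->|p0] := eqVneq p 0.
    exists t%:C; rewrite subr0 modulus0 modulusC gtr0_norm //; split=> //; last lra.
    by apply/diskP; rewrite modulusC gtr0_norm //; have := modulus_ge0 p; lra.
  have mp : 0 < modulus p by rewrite modulus_gt0.
  pose s := t / modulus p.
  have s0 : 0 < s by rewrite divr_gt0.
  have sp : s * modulus p = t by rewrite divfK // gt_eqF.
  have mz : modulus ((1 + s)%:C * p) = modulus p + t.
    by rewrite modulusM modulusC ger0_norm; [rewrite mulrDl mul1r sp|lra].
  exists ((1 + s)%:C * p); split.
  - by apply/diskP; rewrite mz; lra.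
  - have -> : (1 + s)%:C * p - p = s%:C * p by rewrite rmorphD rmorph1; ring.
    by rewrite modulusM modulusC gtr0_norm // sp; lra.
  - by rewrite mz; lra.
have nearD p z : disk p -> modulus (z - p) < 1 - modulus p -> disk z.
  by move=> /diskP dp zp; apply/diskP; have := modulus_subD z p; lra.
have e0 (p : R[i]) : disk p -> 0 < 1 - modulus p by move=> /diskP; rewrite subr_gt0.
apply/eqP; rewrite eq_le; apply/andP; split; rewrite leNgt; apply/negP => h.
  have eps0 : 0 < (modulus (g z0) - 1) / 2 by lra.
  have [rho rho1 hrho] := gb _ eps0.
  have [||p [dp pmin pfar]] := farthest_minimum (B := - (1 + (modulus (g z0) - 1) / 2)) cont' dz0 _ rho1.
  - lra.
  - by move=> z dz /(hrho z dz) /andP[_ hz]; rewrite lerN2.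
  case: (local_extremum (ag _ dp)) => [[e e_gt0 he]|/(_ _ (e0 _ dp)) [[z zp hz] _]].
    have [z [dz zp pz]] := further p e dp e_gt0.
    by have := pfar z dz pz; rewrite he // ltxx.
  by have := pmin z (nearD _ _ dp zp); lra.
have eps0 : 0 < (1 - modulus (g z0)) / 2 by lra.
have [rho rho1 hrho] := gb _ eps0.
have [||p [dp pmin pfar]] := farthest_minimum (B := 1 - (1 - modulus (g z0)) / 2) cont dz0 _ rho1.
- lra.
- by move=> z dz /(hrho z dz) /andP[hz _].
case: (local_extremum (ag _ dp)) => [[e e_gt0 he]|/(_ _ (e0 _ dp)) [_ /(_ (g0 _ dp)) [z zp hz]]].
  have [z [dz zp pz]] := further p e dp e_gt0.
  by have := pfar z dz pz; rewrite he // ltxx.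
by have := pmin z (nearD _ _ dp zp); lra.
Qed.

(** Every coefficient of positive index must vanish, since the first nonzero one would make the
    modulus vary. *)
Lemma constant_of_modulus_one g : analytic_on (@disk R) g -> (forall z, disk z -> modulus (g z) = 1) ->
  forall z, disk z -> g z = g 0.
Proof.
move=> ag g1; have d0 : disk (0 : R[i]) by apply/diskP; rewrite modulus0.
have [c hc] := disk_expansion ag.
have h0 : 0 < (1 / 2 : R) by lra. have h2 : (1 / 2 : R) < 1 by lra.
have /analytic_onP ag' := ag.
case: (local_extremum (ag' _ d0)) => [[e e0 he]|/(_ 1 ltr01) [[z]]]; last first.
  by rewrite subr0 => /diskP dz; rewrite !g1 // ltxx.
have [M hM] := disk_series_expands hc h0 h2.
have K z : has_sum (fun n => (if n is 0%N then g 0 else 0) * z ^+ n) (g 0).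
  apply/has_sumP => eps eps0; exists 1%N => -[//|n] _.
  rewrite big_ord_recl big1 /= ?addr0 ?expr0 ?mulr1 ?subrr ?modulus0 // => i _.
  by rewrite mul0r.
have [z ze|M' hM'] := expands_near (f := g) (z0 := 0) (c := fun n => if n is 0%N then g 0 else 0) e0.
  by rewrite (he z ze) subr0; exact: K.
move=> z dz; apply: has_sum_unique (hc z dz) _.
by rewrite (expands_unique hM hM').
Qed.

(** If a value [w] close to [f z0] is not attained near [z0], then [|f - w|] has a nonzero
    minimum inside a small disk, because injectivity keeps [f] away from [f z0] on the bounding
    circle. *)
Lemma injective_open f z0 : analytic_on (@disk R) f -> {in @disk R &, injective f} -> disk z0 ->
  forall e : R, 0 < e -> exists2 d : R, 0 < d &
    forall w, modulus (w - f z0) < d -> exists2 z, disk z /\ modulus (z - z0) < e & f z = w.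
Proof.
move=> /analytic_onP af finj /[dup] dz0 /diskP mz0 e e0.
pose r := Num.min (e / 2) ((1 - modulus z0) / 2).
have r0 : 0 < r by rewrite lt_min; apply/andP; split; lra.
have re : r <= e / 2 by rewrite ge_min lexx.
have r1 : r <= (1 - modulus z0) / 2 by rewrite ge_min lexx orbT.
have inD z : modulus (z - z0) <= r -> disk z.
  by move=> zr; apply/diskP; have := modulus_subD z z0; lra.
have cont w z : disk z -> forall eps : R, 0 < eps -> exists2 d : R, 0 < d &
    forall z', modulus (z' - z) < d -> `|modulus (f z' - w) - modulus (f z - w)| < eps.
  move=> /af az eps eps0; have [d d0 hd] := analytic_continuous az eps0; exists d => // z' /hd.
  by apply: le_lt_trans; apply: le_trans (modulus_dist _ _) _; rewrite opprB addrA subrK.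
have bd z : modulus (z - z0) <= r -> modulus z <= modulus z0 + r.
  by move=> zr; have := modulus_subD z z0; lra.
have mr : modulus (r%:C : R[i]) = r by rewrite modulusC gtr0_norm.
have [||||p pr pmin] := @extreme_value R (fun z => modulus (z - z0) = r) (fun z => modulus (f z - f z0)) (modulus z0 + r).
- by exists (z0 + r%:C); rewrite addrAC subrr add0r mr.
- by move=> z zr; apply: bd; rewrite zr.
- move=> z zr; exists `|modulus (z - z0) - r|.
    by rewrite normr_gt0 subr_eq0; apply/eqP.
  move=> z' zz z'r; move: zz; rewrite -z'r ltNge => /negP; apply.
  apply: le_trans (modulus_dist _ _) _; rewrite modulusB.
  by have -> : z' - z0 - (z - z0) = z' - z by ring.
- move=> z zr eps eps0; have zr' : modulus (z - z0) <= r by rewrite zr.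
  have [d d0 hd] := cont (f z0) z (inD z zr') eps eps0.
  by exists d => // z' _; exact: hd.
set mu := modulus (f p - f z0) in pmin.
have mu0 : 0 < mu.
  rewrite modulus_gt0 subr_eq0; apply/eqP => /finj E.
  have : p = z0 by apply: E; rewrite inE //; apply: inD; rewrite pr.
  by move=> E'; move: pr; rewrite E' subrr modulus0; lra.
exists (mu / 2); first by rewrite divr_gt0.
move=> w wmu.
have [||||q qr qmin] := @extreme_value R (fun z => modulus (z - z0) <= r) (fun z => modulus (f z - w)) (modulus z0 + r).
- by exists z0; rewrite subrr modulus0 ltW.
- exact: bd.
- move=> z /negP; rewrite -ltNge => rz; exists (modulus (z - z0) - r); first by rewrite subr_gt0.
  move=> z' zz; apply/negP; rewrite -ltNge.
  by have := modulus_triangle z z' z0; rewrite (modulusB z z'); lra.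
- move=> z zr eps eps0; have [d d0 hd] := cont w z (inD z zr) eps eps0.
  by exists d => // z' _; exact: hd.
have qw : modulus (f q - w) < mu / 2.
  by apply: le_lt_trans (qmin z0 _) _; rewrite ?subrr ?modulus0 ?ltW // modulusB.
have qr' : modulus (q - z0) < r.
  rewrite lt_neqAle qr andbT; apply/eqP => E.
  by have := pmin q E; have := modulus_triangle (f q) w (f z0); lra.
exists q; first by split; [exact: inD|lra].
apply/eqP; rewrite -subr_eq0; apply/negPn/negP => fqw.
have aq : analytic_at (fun z => f z - w) q.
  have [c [t [M [t0 pb ht]]]] := af _ (inD _ qr).
  apply: (@analytic_at_near _ _ _ (fun n => c n + if n is 0%N then - w else 0) t) => // z zt.
  have K : has_sum (fun n => (if n is 0%N then - w else 0) * (z - q) ^+ n) (- w).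
    apply/has_sumP => eps eps0; exists 1%N => -[//|n] _.
    rewrite big_ord_recl big1 /= ?addr0 ?expr0 ?mulr1 ?subrr ?modulus0 // => i _.
    by rewrite mul0r.
  by apply: (eq_has_sum (has_sumD (ht z zt) K)) => n; rewrite mulrDl.
have rq : 0 < r - modulus (q - z0) by rewrite subr_gt0.
have nearq z : modulus (z - q) < r - modulus (q - z0) -> modulus (z - z0) <= r.
  by move=> zq; have := modulus_triangle z q z0; lra.
case: (local_extremum aq) => [[t t0 ht]|/(_ _ rq) [_ /(_ fqw) [z /nearq zr hz]]]; last first.
  by have := qmin z zr; lra.
pose t' := Num.min (t / 2) ((r - modulus (q - z0)) / 2).
have t'0 : 0 < t' by rewrite lt_min; apply/andP; split; lra.
have t't : t' <= t / 2 by rewrite ge_min lexx.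
have t'r : t' <= (r - modulus (q - z0)) / 2 by rewrite ge_min lexx orbT.
have mt : modulus (q + t'%:C - q) = t' by rewrite addrAC subrr add0r modulusC gtr0_norm.
have := ht (q + t'%:C); rewrite mt => /(_ _)/addIr E.
have : q + t'%:C = q.
  apply: finj; rewrite ?inE; [apply: inD; apply: nearq; rewrite mt; lra|exact: inD|].
  apply: E; lra.
by move=> E'; move: mt; rewrite E' subrr modulus0; lra.
Qed.

(** By surjectivity and openness, every point of the closed disk of radius [r] has a
    neighbourhood whose preimage stays away from the circle; compactness makes the distance
    uniform. *)
Lemma automorphism_proper phi : is_automorphism phi ->
  forall r : R, r < 1 -> exists2 rho : R, rho < 1 &
    forall z, disk z -> rho < modulus z -> r < modulus (phi z).
Proof.
move=> [aphi [pfun pinj psurj]] r r1.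
have [|N hN] := @closed_disk_uniform R r (fun n w => forall z, disk z -> phi z = w -> modulus z <= 1 - n.+1%:R^-1).
  move=> w wr; have dw : disk w by apply/diskP; lra.
  have [z0 dz0 pz0] := psurj w dw.
  have /diskP mz0 := dz0.
  have e0 : 0 < (1 - modulus z0) / 2 by lra.
  have [d d0 hd] := injective_open aphi pinj dz0 e0; exists d => //.
  exists (Num.truncn (((1 - modulus z0) / 2)^-1)) => w' n w'd Nn z dz pz.
  have [|z1 [dz1 z1z0] pz1] := hd w'; first by rewrite pz0.
  have -> : z = z1 by apply: pinj; rewrite ?inE // pz pz1.
  have : n.+1%:R^-1 <= (1 - modulus z0) / 2.
    rewrite -[leRHS]invrK lef_pV2 ?posrE ?invr_gt0 // ltW //.
    apply: (@lt_le_trans _ _ (Num.truncn (((1 - modulus z0) / 2)^-1)).+1%:R); last by rewrite ler_nat.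
    by rewrite truncnS_gt // num_real.
  have := modulus_subD z1 z0; move: (n.+1%:R^-1) => x; lra.
exists (1 - N.+1%:R^-1).
  by rewrite ltrBlDr ltrDl invr_gt0.
move=> z dz zN; rewrite ltNge; apply/negP => pr.
by have := hN N (phi z) (leqnn _) pr z dz erefl; rewrite leNgt zN.
Qed.

End Automorphisms.

(** * Blaschke factors and the form of the automorphisms *)

Section Blaschke.
Variable R : realType.
Implicit Types (z w a : R[i]) (f g phi : R[i] -> R[i]).

Lemma blaschke_identity a z :
  modulus (1 - a^* * z) ^+ 2 - modulus (a - z) ^+ 2 = (1 - modulus a ^+ 2) * (1 - modulus z ^+ 2).
Proof.
rewrite !modulusE; case: a => x y; case: z => u v /=.
ring.
Qed.

Lemma modulus_denominator a z : modulus z <= 1 -> 1 - modulus a <= modulus (1 - a^* * z).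
Proof.
move=> z1; have := modulus_sub 1 (a^* * z); rewrite modulus1 modulusM modulus_conj.
have := ler_wpM2l (modulus_ge0 a) z1; lra.
Qed.

Lemma denominator_neq0 a z : disk a -> modulus z <= 1 -> 1 - a^* * z != 0.
Proof.
by move=> /diskP a1 z1; rewrite -modulus_gt0; have := modulus_denominator a z1; lra.
Qed.

Lemma disk_closed z : disk z -> modulus z <= 1. Proof. by move=> /diskP /ltW. Qed.

(** The involutive automorphism exchanging [a] and the origin. *)
Definition blaschke a z := (a - z) / (1 - a^* * z).

Lemma modulus_blaschke a z : disk a -> modulus z <= 1 ->
  1 - modulus (blaschke a z) ^+ 2 =
  (1 - modulus a ^+ 2) * (1 - modulus z ^+ 2) / modulus (1 - a^* * z) ^+ 2.
Proof.
move=> da z1; rewrite -blaschke_identity /blaschke modulusM modulusV.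
have := denominator_neq0 da z1; rewrite -modulus_gt0 => q0.
field; by rewrite gt_eqF.
Qed.

Lemma blaschke_disk a z : disk a -> disk z -> disk (blaschke a z).
Proof.
move=> da dz; apply/diskP.
have := modulus_blaschke da (disk_closed dz).
have q0 := denominator_neq0 da (disk_closed dz); rewrite -modulus_gt0 in q0.
have /diskP a1 := da; have /diskP z1 := dz.
have a0 := modulus_ge0 a; have z0 := modulus_ge0 z; have b0 := modulus_ge0 (blaschke a z).
have : 0 < (1 - modulus a ^+ 2) * (1 - modulus z ^+ 2) / modulus (1 - a^* * z) ^+ 2.
  by rewrite divr_gt0 ?exprn_gt0 // mulr_gt0 // subr_gt0 exprn_ilt1.
nra.
Qed.

Lemma blaschkeK a z : disk a -> modulus z <= 1 -> blaschke a (blaschke a z) = z.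
Proof.
move=> da z1; have q0 := denominator_neq0 da z1.
have a0 : 1 - a^* * a != 0 by apply: denominator_neq0 => //; exact: disk_closed.
rewrite /blaschke.
have -> : a - (a - z) / (1 - a^* * z) = z * (1 - a^* * a) / (1 - a^* * z) by field.
have -> : 1 - a^* * ((a - z) / (1 - a^* * z)) = (1 - a^* * a) / (1 - a^* * z) by field.
by field; rewrite a0 q0.
Qed.

Lemma bernoulli_ineq (t : R) m : 0 <= t <= 1 -> 1 - m%:R * t <= (1 - t) ^+ m.
Proof.
move=> /andP[t0 t1]; elim: m => [|m IH]; first by rewrite mul0r subr0 expr0.
rewrite exprSr; apply: (@le_trans _ _ ((1 - m%:R * t) * (1 - t))).
  have : 0 <= m%:R * t * t by rewrite !mulr_ge0.
  rewrite -natr1; nra.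
by rewrite ler_wpM2r // subr_ge0.
Qed.

(** Let [m] be the order of the zero [a] of [phi]. The quotient of [phi] by the [m]-th power of
    the Blaschke factor is analytic without zeros, and its modulus tends to one at the circle
    since both functions are proper; hence it is a unimodular constant. If [m] were larger than
    one, two points with Blaschke images differing by an [m]-th root of unity would have the
    same image. *)
Lemma automorphism_form phi a : disk a -> is_automorphism phi -> phi a = 0 ->
  exists2 lam : R[i], modulus lam = 1 & forall z, disk z -> phi z = lam * blaschke a z.
Proof.
move=> da aut pa; have [aphi [pfun pinj psurj]] := aut.
have /analytic_onP ap := aphi.
have /diskP a1 := da; have a0 := modulus_ge0 a.
have phi0 z : disk z -> z != a -> phi z != 0.
  move=> dz; apply: contra_neq; rewrite -pa => E; apply: pinj; rewrite ?inE //.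
have [e e0|m [G [e [m0 aG Ga e0 hG]]]] := analytic_at_zero (ap _ da) pa.
  pose t := Num.min (e / 2) ((1 - modulus a) / 2).
  have t0 : 0 < t by rewrite lt_min; apply/andP; split; lra.
  have te : t <= e / 2 by rewrite ge_min lexx.
  have t1 : t <= (1 - modulus a) / 2 by rewrite ge_min lexx orbT.
  have mt : modulus (a + t%:C - a) = t by rewrite addrAC subrr add0r modulusC gtr0_norm.
  exists (a + t%:C); first by rewrite mt; lra.
  apply: phi0; first by apply/diskP; have := modulus_subD (a + t%:C) a; rewrite mt; lra.
  by rewrite -subr_eq0 -modulus_gt0 mt.
have qE z : 1 + (- a^*) * z = 1 - a^* * z by rewrite mulNr.
pose g z := if z == a then (1 + (- a^*) * a) ^+ m * G a else (1 + (- a^*) * z) ^+ m * phi z / (a - z) ^+ m.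
have ga z : z != a -> g z = (1 + (- a^*) * z) ^+ m * phi z / (a - z) ^+ m.
  by rewrite /g => /negbTE ->.
have ag : analytic_on (@disk R) g.
  apply/analytic_onP => z0 dz0; have [->|z0a] := eqVneq z0 a.
    apply: (eq_analytic_at e0) (analytic_at_mul_linearX 1 (- a^*) m aG) => z ze.
    rewrite /g; have [->//|za] := eqVneq z a.
    have az : a - z != 0 by rewrite subr_eq0 eq_sym.
    by rewrite hG // mulrCA [RHS]mulrAC divff ?expf_neq0 // mul1r.
  have d0 : 0 < modulus (z0 - a) by rewrite modulus_gt0 subr_eq0.
  apply: (eq_analytic_at d0) (analytic_at_div_linearX m z0a (analytic_at_mul_linearX 1 (- a^*) m (ap _ dz0))) => z zd.
  rewrite ga //; apply: contraTneq zd => ->.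
  by rewrite -leNgt modulusB.
have g0 z : disk z -> g z != 0.
  move=> dz; have q0 := denominator_neq0 da (disk_closed dz); rewrite -qE in q0.
  have [E|za] := eqVneq z a.
    by move: q0; rewrite E /g eqxx => q0; rewrite mulf_neq0 ?expf_neq0.
  have az : a - z != 0 by rewrite subr_eq0 eq_sym.
  by rewrite ga // !mulf_neq0 ?invr_eq0 ?expf_neq0 // phi0.
have gb (eps : R) : 0 < eps -> exists2 rho, rho < 1 &
     forall z, disk z -> rho < modulus z -> 1 - eps <= modulus (g z) <= 1 + eps.
  move=> eps0.
  have e1 : 1 - eps < 1 by lra.
  have [r1 r11 hr1] := automorphism_proper aut e1.
  pose d := eps / (m%:R * (1 + eps)).
  have mR : 1 <= (m%:R : R) by rewrite ler1n.
  have me : 0 < m%:R * (1 + eps) by rewrite mulr_gt0 //; lra.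
  have d0 : 0 < d by rewrite divr_gt0.
  have d1 : d <= 1 by rewrite ler_pdivrMr //; nra.
  have dE : m%:R * (1 + eps) * d = eps by rewrite mulrC divfK // gt_eqF.
  pose r2 := 1 - d * (1 - modulus a) ^+ 2 / 2.
  have c0 : 0 < d * (1 - modulus a) ^+ 2 by rewrite mulr_gt0 // exprn_gt0 // subr_gt0.
  exists (Num.max (Num.max r1 r2) (modulus a)).
    by rewrite !gt_max r11 a1 andbT /= /r2; lra.
  move=> z dz; rewrite !gt_max => /andP[/andP[z1 z2] z3].
  have za : z != a by apply: contraTneq z3 => ->; rewrite ltxx.
  have az : a - z != 0 by rewrite subr_eq0 eq_sym.
  have q0 := denominator_neq0 da (disk_closed dz).
  have gE : modulus (g z) = modulus (phi z) / modulus (blaschke a z) ^+ m.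
    rewrite ga // qE /blaschke !modulusM !modulusV !modulusX exprMn exprVn.
    by field; rewrite !expf_neq0 // modulus_eq0.
  have p1 := hr1 z dz z1.
  have p2 : modulus (phi z) < 1 by apply/diskP; exact: pfun.
  have /diskP b1 := blaschke_disk da dz.
  have b0 : 0 < modulus (blaschke a z) by rewrite modulus_gt0 mulf_neq0 // invr_eq0.
  set s := modulus (blaschke a z) in gE b1 b0.
  have sd : 1 - d <= s.
    have := modulus_blaschke da (disk_closed dz); rewrite -/s.
    have qm := modulus_denominator a (disk_closed dz).
    have q0' : 0 < modulus (1 - a^* * z) by rewrite modulus_gt0.
    have /diskP z1' := dz; have z0' := modulus_ge0 z.
    suff : (1 - modulus a ^+ 2) * (1 - modulus z ^+ 2) / modulus (1 - a^* * z) ^+ 2 <= d by nra.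
    rewrite ler_pdivrMr ?exprn_gt0 //.
    apply: (@le_trans _ _ (d * (1 - modulus a) ^+ 2)); last first.
      rewrite ler_pM2l // lerXn2r ?nnegrE //; [lra|exact: ltW].
    apply: (@le_trans _ _ (1 - modulus z ^+ 2)).
      rewrite ler_piMl ?subr_ge0 ?exprn_ile1 ?(ltW z1') // lerBlDr lerDl sqr_ge0 //.
    move: z2; rewrite /r2; nra.
  have sm : 1 - m%:R * d <= s ^+ m.
    apply: (@le_trans _ _ ((1 - d) ^+ m)); first by apply: bernoulli_ineq; rewrite d1 ltW.
    by rewrite lerXn2r ?nnegrE // ?subr_ge0 // ltW.
  have sm0 : 0 < s ^+ m by rewrite exprn_gt0.
  have sm1 : s ^+ m <= 1 by rewrite exprn_ile1 // ltW.
  have pp := modulus_ge0 (phi z).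
  rewrite gE ler_pdivlMr // ler_pdivrMr //; apply/andP; split; last by nra.
  by have [?|?] := leP 0 (1 - eps); nra.
have g1 := modulus_one ag g0 gb.
have gc := constant_of_modulus_one ag g1.
set k := g 0 in gc.
have k1 : modulus k = 1 by apply: g1; apply/diskP; rewrite modulus0.
have phiE z : disk z -> phi z = k * blaschke a z ^+ m.
  move=> dz; have [->|za] := eqVneq z a.
    by rewrite pa /blaschke subrr mul0r expr0n -[m]prednK //= mulr0.
  have az : a - z != 0 by rewrite subr_eq0 eq_sym.
  have q0 := denominator_neq0 da (disk_closed dz).
  rewrite -(gc z dz) ga // qE /blaschke exprMn exprVn.
  by field; rewrite !expf_neq0.
have m1 : m = 1%N.
  apply/eqP; rewrite eqn_leq m0 andbT leqNgt; apply/negP => m2.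
  have [w pw] := primitive_root_exists R m0.
  have wm := prim_expr_order pw.
  have mw : modulus w = 1 by exact: modulus_root_unity wm.
  have h2 : disk (2^-1 : R[i]).
    by apply/diskP; rewrite modulusV modulus_nat; lra.
  have hw : disk (w / 2).
    by apply/diskP; rewrite modulusM modulusV modulus_nat mw; lra.
  have b2 := blaschke_disk da h2; have bw := blaschke_disk da hw.
  have : blaschke a (2^-1) = blaschke a (w / 2).
    apply: pinj; rewrite ?inE // !phiE // !blaschkeK ?disk_closed //.
    by rewrite exprMn wm mul1r.
  move=> /(congr1 (blaschke a)); rewrite !blaschkeK ?disk_closed // => E.
  have w1 : w = 1.
    have := congr1 (fun x => 2 * x) E; rewrite /= divff ?pnatr_eq0 // mulrCA divff ?pnatr_eq0 // mulr1 //.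
  have := eq_prim_root_expr pw 0 1; rewrite expr0 expr1 w1 eqxx !modn_small //.
by exists k => // z dz; rewrite phiE // m1 expr1.
Qed.

End Blaschke.

(** * The principal power on the right half-plane *)

Section ComplexPower.
Variable R : realType.
Implicit Types (z w : R[i]) (g x : R).

Definition cis x : R[i] := cos x +i* sin x.

Lemma cisD x y : cis (x + y) = cis x * cis y.
Proof. by rewrite /cis cosD sinD; simpc; congr (_ +i* _); rewrite addrC. Qed.

Lemma cis0 : cis 0 = 1.
Proof. by rewrite /cis cos0 sin0. Qed.

Lemma cisN x : cis (- x) = (cis x)^*.
Proof. by rewrite /cis cosN sinN. Qed.

Lemma modulus_cis x : modulus (cis x) = 1.
Proof.
apply/eqP; rewrite -(@eqrXn2 _ 2) ?modulus_ge0 // modulusE /= cos2Dsin2 expr1n //.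
Qed.

Lemma cis_eq1 x : cis x = 1 -> - (pi *+ 2) < x < pi *+ 2 -> x = 0.
Proof.
move=> [cx _]; rewrite mulr2n => /andP[x1 x2].
have s0 : sin (x / 2) = 0.
  have := cos_mulr2n (x / 2); rewrite [x / 2 *+ 2]mulr2n -splitr cx cos2sin2 => h.
  have : sin (x / 2) ^+ 2 = 0 by lra.
  by move/eqP; rewrite sqrf_eq0 => /eqP.
have [xp|xn|//] := ltrgtP 0 x.
  have : 0 < sin (x / 2) by apply: sin_gt0_pi; apply/andP; split; lra.
  by rewrite s0 ltxx.
have : 0 < sin (- x / 2) by apply: sin_gt0_pi; apply/andP; split; lra.
by rewrite mulNr sinN s0 oppr0 ltxx.
Qed.

Lemma right_half_modulus z : 0 < complex.Re z -> 0 < modulus z.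
Proof.
by move=> h; rewrite modulus_gt0; apply: contraTneq h => ->; rewrite ltxx.
Qed.

Lemma right_half_ratio z : 0 < complex.Re z -> 0 < complex.Re z / modulus z <= 1.
Proof.
move=> h; have m0 := right_half_modulus h.
by rewrite divr_gt0 //= ler_pdivrMr // mul1r; exact: le_trans (ler_norm _) (normRe_le _).
Qed.

Lemma cos_arg z : 0 < complex.Re z -> cos (arg z) = complex.Re z / modulus z.
Proof.
move=> h; have /andP[r0 r1] := right_half_ratio h.
have e : complex.Re z / modulus z \in `[-1, 1] by rewrite in_itv /= r1 andbT; lra.
by rewrite /arg; case: ifP => _; rewrite ?cosN acosK.
Qed.

Lemma sin_arg z : 0 < complex.Re z -> sin (arg z) = complex.Im z / modulus z.
Proof.
move=> h; have /andP[r0 r1] := right_half_ratio h; have m0 := right_half_modulus h.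
have e : -1 <= complex.Re z / modulus z <= 1 by rewrite r1 andbT; lra.
have k : Num.sqrt (1 - (complex.Re z / modulus z) ^+ 2) = `|complex.Im z / modulus z|.
  rewrite -sqrtr_sqr; congr Num.sqrt; rewrite !exprMn exprVn.
  have := modulusE z; move: (modulus z ^+ 2) (sqr_ge0 (modulus z)) => y _ yE.
  have y0 : y != 0.
    rewrite yE paddr_eq0 ?sqr_ge0 //; apply/negP => /andP[]; rewrite expf_eq0 /= => /eqP E _; lra.
  by rewrite (_ : complex.Re z ^+ 2 = y - complex.Im z ^+ 2); [field|rewrite yE; ring].
rewrite /arg; case: ifP => hi.
  by rewrite sin_acos // k ger0_norm // divr_ge0 // ltW.
have hi' : complex.Im z < 0 by rewrite ltNge hi.
rewrite sinN sin_acos // k ltr0_norm ?opprK //.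
by rewrite mulrC pmulr_rlt0 // invr_gt0.
Qed.

Lemma polar z : 0 < complex.Re z -> z = (modulus z)%:C * cis (arg z).
Proof.
move=> h; have m0 := right_half_modulus h.
rewrite /cis cos_arg // sin_arg //; case: z h m0 => x y h m0 /=; simpc.
by congr (_ +i* _); rewrite mulrC divfK // gt_eqF.
Qed.

Lemma arg_bound z : 0 < complex.Re z -> - (pi / 2) < arg z < pi / 2.
Proof.
move=> h; have /andP[r0 r1] := right_half_ratio h.
have e : -1 <= complex.Re z / modulus z <= 1 by rewrite r1 andbT; lra.
have b : acos (complex.Re z / modulus z) < pi / 2.
  rewrite ltNge; apply/negP => hb.
  have : cos (acos (complex.Re z / modulus z)) <= 0.
    have := acos_lepi e; move: (acos _) hb => t tb tp.
    have := @sin_gt0_pi; have -> : t = (t - pi / 2) + pi / 2 by ring.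
    rewrite cosDpihalf oppr_le0 => _.
    have [->|tn] := eqVneq t (pi / 2); first by rewrite subrr sin0.
    apply/ltW/sin_gt0_pi; have := pi_gt0 R; move: tn; rewrite neq_lt => /orP[]; move=> ? ?; apply/andP; split; lra.
  by rewrite acosK ?in_itv //= leNgt r0.
have a0 := acos_ge0 e; have p0 := pi_gt0 R.
by rewrite /arg; case: ifP => _; apply/andP; split; lra.
Qed.

Lemma arg_atan z : 0 < complex.Re z -> arg z = atan (complex.Im z / complex.Re z).
Proof.
move=> h; have b := arg_bound h; have m0 := right_half_modulus h.
rewrite -[LHS]tanK ?in_itv //=; congr atan; rewrite /tan cos_arg // sin_arg //.
by field; rewrite !gt_eqF.
Qed.

Lemma conj_real x : (x%:C)^* = x%:C :> R[i].
Proof. by apply: complex_eq => //=; rewrite oppr0. Qed.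

Lemma arg_conj z : 0 < complex.Re z -> arg z^* = - arg z.
Proof.
move=> h; have h' : 0 < complex.Re z^* by case: z h.
rewrite !arg_atan // -atanN; congr atan; case: z {h h'} => x y /=; by rewrite mulNr.
Qed.

Lemma arg_real x : 0 < x -> arg (x%:C : R[i]) = 0.
Proof. by move=> x0; rewrite arg_atan //= mul0r atan0. Qed.

Lemma cpowr_conj z g : 0 < complex.Re z -> cpowr z^* g = (cpowr z g)^*.
Proof.
move=> h; rewrite /cpowr -!/(cis _) arg_conj // mulrN cisN modulus_conj rmorphM /=.
by rewrite conj_real.
Qed.

Lemma cpowr_real x g : 0 < x -> cpowr (x%:C : R[i]) g = (x `^ g)%:C.
Proof.
move=> x0; rewrite /cpowr arg_real // mulr0 -/(cis 0) cis0 mulr1 modulusC gtr0_norm //.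
Qed.

Lemma cpowr_1 z : 0 < complex.Re z -> cpowr z 1 = z.
Proof.
by move=> h; rewrite /cpowr mul1r -/(cis _) powRr1 ?modulus_ge0 // -polar.
Qed.

Lemma modulus_cpowr z g : modulus (cpowr z g) = modulus z `^ g.
Proof. by rewrite /cpowr -/(cis _) modulusM modulus_cis mulr1 modulusC ger0_norm // powR_ge0. Qed.

Lemma cpowr_neq0 z g : z != 0 -> cpowr z g != 0.
Proof.
by rewrite -modulus_eq0 => h; rewrite -modulus_eq0 modulus_cpowr powR_eq0 (negbTE h).
Qed.

Lemma arg_sum_bound z1 z2 z3 z4 : 0 < complex.Re z1 -> 0 < complex.Re z2 ->
  0 < complex.Re z3 -> 0 < complex.Re z4 ->
  - (pi *+ 2) < arg z1 + arg z2 + arg z3 - arg z4 < pi *+ 2.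
Proof.
move=> /arg_bound/andP[a1 b1] /arg_bound/andP[a2 b2] /arg_bound/andP[a3 b3] /arg_bound/andP[a4 b4].
by rewrite mulr2n; apply/andP; split; lra.
Qed.

(** In the right half-plane the arguments of four points add up, with any signs, to less than a
    full turn, so that the principal power respects such a relation. *)
Lemma cpowr_mul3 z1 z2 z3 z4 (c : R) g : 0 < complex.Re z1 -> 0 < complex.Re z2 ->
  0 < complex.Re z3 -> 0 < complex.Re z4 -> 0 < c -> z1 * z2 * z3 = c%:C * z4 ->
  cpowr z1 g * cpowr z2 g * cpowr z3 g = (c `^ g)%:C * cpowr z4 g.
Proof.
move=> h1 h2 h3 h4 c0 E.
have m := congr1 (@modulus R) E; rewrite !modulusM modulusC gtr0_norm // in m.
have m4 := right_half_modulus h4.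
have A : arg z1 + arg z2 + arg z3 = arg z4.
  apply/eqP; rewrite -subr_eq0; apply/eqP/cis_eq1; last exact: arg_sum_bound.
  rewrite cisD cisN.
  have : (c * modulus z4)%:C * cis (arg z1 + arg z2 + arg z3) = (c * modulus z4)%:C * cis (arg z4).
    have E' : z1 * z2 * z3 = (modulus z1 * modulus z2 * modulus z3)%:C * (cis (arg z1) * cis (arg z2) * cis (arg z3)).
      rewrite {1}(polar h1) {1}(polar h2) {1}(polar h3) !rmorphM /=; ring.
    by rewrite -{1}m !cisD -E' E {1}(polar h4) [(c * _)%:C]rmorphM mulrA.
  have cm : (c * modulus z4)%:C != 0 :> R[i].
    by rewrite -modulus_eq0 modulusC normr_eq0 mulf_neq0 // gt_eqF.
  by move/(mulfI cm) => ->; rewrite mulcJ modulus_cis expr1n.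
rewrite /cpowr -!/(cis _) -A !mulrDr !cisD.
have -> : (c `^ g)%:C * ((modulus z4 `^ g)%:C * (cis (g * arg z1) * cis (g * arg z2) * cis (g * arg z3))) =
   ((c * modulus z4) `^ g)%:C * (cis (g * arg z1) * cis (g * arg z2) * cis (g * arg z3)) :> R[i].
  by rewrite powRM ?(ltW c0) ?modulus_ge0 // rmorphM mulrA.
rewrite -m !powRM ?mulr_ge0 ?modulus_ge0 // !rmorphM /=; ring.
Qed.

Lemma re_one_sub z : modulus z < 1 -> 0 < complex.Re (1 - z).
Proof.
by move=> z1; rewrite ReD ReN subr_gt0 /=; apply: le_lt_trans z1; apply: le_trans (ler_norm _) (normRe_le _).
Qed.

End ComplexPower.

(** * The binomial series *)

Section BinomialSeries.
Variable R : realType.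
Implicit Types (z : R[i]) (g x t : R).

(** The coefficient of [z ^ n] in [(1 - z) ^ (- g)]. *)
Fixpoint binomial_coef (g : R) (n : nat) : R :=
  if n is n'.+1 then binomial_coef g n' * ((g + n'%:R) / n'.+1%:R) else 1.

Lemma binomial_coef_gt0 g n : 0 < g -> 0 < binomial_coef g n.
Proof.
by move=> g0; elim: n => //= n IH; rewrite mulr_gt0 // divr_gt0 // ltr_wpDr.
Qed.

Lemma binomial_coefS g n : n.+1%:R * binomial_coef g n.+1 = (g + n%:R) * binomial_coef g n.
Proof. by rewrite /=; field; rewrite addrC natr1. Qed.

Lemma binomial_coef_bound g (r : R) : 0 < g -> 0 < r -> r < 1 ->
  exists M, power_bound (fun n => (binomial_coef g n)%:C) r M.
Proof.
move=> g0 r0 r1.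
pose b n := binomial_coef g n * r ^+ n.
have b0 n : 0 <= b n by rewrite mulr_ge0 ?exprn_ge0 // ltW // binomial_coef_gt0.
have r1' : 0 < 1 - r by rewrite subr_gt0.
pose N := (Num.truncn (g / (1 - r))).+1.
have hN n : (N <= n)%N -> b n.+1 <= b n.
  move=> Nn; rewrite /b /= exprS.
  have -> : binomial_coef g n * ((g + n%:R) / n.+1%:R) * (r * r ^+ n) =
    binomial_coef g n * r ^+ n * ((g + n%:R) * r / n.+1%:R) by ring.
  rewrite ler_piMr ?b0 // ler_pdivrMr // mul1r -natr1.
  have : g / (1 - r) <= n%:R.
    apply: (@le_trans _ _ N%:R); last by rewrite ler_nat.
    by rewrite ltW // truncnS_gt // num_real.
  by rewrite ler_pdivrMr //; nra.
exists (\sum_(i < N.+1) b i) => n.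
rewrite modulusC ger0_norm ?(ltW (binomial_coef_gt0 _ _)) // -/(b n).
have small m : (m <= N)%N -> b m <= \sum_(i < N.+1) b i.
  move=> mN; rewrite -ltnS in mN; rewrite (bigD1 (Ordinal mN)) //= lerDl sumr_ge0 //.
have [/small//|] := leqP n N.
elim: n => // n IH; rewrite ltnS leq_eqVlt => /orP[/eqP <-|Nn].
  by apply: le_trans (hN _ (leqnn _)) (small _ (leqnn _)).
exact: le_trans (hN _ (ltnW Nn)) (IH Nn).
Qed.

Lemma is_derive_quadratic (f : R -> R) x a (C e : R) : 0 < e -> 0 <= C ->
  (forall h, `|h| < e -> `|f (x + h) - f x - a * h| <= C * h ^+ 2) -> is_derive x 1 f a.
Proof.
move=> e0 C0 hf; apply/is_derive1_caratheodory.
exists (fun y => if y == x then a else (f y - f x) / (y - x)); split; last by rewrite eqxx.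
  by move=> y; have [->|zx] := eqVneq y x; rewrite ?subrr ?mulr0 // divfK // subr_eq0.
apply/cvgrPdist_lt => eps eps0; rewrite eqxx.
apply/nbhs_ballP; exists (Num.min e (eps / (C + 1))) => /=.
  by rewrite lt_min e0 divr_gt0 // ltr_wpDl.
move=> y; rewrite /ball /= lt_min => /andP[ze zp].
have [_|zx] := eqVneq y x; first by rewrite subrr normr0.
have zx0 : 0 < `|y - x| by rewrite normr_gt0 subr_eq0.
have := hf (y - x); rewrite distrC => /(_ ze); have -> : x + (y - x) = y by ring.
have -> : f y - f x - a * (y - x) = ((f y - f x) / (y - x) - a) * (y - x).
  by rewrite mulrBl divfK // subr_eq0.
rewrite normrM -[(y - x) ^+ 2]real_normK ?num_real // expr2 mulrA ler_pM2r // => h.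
rewrite distrC; apply: le_lt_trans h _; rewrite distrC in zp.
rewrite ltr_pdivlMr in zp; last by rewrite ltr_wpDl.
nra.
Qed.

Lemma derive_mul (f h : R -> R) t a b : is_derive t 1 f a -> is_derive t 1 h b ->
  is_derive t 1 (fun s => f s * h s) (f t * b + h t * a).
Proof. by move=> hf hh; apply: (is_derive_eq (f := f * h)). Qed.

Lemma derive_add (f h : R -> R) t a b : is_derive t 1 f a -> is_derive t 1 h b ->
  is_derive t 1 (fun s => f s + h s) (a + b).
Proof. by move=> hf hh; apply: (is_derive_eq (f := f + h)). Qed.

Lemma derive_sub (f h : R -> R) t a b : is_derive t 1 f a -> is_derive t 1 h b ->
  is_derive t 1 (fun s => f s - h s) (a - b).
Proof. by move=> hf hh; apply: (is_derive_eq (f := f - h)). Qed.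

Lemma derive_comp (f h : R -> R) t a b : is_derive (h t) 1 f a -> is_derive t 1 h b ->
  is_derive t 1 (fun s => f (h s)) (a * b).
Proof. by move=> hf hh; apply: (is_derive1_comp (f := f) (g := h)). Qed.

Lemma derive_inv (h : R -> R) t b : h t != 0 -> is_derive t 1 h b ->
  is_derive t 1 (fun s => (h s)^-1) (- (h t)^-2 * b).
Proof. by move=> h0 hh; exact: is_deriveV. Qed.

Lemma derive_lin (k : R) t : is_derive t 1 (fun s => s * k) k.
Proof.
apply: (@is_derive_quadratic _ _ _ 0 1) => // h _.
by rewrite mul0r (_ : _ - _ = 0) ?normr0 //; ring.
Qed.

Lemma derive_const (k : R) t : is_derive t 1 (fun=> k) 0.
Proof. exact: is_derive_cst. Qed.

(** Only the increments in the direction [zeta] of the complex difference quotient matter. *)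
Lemma derive_ray (F : R[i] -> R[i]) (zeta D : R[i]) (C e t : R) : 0 < e -> 0 <= C ->
  (forall h, modulus h < e -> modulus (F (t%:C * zeta + h) - F (t%:C * zeta) - D * h) <= C * modulus h ^+ 2) ->
  is_derive t 1 (fun s => complex.Re (F (s%:C * zeta))) (complex.Re (D * zeta)) /\
  is_derive t 1 (fun s => complex.Im (F (s%:C * zeta))) (complex.Im (D * zeta)).
Proof.
move=> e0 C0 hF.
have m1 : 0 < modulus zeta + 1 by rewrite ltr_wpDl ?modulus_ge0.
have key h : `|h| < e / (modulus zeta + 1) ->
    modulus (F ((t + h)%:C * zeta) - F (t%:C * zeta) - D * zeta * h%:C) <= C * modulus zeta ^+ 2 * h ^+ 2.
  rewrite ltr_pdivlMr // => he.
  have := hF (h%:C * zeta); rewrite modulusM modulusC => /(_ _).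
  have -> : (t + h)%:C * zeta = t%:C * zeta + h%:C * zeta by rewrite rmorphD mulrDl.
  have -> : D * (h%:C * zeta) = D * zeta * h%:C by ring.
  have -> : C * (`|h| * modulus zeta) ^+ 2 = C * modulus zeta ^+ 2 * h ^+ 2.
    by rewrite exprMn real_normK ?num_real //; ring.
  by apply; have := normr_ge0 h; nra.
have A0 : 0 <= C * modulus zeta ^+ 2 by rewrite mulr_ge0 // exprn_ge0 // modulus_ge0.
split; apply: (is_derive_quadratic (divr_gt0 e0 m1) A0) => h /key hh; apply: le_trans hh.
  apply: le_trans (normRe_le _); rewrite !ReD !ReN [X in _ <= `|_ - X|]ReM /= mulr0 subr0 //.
apply: le_trans (normIm_le _); rewrite !ImD !ImN [X in _ <= `|_ - X|]ImM /= mulr0 add0r //.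
Qed.

Section Sum.
Variable g : R.
Hypothesis g0 : 0 < g.

Let k n : R[i] := (binomial_coef g n)%:C.

Lemma binomial_sum_exists z : exists s, modulus z < 1 -> has_sum (fun n => k n * z ^+ n) s.
Proof.
have [z1|z1] := ltP (modulus z) 1; last by exists 0.
have z0 := modulus_ge0 z.
have r0 : 0 < (1 + modulus z) / 2 by lra. have r1 : (1 + modulus z) / 2 < 1 by lra.
have [M pb] := binomial_coef_bound g0 r0 r1.
have zr : modulus z < (1 + modulus z) / 2 by lra.
by have [s hs] := has_sum_power r0 pb zr; exists s.
Qed.

Let G := projT1 (choice binomial_sum_exists).
Let GP z : modulus z < 1 -> has_sum (fun n => k n * z ^+ n) (G z).
Proof. by move: z; exact: (projT2 (choice binomial_sum_exists)). Qed.

(** The recursion of the coefficients says that the sum satisfies [(1 - z) G' = g G]. *)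
Lemma binomial_ode z1 : modulus z1 < 1 -> exists D, (1 - z1) * D = g%:C * G z1 /\
  exists C e : R, [/\ 0 <= C, 0 < e &
    forall h, modulus h < e -> modulus (G (z1 + h) - G z1 - D * h) <= C * modulus h ^+ 2].
Proof.
move=> z11; have z10 := modulus_ge0 z1.
have r0 : 0 < (1 + modulus z1) / 2 by lra. have r1 : (1 + modulus z1) / 2 < 1 by lra.
have [M pb] := binomial_coef_bound g0 r0 r1.
have zr : modulus z1 < (1 + modulus z1) / 2 by lra.
have [d [hd pd sd]] := recenter r0 pb zr.
have d0 : d 0%N = G z1.
  apply: has_sum_unique (GP z11); apply: (eq_has_sum (hd 0%N)) => n.
  by rewrite bin0 mul1r subn0.
have D1 : has_sum (fun n => n.+1%:R * k n.+1 * z1 ^+ n) (d 1%N).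
  have := hd 1%N; move/(has_sum_shift _ _ 1); rewrite big_ord1 bin0n /= !mul0r subr0 => h.
  by apply: (eq_has_sum h) => n; rewrite addn1 bin1 subn1.
have D2 : has_sum (fun n => n%:R * k n * z1 ^+ n) (z1 * d 1%N).
  apply: (eq_has_sum (has_sumZ (c := z1) (hd 1%N))) => -[|n].
    by rewrite bin0n /= !mul0r mulr0.
  by rewrite -/(k n.+1) bin1 subn1 [n.+1.-1]/= exprS; ring.
exists (d 1%N); split.
  have -> : (1 - z1) * d 1%N = d 1%N - z1 * d 1%N by ring.
  apply: has_sum_unique (has_sumD D1 (has_sumN D2)) _.
  apply: (eq_has_sum (has_sumZ (c := g%:C) (GP z11))) => n.
  have kS : n.+1%:R * k n.+1 = (g%:C + n%:R) * k n.
    by rewrite /k -!(rmorph_nat (real_complex R)) -rmorphD -!rmorphM binomial_coefS.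
  rewrite kS; ring.
pose h0 := (1 - modulus z1) / 4.
have h00 : 0 < h0 by rewrite /h0; lra.
have h0r : modulus z1 + h0 < (1 + modulus z1) / 2 by rewrite /h0; lra.
have pdh := pd h0 (ltW h00) h0r.
set Md := M / _ in pdh.
have Md0 := power_bound_ge0 h00 pdh.
exists (2 * Md / h0 ^+ 2), (h0 / 2); split.
- by apply: divr_ge0; [exact: mulr_ge0|apply: exprn_ge0; exact: ltW].
- by rewrite divr_gt0.
move=> h hh.
have hs : has_sum (fun n => d n * h ^+ n) (G (z1 + h)).
  apply: sd; first by rewrite /h0 in hh; lra.
  by apply: GP; apply: le_lt_trans (modulusD _ _) _; rewrite /h0 in hh; lra.
have := power_tail 2 h00 pdh (ltW hh) hs.
by rewrite !big_ord_recl big_ord0 /= addr0 expr0 mulr1 expr1 d0 opprD addrA.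
Qed.

(** On the segment from the origin to [z], the logarithmic derivatives of the sum and of [cpowr
    (1 - t z) g] are opposite to each other, so the product of the two is constant; it is one at
    the origin. *)
Lemma binomial_series z : modulus z < 1 -> has_sum (fun n => k n * z ^+ n) (cpowr (1 - z) g)^-1.
Proof.
move=> z1; suff E : G z * cpowr (1 - z) g = 1.
  have c0 : cpowr (1 - z) g != 0.
    by apply: cpowr_neq0; rewrite -modulus_gt0 right_half_modulus // re_one_sub.
  by have -> : (cpowr (1 - z) g)^-1 = G z; [rewrite -[RHS](mulfK c0) E mul1r|exact: GP].
set x := complex.Re z; set y := complex.Im z.
pose u t := complex.Re (G (t%:C * z)); pose v t := complex.Im (G (t%:C * z)).
(* [D t] is the squared modulus of [1 - t z]; [a t] and [b t] are the real and imaginary parts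
   of the product that is shown to be constant. *)
pose D t := (1 - t * x) * (1 - t * x) + t * y * (t * y).
pose l t := ln (D t) * (2^-1 * g).
pose th t := atan ((0 - t * y) * (1 - t * x)^-1) * g.
pose a t := expR (l t) * (u t * cos (th t) - v t * sin (th t)).
pose b t := expR (l t) * (u t * sin (th t) + v t * cos (th t)).
have tz t : 0 <= t <= 1 -> modulus (t%:C * z) < 1.
  move=> /andP[t0 t1]; rewrite modulusM modulusC ger0_norm //.
  have := modulus_ge0 z; nra.
have xt t : 0 <= t <= 1 -> 0 < 1 - t * x.
  move=> /tz /re_one_sub; rewrite ReD ReN ReM /= mul0r subr0 -/x //.
have D0 t : 0 <= t <= 1 -> 0 < D t.
  by move=> /xt h; rewrite /D ltr_wpDr // ?mulr_gt0 // -expr2 sqr_ge0.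
have cE t : 0 <= t <= 1 -> cpowr (1 - t%:C * z) g = (expR (l t))%:C * cis (th t).
  move=> ht; have h := re_one_sub (tz t ht).
  have mD : modulus (1 - t%:C * z) ^+ 2 = D t.
    rewrite modulusE /D ReD ReN ReM ImD ImN ImM /= -/x -/y; ring.
  have m0 := right_half_modulus h.
  rewrite /cpowr -/(cis _) arg_atan //; congr (_%:C * cis _).
    by rewrite /powR gt_eqF //; congr expR; rewrite /l -mD lnXn // -mulr_natr; field.
  rewrite mulrC /th; congr (atan _ * g).
  by rewrite ReD ReN ReM ImD ImN ImM /= -/x -/y; congr (_ / _); ring.
have der t : 0 <= t <= 1 -> is_derive t 1 a 0 /\ is_derive t 1 b 0.
  move=> ht; have [Dv [ode [C [e [C0 e0 hq]]]]] := binomial_ode (tz t ht).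
  have [du dv] := derive_ray e0 C0 hq.
  have dx : is_derive t 1 (fun s => 1 - s * x) (0 - x).
    exact: derive_sub (derive_const 1 t) (derive_lin x t).
  have dy : is_derive t 1 (fun s => 0 - s * y) (0 - y).
    exact: derive_sub (derive_const 0 t) (derive_lin y t).
  have dD := derive_add (derive_mul dx dx) (derive_mul (derive_lin y t) (derive_lin y t)).
  have dl := derive_mul (derive_comp (is_derive1_ln (D0 t ht)) dD) (derive_const (2^-1 * g) t).
  have de := derive_comp (is_derive_expR (l t)) dl.
  have x0 : 1 - t * x != 0 by rewrite gt_eqF // xt.
  have dw := derive_mul dy (derive_inv (h := fun s => 1 - s * x) x0 dx).
  have dth := derive_mul (derive_comp (is_derive1_atan _) dw) (derive_const g t).
  have dc := derive_comp (is_derive_cos (th t)) dth.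
  have ds := derive_comp (is_derive_sin (th t)) dth.
  have da := derive_mul de (derive_sub (derive_mul du dc) (derive_mul dv ds)).
  have db := derive_mul de (derive_add (derive_mul du ds) (derive_mul dv dc)).
  have Dt := D0 t ht.
  have Dn : D t != 0 by rewrite gt_eqF.
  pose P := g * (x - t * (x * x + y * y)) / D t; pose Q := g * y / D t.
  have lE : ln (D t) * 0 + 2^-1 * g * ((D t)^-1 *
      ((1 - t * x) * (0 - x) + (1 - t * x) * (0 - x) + (t * y * y + t * y * y))) = - P.
    by rewrite /P; field.
  have w0 : 1 + ((0 - t * y) / (1 - t * x)) ^+ 2 = D t / (1 - t * x) ^+ 2.
    by rewrite /D; field.
  have tE : atan ((0 - t * y) / (1 - t * x)) * 0 + g * ((1 + ((0 - t * y) / (1 - t * x)) ^+ 2)^-1 *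
      ((0 - t * y) * (- (1 - t * x) ^- 2 * (0 - x)) + (1 - t * x)^-1 * (0 - y))) = - Q.
    by rewrite w0 /Q; field; rewrite x0 Dn.
  have zE : Dv * z = (P +i* Q) * G (t%:C * z).
    have h1 : 1 - t%:C * z != 0.
      by rewrite -modulus_gt0 right_half_modulus // re_one_sub // tz.
    apply: (mulfI h1); rewrite mulrA ode mulrA.
    have -> : (1 - t%:C * z) * (P +i* Q) = g%:C * z; last by ring.
    apply: complex_eq.
      rewrite !ReM ReD ImD ReN ImN ReM ImM /= -/x -/y /P /Q; rewrite /D in Dn *; field => //.
    by rewrite !ImM ReD ImD ReN ImN ReM ImM /= -/x -/y /P /Q; rewrite /D in Dn *; field.
  have [rE iE] : complex.Re (Dv * z) = P * u t - Q * v t /\ complex.Im (Dv * z) = P * v t + Q * u t.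
    by rewrite zE ReM ImM /=.
  split.
    apply: (is_derive_eq da); rewrite lE tE rE iE -/(u t) -/(v t); ring.
  apply: (is_derive_eq db); rewrite lE tE rE iE -/(u t) -/(v t); ring.
have const (f : R -> R) : (forall t, 0 <= t <= 1 -> is_derive t 1 f 0) -> f 1 = f 0.
  move=> hf; have [||c _] := @MVT R f (fun=> 0) 0 1 ltr01.
  - by move=> t; rewrite in_itv /= => /andP[t0 t1]; apply: hf; rewrite !ltW.
  - apply: derivable_within_continuous => t; rewrite in_itv /= => /hf [] //.
  by rewrite mul0r => /eqP; rewrite subr_eq0 => /eqP.
have o1 : 0 <= (1 : R) <= 1 by rewrite ler01 lexx.
have o0 : 0 <= (0 : R) <= 1 by rewrite ler01 lexx.
have HE t : 0 <= t <= 1 -> G (t%:C * z) * cpowr (1 - t%:C * z) g = a t +i* b t.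
  move=> ht; rewrite cE // /a /b /u /v; case: (G _) => p q; rewrite /cis /=; simpc.
  by congr (_ +i* _); ring.
have := HE 1 o1; rewrite mul1r => ->.
have -> : a 1 = a 0 by apply: const => t /der [].
have -> : b 1 = b 0 by apply: const => t /der [].
rewrite -(HE 0 o0) mul0r subr0.
have -> : G 0 = 1.
  have h0 := @GP 0; rewrite modulus0 in h0.
  apply: has_sum_unique (h0 ltr01) _; apply/has_sumP => eps eps0; exists 1%N => -[//|n] _.
  rewrite big_ord_recl big1 => [|i _]; last by rewrite expr0n /= mulr0.
  by rewrite addr0 expr0 mulr1 -[X in _ - X]/(k 0%N) subrr modulus0.
by rewrite mul1r cpowr_real // powR1.
Qed.

End Sum.
End BinomialSeries.

(** * Kernel functions *)

Section Kernel.
Variable R : realType.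
Variable g : R.
Hypothesis g0 : 0 < g.
Implicit Types (x y z a : R[i]).

Definition kernel x y : R[i] := (cpowr (1 - x^* * y) g)^-1.

Lemma mul_conj_lt1 x y : disk x -> modulus y <= 1 -> modulus (x^* * y) < 1.
Proof.
move=> /diskP x1 y1; rewrite modulusM modulus_conj.
have := modulus_ge0 x; have := modulus_ge0 y; nra.
Qed.

Lemma re_kernel x y : disk x -> modulus y <= 1 -> 0 < complex.Re (1 - x^* * y).
Proof. by move=> dx dy; apply/re_one_sub/mul_conj_lt1. Qed.

Lemma cpowr_kernel_neq0 x y : disk x -> modulus y <= 1 -> cpowr (1 - x^* * y) g != 0.
Proof.
by move=> dx dy; apply: cpowr_neq0; rewrite -modulus_gt0 right_half_modulus // re_kernel.
Qed.

Lemma kernel_neq0 x y : disk x -> modulus y <= 1 -> kernel x y != 0.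
Proof. by move=> dx dy; rewrite invr_eq0 cpowr_kernel_neq0. Qed.

Lemma kernel_series x y : disk x -> modulus y <= 1 ->
  has_sum (fun n => ((binomial_coef g n)%:C * x^* ^+ n) * y ^+ n) (kernel x y).
Proof.
move=> dx dy; apply: (eq_has_sum (binomial_series g0 (mul_conj_lt1 dx dy))) => n.
by rewrite exprMn mulrA.
Qed.

Lemma kernel_conj x y : disk x -> disk y -> (kernel x y)^* = kernel y x.
Proof.
move=> dx dy; rewrite /kernel fmorphV /= -cpowr_conj ?re_kernel ?disk_closed //.
by congr (_^-1); congr (cpowr _ _); rewrite rmorphB rmorph1 rmorphM /= conjCK mulrC.
Qed.

Lemma modulus_kernel x y : modulus (kernel x y) = modulus (1 - x^* * y) `^ (- g).
Proof. by rewrite modulusV modulus_cpowr powRN. Qed.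

Lemma conj_mul x : x^* * x = (modulus x ^+ 2)%:C.
Proof. by rewrite mulrC mulcJ. Qed.

Lemma one_sub_sqr_gt0 x : disk x -> 0 < 1 - modulus x ^+ 2.
Proof. by move=> /diskP x1; rewrite subr_gt0 exprn_ilt1 // modulus_ge0. Qed.

Lemma kernel_diag x : disk x -> kernel x x = ((1 - modulus x ^+ 2) `^ (- g))%:C.
Proof.
move=> dx; rewrite /kernel conj_mul -(rmorph1 (real_complex R)) -rmorphB cpowr_real ?one_sub_sqr_gt0 //.
by rewrite -fmorphV powRN.
Qed.

Lemma kernel0 y : kernel 0 y = 1.
Proof. by rewrite /kernel rmorph0 mul0r subr0 cpowr_real // powR1 invr1. Qed.

(** The numbers [1 - conj(b(x)) b(y)], [1 - conj(a) y], [1 - a conj(x)] have the product [(1 -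
    |a|^2) (1 - conj(x) y)], where [b] is the Blaschke factor, and [cpowr_mul3] raises this
    identity to the power [g]. *)
Lemma kernel_automorphism (lam a x y : R[i]) : modulus lam = 1 -> disk a -> disk x -> disk y ->
  kernel (lam * blaschke a x) (lam * blaschke a y) =
  cpowr (1 - a^* * y) g * (cpowr (1 - a^* * x) g)^* / ((1 - modulus a ^+ 2) `^ g)%:C * kernel x y.
Proof.
move=> lam1 da dx dy.
have E : (lam * blaschke a x)^* * (lam * blaschke a y) = (blaschke a x)^* * blaschke a y.
  rewrite rmorphM /= mulrACA conj_mul lam1 expr1n mul1r //.
rewrite /kernel E.
have dbx := blaschke_disk da dx; have dby := blaschke_disk da dy.
have P0 : 0 < (1 - modulus a ^+ 2) `^ g by rewrite powR_gt0 // one_sub_sqr_gt0.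
have PC : ((1 - modulus a ^+ 2) `^ g)%:C != 0 :> R[i].
  by rewrite -modulus_eq0 modulusC normr_eq0 gt_eqF.
have qx := denominator_neq0 da (disk_closed dx); have qy := denominator_neq0 da (disk_closed dy).
rewrite -cpowr_conj ?re_kernel ?disk_closed //.
have cx : (1 - a^* * x)^* = 1 - a * x^* by rewrite rmorphB rmorph1 rmorphM /= conjCK.
have qx' : 1 - a * x^* != 0 by rewrite -cx conjC_eq0.
have n1 := cpowr_kernel_neq0 dbx (disk_closed dby).
have n4 := cpowr_kernel_neq0 dx (disk_closed dy).
have M : cpowr (1 - (blaschke a x)^* * blaschke a y) g * cpowr (1 - a^* * y) g * cpowr (1 - a^* * x)^* g =
    ((1 - modulus a ^+ 2) `^ g)%:C * cpowr (1 - x^* * y) g.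
  apply: cpowr_mul3; rewrite ?re_kernel ?disk_closed ?one_sub_sqr_gt0 //.
    have -> : (1 - a^* * x)^* = 1 - x^* * a by rewrite cx mulrC.
    by rewrite re_kernel // disk_closed.
  have Ea : (1 - modulus a ^+ 2)%:C = 1 - a^* * a :> R[i] by rewrite conj_mul rmorphB rmorph1.
  have bxE : (blaschke a x)^* = (a^* - x^*) / (1 - a * x^*) by rewrite rmorphM fmorphV /= cx rmorphB.
  by rewrite Ea bxE cx /blaschke; field; rewrite qy.
move: M n1 n4 PC; set A := cpowr (1 - (blaschke a x)^* * _) g; set P := (_%:C); set Q := cpowr (1 - x^* * y) g.
set Ey := cpowr _ _; set Ex := cpowr _ _ => M n1 n4 PC.
have -> : Ey * Ex / P / Q = A * Ey * Ex / (P * Q) / A by field; rewrite n1 n4 PC.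
by rewrite M divff ?mul1r // mulf_neq0.
Qed.

End Kernel.

(** * Reproducing kernel spaces *)

Section Reproducing.
Variable R : realType.
Implicit Types (f h : R[i] -> R[i]) (k x y z : R[i]).

(** The properties of the two families of function spaces that the study of normal operators
    relies on. The constant [c] is the squared norm of the function one; for the Bergman spaces
    its value is left undetermined, which avoids the area of the disk. *)
Record reproducing (H : disk_space R) (c : R) : Prop := Reproducing {
  rep_gt0 : 0 < c;
  rep_eq : forall f h, eqD f h -> in_space H f -> in_space H h;
  rep_inner_eq : forall f h h', eqD h h' -> inner H f h = inner H f h';
  rep_lin : forall k f h, in_space H f -> in_space H h -> in_space H (fun z => k * f z + h z);
  rep_inner_lin : forall k f h f', in_space H f -> in_space H h -> in_space H f' ->
    inner H (fun z => k * f z + h z) f' = k * inner H f f' + inner H h f';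
  rep_conj : forall f h, in_space H f -> in_space H h -> inner H h f = (inner H f h)^*;
  rep_ge0 : forall f, in_space H f -> 0 <= inner H f f;
  rep_kernel_in : forall x, disk x -> in_space H (kernel (space_exponent H) x);
  rep_kernel : forall f x, in_space H f -> disk x ->
    inner H f (kernel (space_exponent H) x) = c%:C * f x }.

Section Facts.
Variables (H : disk_space R) (c : R).
Hypothesis rep : reproducing H c.
Local Notation g := (space_exponent H).
Local Notation K := (kernel g).

Lemma space_exponent_gt0 : 0 < g.
Proof. by case: H => [|alpha ha] /=; lra. Qed.

Lemma in_space_scale k f : in_space H f -> in_space H (fun z => k * f z).
Proof.
move=> hf; by apply: (rep_eq rep _ (rep_lin rep (k - 1) hf hf)) => z _; ring.
Qed.

Lemma inner_scale k f h : in_space H f -> in_space H h ->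
  inner H (fun z => k * f z) h = k * inner H f h.
Proof.
move=> hf hh.
have -> : (fun z => k * f z) = (fun z => (k - 1) * f z + f z) by apply/funext => z; ring.
rewrite (rep_inner_lin rep) //; ring.
Qed.

Lemma inner_eql f f' h : in_space H f -> in_space H f' -> in_space H h -> eqD f f' ->
  inner H f h = inner H f' h.
Proof.
move=> hf hf' hh E; rewrite (rep_conj rep hh hf) (rep_conj rep hh hf').
by rewrite (rep_inner_eq rep h E).
Qed.

Lemma inner_scaler k f h : in_space H f -> in_space H h ->
  inner H f (fun z => k * h z) = k^* * inner H f h.
Proof.
move=> hf hh; rewrite (rep_conj rep (in_space_scale k hh) hf) inner_scale //.
by rewrite rmorphM /= -(rep_conj rep).
Qed.

Lemma inner_linr k f h f' : in_space H f -> in_space H h -> in_space H f' ->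
  inner H f' (fun z => k * f z + h z) = k^* * inner H f' f + inner H f' h.
Proof.
move=> hf hh hf'; rewrite (rep_conj rep (rep_lin rep k hf hh) hf') (rep_inner_lin rep) //.
by rewrite rmorphD rmorphM /= -!(rep_conj rep).
Qed.

Lemma inner_norm_lin k f h : in_space H f -> in_space H h ->
  inner H (fun z => k * f z + h z) (fun z => k * f z + h z) =
  k * k^* * inner H f f + k * inner H f h + k^* * (inner H f h)^* + inner H h h.
Proof.
move=> hf hh; rewrite (rep_inner_lin rep) ?inner_linr //; last exact: (rep_lin rep).
by rewrite (rep_conj rep hf hh); ring.
Qed.

Lemma kernel_norm x : disk x -> inner H (K x) (K x) = c%:C * K x x.
Proof. by move=> dx; rewrite (rep_kernel rep) //; exact: (rep_kernel_in rep). Qed.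

(** The squared norm of [f - (f y / K y y) K_y], which is nonnegative, equals that of [f] minus
    a positive multiple of [|f y|^2]. *)
Lemma inner_eq0 f : in_space H f -> inner H f f = 0 -> eqD f (fun=> 0).
Proof.
move=> hf f0 y dy; apply/eqP; rewrite -modulus_eq0.
have c0 := rep_gt0 rep.
have Ky := rep_kernel_in rep dy.
have kd : 0 < (1 - modulus y ^+ 2) `^ (- g) by rewrite powR_gt0 // one_sub_sqr_gt0.
set b := (1 - modulus y ^+ 2) `^ (- g) in kd.
have := rep_ge0 rep (rep_lin rep (- (f y) / b%:C) Ky hf).
rewrite inner_norm_lin // f0 addr0 kernel_norm // kernel_diag // -/b.
rewrite (rep_conj rep hf Ky) (rep_kernel rep hf dy) conjCK.
have bC : b%:C != 0 :> R[i] by rewrite -modulus_eq0 modulusC normr_eq0 gt_eqF.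
rewrite !(rmorphM, rmorphN, fmorphV) /= !conj_real.
set X := (X in 0 <= X).
have -> : X = - (c / b * modulus (f y) ^+ 2)%:C.
  have -> : (c / b * modulus (f y) ^+ 2)%:C = c%:C / b%:C * (f y * (f y)^*).
    by rewrite mulcJ -fmorphV -!rmorphM.
  by rewrite /X; field.
rewrite oppr_ge0 lecR => h.
have h' : modulus (f y) ^+ 2 <= 0 by rewrite pmulr_rle0 ?divr_gt0 // in h.
by rewrite -sqrf_eq0 eq_le h' sqr_ge0.
Qed.

End Facts.
End Reproducing.

(** * Normal weighted composition operators *)

Section NormalOperator.
Variable R : realType.
Variables (H : disk_space R) (c : R).
Hypothesis rep : reproducing H c.
Local Notation g := (space_exponent H).
Local Notation K := (kernel g).
Variables (phi psi : R[i] -> R[i]) (a lam : R[i]).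
Hypotheses (da : disk a) (lam1 : modulus lam = 1).
Hypothesis phiE : forall z, disk z -> phi z = lam * blaschke a z.
Hypothesis normal : normal_operator H (weighted_composition_op psi phi).
Implicit Types (x y z u v : R[i]).

Let E y := cpowr (1 - a^* * y) g.
Let P : R[i] := ((1 - modulus a ^+ 2) `^ g)%:C.

(** Let [U f = P ^ (1/2) (f o phi) / E], a unitary operator. The weighted composition operator
    is a multiple of [U] followed by multiplication by [symbol]. *)
Definition symbol z := cpowr (1 - a^* * z) g * psi z.

Let E0 y : disk y -> E y != 0.
Proof. by move=> dy; apply: cpowr_kernel_neq0 => //; exact: disk_closed. Qed.

Let P0 : P != 0.
Proof. by rewrite -modulus_eq0 modulusC normr_eq0 gt_eqF // powR_gt0 // one_sub_sqr_gt0. Qed.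

Lemma phi_disk y : disk y -> disk (phi y).
Proof.
move=> dy; rewrite phiE //; apply/diskP; rewrite modulusM lam1 mul1r; apply/diskP.
exact: blaschke_disk.
Qed.

Let KphiE x y : disk x -> disk y -> K (phi x) (phi y) = E y * (E x)^* / P * K x y.
Proof. by move=> dx dy; rewrite !phiE // kernel_automorphism //; exact: space_exponent_gt0. Qed.

Let T := weighted_composition_op psi phi.

Let T_in f : in_space H f -> in_space H (T f).
Proof. by case: normal => -[h _ _] _; exact: h. Qed.

(** This is where normality enters. The adjoint [S] maps [K_y] to [conj(psi y) K_(phi y)], so
    that [<T K_x, T K_y> = <K_x, S (T K_y)> = <K_x, T (S K_y)>] is a value of [T] on a kernel. *)
Lemma inner_image x y : disk x -> disk y ->
  inner H (T (K x)) (T (K y)) = c%:C * ((psi x)^* * psi y * K (phi x) (phi y)).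
Proof.
move=> dx dy; case: normal => _ [S [[[Sin _ _] adj] comm]].
have Kx := rep_kernel_in rep dx; have Ky := rep_kernel_in rep dy.
rewrite adj //; last exact: T_in.
rewrite -(rep_inner_eq rep _ (comm _ Ky)).
have SKy z : disk z -> S (K y) z = (psi y)^* * K (phi y) z.
  move=> dz; have Kz := rep_kernel_in rep dz.
  have cC : c%:C != 0 :> R[i].
    by rewrite -modulus_eq0 modulusC normr_eq0 gt_eqF //; exact: rep_gt0 rep.
  have SK := Sin _ Ky; have TK := T_in Kz.
  apply: (mulfI cC); rewrite -(rep_kernel rep SK dz) (rep_conj rep Kz SK) -adj // (rep_kernel rep TK dy).
  rewrite rmorphM /= conj_real /T /weighted_composition_op rmorphM /= kernel_conj //.
  exact: phi_disk.
rewrite (rep_conj rep (T_in (Sin _ Ky)) Kx) (rep_kernel rep) //; last exact/T_in/Sin.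
rewrite rmorphM /= conj_real /T /weighted_composition_op (SKy _ (phi_disk dx)) !rmorphM /= conjCK (kernel_conj _ (phi_disk dy) (phi_disk dx)).
ring.
Qed.

Let kap u : R[i] := (E u)^* / P.

Let kap0 u : disk u -> kap u != 0.
Proof. by move=> du; rewrite mulf_neq0 ?invr_eq0 // conjC_eq0 E0. Qed.

Let TK u : disk u -> eqD (T (K (phi u))) (fun y => kap u * (symbol y * K u y)).
Proof.
move=> du y dy; rewrite /T /weighted_composition_op KphiE // /kap /symbol -/(E y).
ring.
Qed.

Lemma symbol_kernel_in u : disk u -> in_space H (fun y => symbol y * K u y).
Proof.
move=> du; have Kp := rep_kernel_in rep (phi_disk du).
have h := rep_eq rep (TK du) (T_in Kp).
apply: (rep_eq rep _ (in_space_scale rep (kap u)^-1 h)) => y _.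
by rewrite mulKf // kap0.
Qed.

(** Writing [M] for multiplication operators, [w] for the symbol and [v = w o phi], this says on
    kernels that [M_w] and [M_v] satisfy [adjoint(M_w) M_w = M_v adjoint(M_v)], which is
    normality conjugated by [U]. *)
Lemma symbol_kernel_inner u v : disk u -> disk v ->
  inner H (fun y => symbol y * K u y) (fun y => symbol y * K v y) =
  c%:C * ((symbol (phi u))^* * symbol (phi v) * K u v).
Proof.
move=> du dv.
have hu := symbol_kernel_in du; have hv := symbol_kernel_in dv.
have Ku := T_in (rep_kernel_in rep (phi_disk du)); have Kv := T_in (rep_kernel_in rep (phi_disk dv)).
have := inner_image (phi_disk du) (phi_disk dv).
rewrite (inner_eql rep Ku (in_space_scale rep (kap u) hu) Kv (TK du)).
rewrite (rep_inner_eq rep _ (TK dv)).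
rewrite (inner_scale rep) ?(inner_scaler rep) //; last exact: (in_space_scale rep).
rewrite (KphiE (phi_disk du) (phi_disk dv)) KphiE // => h.
apply: (mulfI (kap0 du)); apply: (mulfI (_ : (kap v)^* != 0)); first by rewrite conjC_eq0 kap0.
have PJ : P^* = P by rewrite conj_real.
have kJ : (kap v)^* = E v / P by rewrite /kap [LHS](rmorphM Num.conj) fmorphV /= conjCK PJ.
have sJ : (symbol (phi u))^* = (E (phi u))^* * (psi (phi u))^* by exact: rmorphM.
rewrite mulrCA h kJ sJ /kap /symbol -!/(E _).
by field.
Qed.

Lemma symbol_kernel_norm u : disk u ->
  inner H (fun y => symbol y * K u y) (fun y => symbol y * K u y) =
  (c * (modulus (symbol (phi u)) ^+ 2 * (1 - modulus u ^+ 2) `^ (- g)))%:C.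
Proof.
move=> du; rewrite symbol_kernel_inner // kernel_diag // [_^* * _]mulrC mulcJ -!rmorphM //.
Qed.

(** The orthogonal projection of [w K_u] to the line of [K_u] is [w(u) K_u], while the norm of
    [w K_u] is [|w(phi u)|] times that of [K_u]. In case of equality [w K_u] lies on the line. *)
Lemma symbol_le u : disk u -> modulus (symbol u) <= modulus (symbol (phi u)) /\
  (modulus (symbol u) = modulus (symbol (phi u)) -> forall y, disk y -> symbol y = symbol u).
Proof.
move=> du; have Ku := rep_kernel_in rep du; have hu := symbol_kernel_in du.
have hh := rep_lin rep (- symbol u) Ku hu.
set b := (1 - modulus u ^+ 2) `^ (- g).
have b0 : 0 < b by rewrite powR_gt0 // one_sub_sqr_gt0.
have c0 := rep_gt0 rep.
have N : inner H (fun z => - symbol u * K u z + symbol z * K u z) (fun z => - symbol u * K u z + symbol z * K u z)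
    = (c * b * (modulus (symbol (phi u)) ^+ 2 - modulus (symbol u) ^+ 2))%:C.
  rewrite (inner_norm_lin rep) // (kernel_norm rep) // symbol_kernel_norm //.
  rewrite (rep_conj rep hu Ku) (rep_kernel rep hu du) conjCK kernel_diag // -/b.
  have -> : (c * b * (modulus (symbol (phi u)) ^+ 2 - modulus (symbol u) ^+ 2))%:C =
     c%:C * b%:C * ((modulus (symbol (phi u)) ^+ 2)%:C - symbol u * (symbol u)^*) :> R[i].
    by rewrite mulcJ -rmorphB -!rmorphM.
  have -> : (c * (modulus (symbol (phi u)) ^+ 2 * b))%:C = c%:C * ((modulus (symbol (phi u)) ^+ 2)%:C * b%:C) :> R[i].
    by rewrite -!rmorphM.
  move: (symbol u) (modulus (symbol (phi u)) ^+ 2) => t q.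
  have -> : (- t)^* = - t^* by exact: rmorphN.
  have -> : (c%:C * (t * b%:C))^* = c%:C * (t^* * b%:C) by rewrite !(rmorphM Num.conj) /= !conj_real.
  ring.
have h0 := rep_ge0 rep hh; rewrite N ler0c in h0.
split.
  rewrite -(@ler_pXn2r _ 2) ?nnegrE ?modulus_ge0 //.
  by rewrite -subr_ge0; rewrite pmulr_rge0 ?mulr_gt0 // in h0.
move=> E1 y dy; rewrite -E1 subrr mulr0 in N.
have /(_ y dy) := inner_eq0 rep hh N.
rewrite -mulrDl => /eqP; rewrite mulf_eq0 (negbTE (kernel_neq0 _ du (disk_closed dy))) orbF.
by rewrite addrC subr_eq0 => /eqP.
Qed.

(** For [g = 1] one has [w K_u - w K_0 = conj(u) z w K_u]. If multiplication by [z] is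
    isometric, comparing the norms given by [symbol_kernel_inner] yields [|w(phi u) - w(phi
    0)|^2 = 0]. *)
Lemma isometry_symbol_constant :
  (forall f h, in_space H f -> in_space H h -> (forall z, disk z -> h z = z * f z) ->
     inner H h h = inner H f f) -> g = 1 ->
  forall u, disk u -> symbol (phi u) = symbol (phi 0).
Proof.
move=> iso g1 u du.
have d0 : disk (0 : R[i]) by apply/diskP; rewrite modulus0.
have [->//|u0] := eqVneq u 0.
have hu := symbol_kernel_in du; have h0 := symbol_kernel_in d0.
have hh := rep_lin rep (-1) h0 hu.
have uC : u^* != 0 by rewrite conjC_eq0.
(* The left-hand side is the squared norm of [conj(u) z w K_u]. *)
have key : inner H (fun z => -1 * (symbol z * K 0 z) + symbol z * K u z) (fun z => -1 * (symbol z * K 0 z) + symbol z * K u z)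
   = u^* * u * inner H (fun z => symbol z * K u z) (fun z => symbol z * K u z).
  have hs := in_space_scale rep u^* hu.
  rewrite (iso _ _ hs hh).
    by rewrite (inner_scale rep) // (inner_scaler rep) // conjCK mulrA.
  move=> z dz; rewrite kernel0 mulr1 /kernel g1 cpowr_1; last first.
    by apply: re_kernel => //; exact: disk_closed.
  have q := denominator_neq0 du (disk_closed dz).
  by field.
move: key; rewrite (inner_norm_lin rep) // !symbol_kernel_norm // symbol_kernel_inner //.
rewrite kernel0 mulr1 modulus0 expr0n /= subr0 powR1 mulr1 g1 powRN powRr1; last exact/ltW/one_sub_sqr_gt0.
rewrite [u^* * u]mulrC (mulcJ u).
set A := symbol (phi u); set B := symbol (phi 0).
have c0 := rep_gt0 rep; have s0 := one_sub_sqr_gt0 du.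
set s := 1 - modulus u ^+ 2 in s0 *.
have -> : modulus u ^+ 2 = 1 - s by rewrite /s; ring.
move=> key.
have : (c * (modulus (B - A) ^+ 2))%:C = 0 :> R[i].
  have -> : (c * (modulus (B - A) ^+ 2))%:C = c%:C * (B - A) * (B - A)^* by rewrite -mulrA mulcJ -rmorphM.
  have e1 : (c * (modulus A ^+ 2 / s))%:C = c%:C * (A * A^* / s%:C) by rewrite mulcJ -fmorphV -!rmorphM.
  have e2 : (c * modulus B ^+ 2)%:C = c%:C * (B * B^*) by rewrite mulcJ -rmorphM.
  have e3 : (1 - s)%:C = 1 - s%:C :> R[i] by rewrite rmorphB rmorph1.
  have sC : s%:C != 0 :> R[i] by rewrite -modulus_eq0 modulusC normr_eq0 gt_eqF.
  move: key; rewrite e1 e2 e3; move: A B {e1 e2} => p q.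
  have -> : (-1)^* = -1 :> R[i] by rewrite rmorphN rmorph1.
  have -> : (c%:C * (q^* * p))^* = c%:C * (q * p^*).
    by rewrite !(rmorphM Num.conj) /= conj_real conjCK.
  have -> : (q - p)^* = q^* - p^* by exact: rmorphB.
  move=> key.
  have := congr1 (fun x => x - (1 - s%:C) * (c%:C * (p * p^* / s%:C))) key.
  rewrite subrr => <-; by field.
move=> /(congr1 (@modulus R)); rewrite modulusC modulus0 => /eqP.
rewrite normr_eq0 mulf_eq0 gt_eqF //= sqrf_eq0 modulus_eq0 subr_eq0 eq_sym => /eqP //.
Qed.

Hypothesis psi0 : ~ eqD psi (fun=> 0).

Lemma eigenvector_of_constant : (forall u v, disk u -> disk v -> symbol u = symbol v) ->
  is_eigenvector H (composition_op phi) 1 symbol.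
Proof.
move=> const; have d0 : disk (0 : R[i]) by apply/diskP; rewrite modulus0.
split.
- apply: (rep_eq rep _ (in_space_scale rep (symbol 0) (rep_kernel_in rep d0))) => y dy.
  by rewrite kernel0 mulr1; exact: const.
- move=> h; apply: psi0 => y dy; have := h y dy => /eqP.
  by rewrite mulf_eq0 (negbTE (E0 dy)) /= => /eqP.
- by move=> y dy; rewrite mul1r; apply: const => //; exact: phi_disk.
Qed.

End NormalOperator.

(** * The Hardy space *)

Section AnalyticLinear.
Variable R : realType.
Implicit Types (f h : R[i] -> R[i]) (c d : nat -> R[i]).

Lemma eqD_analytic f h : eqD f h -> analytic_on (@disk R) f -> analytic_on (@disk R) h.
Proof.
move=> E /disk_expansion [c hc]; apply: (disk_series_analytic (c := c)) => z dz.
by rewrite -E //; exact: hc.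
Qed.

Lemma eqD_taylor f h : eqD f h -> taylor f = taylor h.
Proof.
move=> E.
pose S (f : R[i] -> R[i]) := [set c : nat -> R[i] | forall z, disk z -> has_sum (fun n => c n * z ^+ n) (f z)].
have ES : S f = S h.
  apply/funext => c; apply/propext; split=> hc z dz; first by rewrite -(E z dz); exact: hc.
  by rewrite (E z dz); exact: hc.
by rewrite -[LHS]/(xget (fun=> 0) (S f)) ES.
Qed.

Lemma linear_expansion (k : R[i]) f h :
  analytic_on (@disk R) f -> analytic_on (@disk R) h -> forall z, disk z ->
  has_sum (fun n => (k * taylor f n + taylor h n) * z ^+ n) (k * f z + h z).
Proof.
move=> af ah z dz.
apply: (eq_has_sum (has_sumD (has_sumZ (c := k) (taylorP af dz)) (taylorP ah dz))) => n /=.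
by rewrite [RHS]mulrDl mulrA.
Qed.

Lemma linear_analytic (k : R[i]) f h :
  analytic_on (@disk R) f -> analytic_on (@disk R) h -> analytic_on (@disk R) (fun z => k * f z + h z).
Proof. 
move=> af ah; apply: (disk_series_analytic (c := fun n => k * taylor f n + taylor h n)).
exact: linear_expansion.
 Qed.

Lemma taylor_linear (k : R[i]) f h :
  analytic_on (@disk R) f -> analytic_on (@disk R) h ->
  taylor (fun z => k * f z + h z) = (fun n => k * taylor f n + taylor h n).
Proof. by move=> af ah; apply: taylorE; exact: linear_expansion. Qed.

Lemma kernel_analytic (g : R) x : 0 < g -> disk x -> analytic_on (@disk R) (kernel g x).
Proof.
move=> g0 dx; apply: disk_series_analytic => z dz.
exact: (kernel_series g0 dx (disk_closed dz)).
Qed.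

Lemma taylor_kernel (g : R) x : 0 < g -> disk x ->
  taylor (kernel g x) = (fun n => (binomial_coef g n)%:C * x^* ^+ n).
Proof.
move=> g0 dx; apply: taylorE => z dz.
exact: (kernel_series g0 dx (disk_closed dz)).
Qed.

End AnalyticLinear.

Lemma modulus_linear_sqr (R : realType) (k x y : R[i]) :
  modulus (k * x + y) ^+ 2 <= 2 * modulus k ^+ 2 * modulus x ^+ 2 + 2 * modulus y ^+ 2.
Proof.
have h : modulus (k * x + y) <= modulus k * modulus x + modulus y by rewrite -modulusM modulusD.
have h0 := modulus_ge0 (k * x + y).
have := sqr_ge0 (modulus k * modulus x - modulus y); have := modulus_ge0 y.
have := mulr_ge0 (modulus_ge0 k) (modulus_ge0 x).
rewrite -[2 * modulus k ^+ 2 * _]mulrA -exprMn.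
move: (modulus k * modulus x) (modulus y) (modulus (k * x + y)) h h0 => p q m; nra.
Qed.

Section Hardy.
Variable R : realType.
Implicit Types (f h : R[i] -> R[i]) (c d : nat -> R[i]).

Definition square_sum_le c (B : R) := forall n, \sum_(i < n) modulus (c i) ^+ 2 <= B.

Lemma in_hardyP f : in_space (@Hardy R) f <->
  analytic_on (@disk R) f /\ exists B, square_sum_le (taylor f) B.
Proof.
rewrite /in_space /=; split=> -[af hf]; split=> //.
  exists (fine (\sum_(0 <= n <oo) (modulus (taylor f n) ^+ 2)%:E)%E) => n.
  have s0 : (0 <= \sum_(0 <= n <oo) (modulus (taylor f n) ^+ 2)%:E)%E.
    by apply: nneseries_ge0 => k _ _; rewrite lee_fin sqr_ge0.
  rewrite -lee_fin fineK ?ge0_fin_numE // -sumEFin -(big_mkord xpredT (fun i => (modulus (taylor f i) ^+ 2)%:E)).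
  by apply: nneseries_lim_ge => k _ _; rewrite lee_fin sqr_ge0.
case: hf => B hB; apply: (@le_lt_trans _ _ B%:E); last exact: ltry.
apply: lime_le.
  by apply: is_cvg_nneseries => k _ _; rewrite lee_fin sqr_ge0.
by apply: nearW => n; rewrite big_mkord sumEFin lee_fin.
Qed.

Lemma has_sum_lim (u : nat -> R[i]) s : has_sum u s -> limn (series (u : nat -> R[i]^o)) = s.
Proof. by move=> h; apply: cvg_lim h; exact: norm_hausdorff. Qed.

Lemma square_sum_linear k c d (B B' : R) : square_sum_le c B -> square_sum_le d B' ->
  square_sum_le (fun n => k * c n + d n) (2 * modulus k ^+ 2 * B + 2 * B').
Proof.
move=> hc hd n.
apply: (@le_trans _ _ (\sum_(i < n) (2 * modulus k ^+ 2 * modulus (c i) ^+ 2 + 2 * modulus (d i) ^+ 2))).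
  by apply: ler_sum => i _; exact: modulus_linear_sqr.
rewrite big_split /= -!mulr_sumr; apply: lerD; apply: ler_wpM2l => //; last exact: hd.
  by rewrite mulr_ge0 // sqr_ge0.
exact: hc.
Qed.

Lemma square_sum_mul c d (B B' : R) : square_sum_le c B -> square_sum_le d B' ->
  exists s, has_sum (fun n => c n * (d n)^*) s.
Proof.
move=> hc hd.
have [n|n|s hs _] := has_sum_dominated (u := fun n => c n * (d n)^*) (v := fun n => modulus (c n) ^+ 2 + modulus (d n) ^+ 2) (B := B + B').
- rewrite modulusM modulus_conj; have := sqr_ge0 (modulus (c n) - modulus (d n)).
  have := modulus_ge0 (c n); have := modulus_ge0 (d n); nra.
- by rewrite big_split lerD.
by exists s.
Qed.

Lemma hardy_inner f h : in_space Hardy f -> in_space Hardy h ->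
  has_sum (fun n => taylor f n * (taylor h n)^*) (inner Hardy f h).
Proof.
move=> /in_hardyP [_ [B hB]] /in_hardyP [_ [B' hB']].
have [s hs] := square_sum_mul hB hB'.
by rewrite /inner (has_sum_lim hs).
Qed.

Lemma hardy_inner_eq f h s : has_sum (fun n => taylor f n * (taylor h n)^*) s -> inner Hardy f h = s.
Proof. exact: has_sum_lim. Qed.

Lemma has_sum_ge0 (u : nat -> R[i]) s : has_sum u s -> (forall n, 0 <= u n) -> 0 <= s.
Proof.
move=> hs u0.
have uE n : u n = (complex.Re (u n))%:C by have := u0 n; rewrite lecE; case: (u n) => x y /= /andP[/eqP -> _].
have uR n : 0 <= complex.Re (u n) by have := u0 n; rewrite lecE => /andP[_].
have sE : s^* = s.
  apply: has_sum_unique (has_sum_conj hs) _; apply: (eq_has_sum hs) => n.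
  by rewrite uE; apply: complex_eq => //=; rewrite oppr0.
have i0 : complex.Im s = 0.
  by have := congr1 (@complex.Im R) sE; case: (s) => x y /=; lra.
rewrite lecE i0 eqxx /=; apply/ler_addgt0Pr => e e0.
move/has_sumP: hs => /(_ e e0) [N /(_ N (leqnn _)) hN].
have := le_lt_trans (normRe_le _) hN; rewrite ReD ReN ltr_norml => /andP[_ h].
have : 0 <= complex.Re (\sum_(i < N) u i).
  by elim/big_rec: _ => // i x _ hx; rewrite ReD addr_ge0.
lra.
Qed.

Lemma binomial_coef1 n : binomial_coef (1 : R) n = 1.
Proof. by elim: n => //= n ->; rewrite mul1r addrC natr1 divff. Qed.

Lemma hardy_reproducing : reproducing (@Hardy R) 1.
Proof.
have g1 : (0 : R) < space_exponent Hardy by exact: ltr01.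
split=> /=.
- exact: ltr01.
- move=> f h E /in_hardyP [af [B hB]]; apply/in_hardyP; split; first exact: eqD_analytic af.
  by exists B; rewrite -(eqD_taylor E).
- by move=> f h h' E; rewrite (eqD_taylor E).
- move=> k f h /in_hardyP [af [B hB]] /in_hardyP [ah [B' hB']]; apply/in_hardyP; split.
    exact: linear_analytic.
  exists (2 * modulus k ^+ 2 * B + 2 * B'); rewrite taylor_linear //.
  exact: square_sum_linear.
- move=> k f h f' hf hh hf'; apply: hardy_inner_eq.
  have [[af _] [ah _]] : in_space Hardy f /\ in_space Hardy h by [].
  rewrite taylor_linear //.
  apply: (eq_has_sum (has_sumD (has_sumZ (c := k) (hardy_inner hf hf')) (hardy_inner hh hf'))) => n.
  by rewrite /= mulrDl mulrA.
- move=> f h hf hh; apply: hardy_inner_eq.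
  apply: (eq_has_sum (has_sum_conj (hardy_inner hf hh))) => n.
  by rewrite -[LHS]/(Num.conj _) rmorphM /= conjCK mulrC.
- move=> f hf; apply: has_sum_ge0 (hardy_inner hf hf) _ => n.
  by rewrite mulcJ ler0c sqr_ge0.
- move=> x dx; apply/in_hardyP; split; first exact: kernel_analytic.
  have x0 := modulus_ge0 x; have /diskP x1 := dx.
  exists (1 - modulus x ^+ 2)^-1 => n; rewrite taylor_kernel //.
  rewrite (eq_bigr (fun i : 'I_n => (modulus x ^+ 2) ^+ i)) => [|i _].
    by apply: geo_sum_le; rewrite ?sqr_ge0 // exprn_ilt1.
  by rewrite binomial_coef1 mul1r modulusX modulus_conj exprAC.
- move=> f x hf dx; rewrite mul1r; apply: hardy_inner_eq.
  have [af _] := hf; rewrite taylor_kernel //.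
  apply: (eq_has_sum (taylorP af dx)) => n.
  by rewrite binomial_coef1 mul1r rmorphXn /= conjCK.
Qed.

(** Multiplication by [z] shifts the sequence of coefficients. *)
Lemma hardy_shift_isometric f h : in_space Hardy f -> in_space Hardy h ->
  (forall z, disk z -> h z = z * f z) -> inner Hardy h h = inner Hardy f f.
Proof.
move=> hf hh E; have [af _] := hf.
have th : taylor h = (fun n => if n is n'.+1 then taylor f n' else 0).
  apply: taylorE => z dz; rewrite E //.
  apply/(has_sum_shift _ _ 1); rewrite big_ord1 mul0r subr0.
  apply: (eq_has_sum (has_sumZ (c := z) (taylorP af dz))) => n.
  by rewrite addn1 exprS; ring.
apply: hardy_inner_eq; rewrite th.
apply/(has_sum_shift _ _ 1); rewrite big_ord1 mul0r subr0.
by apply: (eq_has_sum (hardy_inner hf hf)) => n; rewrite addn1.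
Qed.

End Hardy.

(** * Linear changes of variables in the plane *)

Section PlaneMeasure.
Variable R : realType.
Local Notation T := (measurableTypeR R).
Local Notation leb := (@lebesgue_measure R).
Local Notation leb2 := (leb \x leb)%E.
Local Notation image_measure :=
  (measure_function_pushforward__canonical__measure_function_Measure).

Lemma measurable_shift (a : R) : measurable_fun [set: T] (fun x : T => (x + a) : T).
Proof. exact: measurable_funD. Qed.

Lemma measurable_scale (a : R) : measurable_fun [set: T] (fun x : T => (a * x) : T).
Proof. exact: measurable_funM. Qed.

Lemma preimage_shift_ocitv (a x y : R) :
  (fun z : R => z + a) @^-1` `]x, y]%classic = `](x - a), (y - a)]%classic.
Proof. by apply/seteqP; split => z /=; rewrite !in_itv /= ltrBlDr lerBrDr. Qed.

Lemma lebesgue_measure_shift (a : R) (A : set T) : measurable A ->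
  leb ((fun x : T => x + a : T) @^-1` A) = leb A.
Proof.
move=> mA.
apply/esym/(@lebesgue_measure_unique R (image_measure leb (measurable_shift a))) => //= _ [[x y]] _ <-.
rewrite /pushforward /= preimage_shift_ocitv !lebesgue_measure_itv /= !lte_fin.
by rewrite ltrD2r -!EFinB opprB addrA subrK.
Qed.

Lemma preimage_scale_ocitv (a x y : R) : 0 < a ->
  (fun z : R => a * z) @^-1` `]x, y]%classic = `](x / a), (y / a)]%classic.
Proof.
by move=> a0; apply/seteqP; split => z /=; rewrite !in_itv /= ltr_pdivrMr // ler_pdivlMr // ![z * a]mulrC.
Qed.

Lemma lebesgue_measure_scale (a : R) (A : set T) : 0 < a -> measurable A ->
  (a%:E * leb ((fun x : T => (a * x)%R : T) @^-1` A) = leb A)%E.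
Proof.
move=> ap mA.
apply/esym/(@lebesgue_measure_unique R (mscale (NngNum (ltW ap)) (image_measure leb (measurable_scale a)))) => //= _ [[x y]] _ <-.
rewrite /mscale /= /pushforward /= preimage_scale_ocitv // !lebesgue_measure_itv /= !lte_fin.
rewrite ltr_pM2r ?invr_gt0 //; case: ifP => _; last by rewrite mule0.
by rewrite -!EFinB -EFinM -mulrBl mulrCA divff ?mulr1 // gt_eqF.
Qed.

Definition shearX (k : R) (p : T * T) : T * T := (p.1 + k * p.2 : T, p.2).
Definition shearY (k : R) (p : T * T) : T * T := (p.1, p.2 + k * p.1 : T).
Definition dilation (k : R) (p : T * T) : T * T := (k * p.1 : T, k * p.2 : T).

Lemma measurable_shearX k : measurable_fun [set: T * T] (shearX k).
Proof.
apply: measurable_fun_pair; last exact: measurable_snd.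
apply: measurable_funD; first exact: measurable_fst.
by apply: measurable_funM => //; exact: measurable_snd.
Qed.

Lemma measurable_shearY k : measurable_fun [set: T * T] (shearY k).
Proof.
apply: measurable_fun_pair; first exact: measurable_fst.
apply: measurable_funD; first exact: measurable_snd.
by apply: measurable_funM => //; exact: measurable_fst.
Qed.

Lemma measurable_dilation k : measurable_fun [set: T * T] (dilation k).
Proof.
by apply: measurable_fun_pair; apply: measurable_funM.
Qed.

Lemma leb2_swap (X : set (T * T)) : measurable X -> (leb2 X = (leb \x^ leb) X)%E.
Proof. by move=> mX; apply: product_measure_unique => //= ? ? ? ?; rewrite product_measure2E. Qed.

(** By Fubini's theorem, since a shear translates each of the parallel lines that it preserves. *)
Lemma leb2_shearX k (X : set (T * T)) : measurable X -> leb2 (shearX k @^-1` X) = leb2 X.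
Proof.
move=> mX; apply/esym/(@product_measure_unique _ _ _ _ _ leb leb (image_measure leb2 (measurable_shearX k))) => //.
move=> A B mA mB /=; rewrite /pushforward leb2_swap; last first.
  by rewrite -[X in measurable X]setTI; apply: measurable_shearX => //; exact: measurableX.
rewrite -(product_measure2E leb leb mA mB) /product_measure2; apply: eq_integral => y _ /=.
have -> : ysection (shearX k @^-1` (A `*` B)) y = if y \in B then (fun x : T => x + k * y : T) @^-1` A else set0.
  apply/seteqP; split => x; rewrite /ysection /= !inE /shearX /=.
    by move=> [Ax By]; rewrite mem_set.
  by case: ifPn => // yB Ax; split => //; exact: set_mem.
case: ifPn => yB; last by rewrite notin_ysectionX.
by rewrite in_ysectionX // lebesgue_measure_shift.
Qed.

Lemma leb2_shearY k (X : set (T * T)) : measurable X -> leb2 (shearY k @^-1` X) = leb2 X.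
Proof.
move=> mX; apply/esym/(@product_measure_unique _ _ _ _ _ leb leb (image_measure leb2 (measurable_shearY k))) => //.
move=> A B mA mB /=; rewrite /pushforward.
rewrite -(product_measure1E leb leb mA mB) /product_measure1; apply: eq_integral => x _ /=.
have -> : xsection (shearY k @^-1` (A `*` B)) x = if x \in A then (fun y : T => y + k * x : T) @^-1` B else set0.
  apply/seteqP; split => y; rewrite /xsection /= !inE /shearY /=.
    by move=> [Ax By]; rewrite mem_set.
  by case: ifPn => // xA By; split => //; exact: set_mem.
case: ifPn => xA; last by rewrite notin_xsectionX.
by rewrite in_xsectionX // lebesgue_measure_shift.
Qed.

Lemma leb2_dilation k (X : set (T * T)) : 0 < k -> measurable X ->
  ((k ^+ 2)%R%:E * leb2 (dilation k @^-1` X) = leb2 X)%E.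
Proof.
move=> k0 mX.
have k2 : 0 <= k ^+ 2 by rewrite sqr_ge0.
apply/esym/(@product_measure_unique _ _ _ _ _ leb leb (mscale (NngNum k2) (image_measure leb2 (measurable_dilation k)))) => //.
move=> A B mA mB /=; rewrite /mscale /= /pushforward.
have -> : dilation k @^-1` (A `*` B) = ((fun x : T => k * x : T) @^-1` A) `*` ((fun x : T => k * x : T) @^-1` B).
  by apply/seteqP; split => -[x y].
rewrite product_measure1E; last 2 first.
- by rewrite -[X in measurable X]setTI; exact: measurable_scale.
- by rewrite -[X in measurable X]setTI; exact: measurable_scale.
by rewrite -(lebesgue_measure_scale k0 mA) -(lebesgue_measure_scale k0 mB) expr2 EFinM muleACA.
Qed.

(** The rotation by twice the arctangent of [k] is a composition of three shears, which preserve
    the area; no change of variables formula is needed. *)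
Definition rotation (k : R) (p : T * T) : T * T :=
  shearX (- k) (shearY (2 * k / (1 + k ^+ 2)) (shearX (- k) p)).

Lemma measurable_rotation k : measurable_fun [set: T * T] (rotation k).
Proof.
apply: (measurableT_comp (measurable_shearX (- k))).
exact: (measurableT_comp (measurable_shearY _) (measurable_shearX _)).
Qed.

Lemma leb2_rotation k (X : set (T * T)) : measurable X -> leb2 (rotation k @^-1` X) = leb2 X.
Proof.
move=> mX.
have m1 : measurable (shearX (- k) @^-1` X).
  by rewrite -[X in measurable X]setTI; exact: measurable_shearX.
have m2 : measurable (shearY (2 * k / (1 + k ^+ 2)) @^-1` (shearX (- k) @^-1` X)).
  by rewrite -[X in measurable X]setTI; exact: measurable_shearY.
by rewrite -(leb2_shearX (- k) mX) -(leb2_shearY (2 * k / (1 + k ^+ 2)) m1) -(leb2_shearX (- k) m2).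
Qed.

Definition rotation_number (k : R) : R[i] := (1 - k ^+ 2) / (1 + k ^+ 2) +i* (2 * k / (1 + k ^+ 2)).

Lemma of_plane_rotation k p : of_plane (rotation k p) = rotation_number k * of_plane p.
Proof.
have k1 : 1 + k ^+ 2 != 0 by rewrite gt_eqF // ltr_pwDl // sqr_ge0.
case: p => x y; apply: complex_eq; rewrite ?ReM ?ImM /=; by field.
Qed.

Lemma modulus_rotation_number k : modulus (rotation_number k) = 1.
Proof.
have k1 : 1 + k ^+ 2 != 0 by rewrite gt_eqF // ltr_pwDl // sqr_ge0.
apply/eqP; rewrite -(@eqrXn2 _ 2) ?modulus_ge0 // modulusE /=; apply/eqP; by field.
Qed.

Lemma rotation_number_surj (w : R[i]) : modulus w = 1 -> w != -1 -> exists k, w = rotation_number k.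
Proof.
case: w => x y m1 w1.
have sq : x ^+ 2 + y ^+ 2 = 1 by have := modulusE (x +i* y); rewrite m1 /= expr1n => <-.
have x1 : 1 + x != 0.
  apply: contraNneq w1 => x1; have xE : x = -1 by lra.
  have : y ^+ 2 = 0 by move: sq; rewrite xE sqrrN expr1n; lra.
  by move/eqP; rewrite sqrf_eq0 => /eqP ->; rewrite xE; apply/eqP/complex_eq => //=; rewrite oppr0.
exists (y / (1 + x)).
have yE : y ^+ 2 = (1 - x) * (1 + x) by rewrite -subr_sqr expr1n -sq addrAC subrr add0r.
have d1 : 1 + (y / (1 + x)) ^+ 2 = 2 / (1 + x).
  by rewrite exprMn exprVn yE; field.
have d2 : 1 - (y / (1 + x)) ^+ 2 = 2 * x / (1 + x).
  by rewrite exprMn exprVn yE; field.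
by apply: complex_eq => /=; rewrite d1 ?d2; field.
Qed.

End PlaneMeasure.

(** * Integrals of radial functions *)

Section RadialMeasure.
Variable R : realType.
Local Notation T := (measurableTypeR R).
Local Notation leb := (@lebesgue_measure R).
Local Notation leb2 := (leb \x leb)%E.
Local Notation image_measure :=
  (measure_function_pushforward__canonical__measure_function_Measure).

Definition sqr_modulus (p : T * T) : T := (p.1 : R) ^+ 2 + (p.2 : R) ^+ 2.

Lemma sqr_modulusE (p : T * T) : sqr_modulus p = modulus (of_plane p) ^+ 2.
Proof. by rewrite modulusE. Qed.

Lemma measurable_sqr_modulus : measurable_fun [set: T * T] sqr_modulus.
Proof.
apply: measurable_funD; apply: measurable_funX; [exact: measurable_fst|exact: measurable_snd].
Qed.

Lemma measurable_preimage_sqr_modulus (A : set T) : measurable A -> measurable (sqr_modulus @^-1` A).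
Proof. by move=> mA; rewrite -[X in measurable X]setTI; exact: measurable_sqr_modulus. Qed.

Definition open_ball (r : R) : set (T * T) := [set p | modulus (of_plane p) < r].

Lemma open_ballE r : 0 <= r -> open_ball r = sqr_modulus @^-1` `[0, r ^+ 2[%classic.
Proof.
move=> r0; apply/seteqP; split => p; rewrite /open_ball /= in_itv /= sqr_modulusE sqr_ge0 /=;
  by rewrite ltr_pXn2r ?nnegrE ?modulus_ge0.
Qed.

Lemma measurable_open_ball r : 0 <= r -> measurable (open_ball r).
Proof. by move=> r0; rewrite open_ballE //; exact: measurable_preimage_sqr_modulus. Qed.

Lemma plane_diskE : @plane_disk R = open_ball 1.
Proof. by apply/seteqP; split => p /= /diskP. Qed.

Lemma leb2_square (r : R) : 0 <= r ->
  leb2 (`[- r, r]%classic `*` `[- r, r]%classic) = ((2 * r) ^+ 2)%:E.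
Proof.
move=> r0; rewrite product_measure1E //= !lebesgue_measure_itv /= lte_fin.
rewrite expr2 EFinM; have [h|h] := ltP (- r) r.
  by rewrite -EFinB; have -> : r - - r = 2 * r by ring.
have -> : r = 0 by lra.
by rewrite mulr0 mule0.
Qed.

Lemma leb2_unit_ball : exists2 c : R, 0 < c & leb2 (open_ball 1) = c%:E.
Proof.
have mB := measurable_open_ball (@ler01 R).
have le4 : (leb2 (open_ball 1) <= ((2 * 1) ^+ 2)%:E)%E.
  rewrite -leb2_square //; apply: le_measure; rewrite ?inE //; first exact: measurableX.
  move=> p; rewrite /open_ball /= => p1; split; rewrite /= in_itv /= -ler_norml.
    by apply: le_trans (normRe_le (of_plane p)) (ltW p1).
  by apply: le_trans (normIm_le (of_plane p)) (ltW p1).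
have ge1 : (((2 * (1 / 2)) ^+ 2)%:E <= leb2 (open_ball 1))%E.
  rewrite -leb2_square; last by lra.
  apply: le_measure; rewrite ?inE //; first exact: measurableX.
  move=> -[x y] [] /=; rewrite !in_itv /= => /andP[x1 x2] /andP[y1 y2].
  have m0 := modulus_ge0 (of_plane (x, y)); have : modulus (of_plane (x, y)) ^+ 2 < 1.
    by rewrite modulusE /=; nra.
  by rewrite /open_ball /=; nra.
move: le4 ge1; case E : (leb2 (open_ball 1)) => [c| |] //=; rewrite !lee_fin => _ c1.
by exists c => //; move: c1; rewrite mulrC divfK ?pnatr_eq0 // expr1n; lra.
Qed.

Lemma area_unit_disk_gt0 : exists2 c : R, 0 < c & forall x : R, 0 < x ->
  @area R (open_ball x) = (c * x ^+ 2)%:E.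
Proof.
have [c c0 hc] := leb2_unit_ball.
exists (pi^-1 * c); first by rewrite mulr_gt0 // invr_gt0 pi_gt0.
move=> x x0; rewrite -[LHS]/((pi^-1)%:E * leb2 (open_ball x))%E.
have xi : 0 < x^-1 by rewrite invr_gt0.
have := leb2_dilation xi (measurable_open_ball (@ler01 R)).
have -> : dilation x^-1 @^-1` (open_ball 1) = open_ball x.
  have E p : of_plane (dilation x^-1 p) = (x^-1)%:C * of_plane p.
    by apply: complex_eq; rewrite ?ReM ?ImM /=; ring.
  have Eb p : (modulus (of_plane (dilation x^-1 p)) < 1) = (modulus (of_plane p) < x).
    by rewrite E modulusM modulusC gtr0_norm // ltr_pdivrMl // mulr1.
  by apply/seteqP; split => p hp; move: (Eb p); move: hp; rewrite /preimage /open_ball /mkset => -> //= ->.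
rewrite hc => h.
have : (leb2 (open_ball x) = (x ^+ 2 * c)%:E)%E.
  move: h; case: (leb2 (open_ball x)) => [v| |].
  - rewrite -EFinM => -[<-]; congr EFin; rewrite exprVn mulrA divff ?mul1r // expf_neq0 // gt_eqF //.
  - by rewrite mulry gtr0_sg ?mul1e // exprn_gt0.
  - by rewrite mulrNy gtr0_sg ?mul1e // exprn_gt0.
by move=> ->; rewrite -EFinM; congr EFin; ring.
Qed.

(** By invariance under dilations, the area of a ball is proportional to the square of its
    radius, and the half-lines generate the Borel sets. *)
Lemma radial_distribution : exists2 c : R, 0 < c & forall A : set T, measurable A ->
  @area R (sqr_modulus @^-1` A) = (c%:E * leb (A `&` `[0%R, +oo[%classic))%E.
Proof.
have [c c0 hc] := area_unit_disk_gt0; exists c => // A mA.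
have c0' := ltW c0.
have mI : measurable (`[0%R, +oo[%classic : set T) by [].
suff : image_measure (@area R) measurable_sqr_modulus A = mscale (NngNum c0') (mrestr leb mI) A by [].
apply: (@measure_unique _ R T (@RGenInftyO.G R) (fun n => `]-oo, n%:R[%classic) _ _ _ _
  (image_measure (@area R) measurable_sqr_modulus) (mscale (NngNum c0') (mrestr leb mI))) => //.
- exact: RGenInftyO.measurableE.
- move=> _ _ [x ->] [y ->]; exists (Num.min x y).
  by apply/seteqP; split => z /=; rewrite !in_itv /= lt_min => /andP.
- by move=> n; exists n%:R.
- apply/seteqP; split => // x _; exists (Num.truncn x).+1 => //=.
  by rewrite in_itv /= truncnS_gt // num_real.
- move=> _ [x ->].
  rewrite -[LHS]/(@area R (sqr_modulus @^-1` `]-oo, x[%classic)).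
  rewrite -[RHS]/(c%:E * leb (`]-oo, x[%classic `&` `[0%R, +oo[%classic))%E.
  have [x0|x0] := ltP 0 x.
    have -> : sqr_modulus @^-1` `]-oo, x[%classic = open_ball (Num.sqrt x).
      rewrite open_ballE ?sqrtr_ge0 // sqr_sqrtr ?(ltW x0) //.
      apply/seteqP; split => p; rewrite /= !in_itv /= ?sqr_modulusE ?sqr_ge0 //= => /andP[] //.
    have -> : `]-oo, x[%classic `&` `[0, +oo[%classic = `[0, x[%classic.
      apply/seteqP; split => y /=; rewrite !in_itv /= ?andbT; first by move=> [-> ->].
      by move=> /andP[].
    rewrite hc ?sqrtr_gt0 // sqr_sqrtr ?(ltW x0) // lebesgue_measure_itv /= lte_fin x0.
    by rewrite sube0 EFinM.
  have -> : sqr_modulus @^-1` `]-oo, x[%classic = set0.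
    apply/seteqP; split => p //=; rewrite in_itv /= sqr_modulusE.
    by have := sqr_ge0 (modulus (of_plane p)); lra.
  have -> : `]-oo, x[%classic `&` `[0, +oo[%classic = set0.
    by apply/seteqP; split => y //=; rewrite !in_itv /= andbT => -[y1 y2]; lra.
  by rewrite !measure0 mule0.
- move=> n; rewrite -[X in (X < _)%E]/(@area R (sqr_modulus @^-1` `]-oo, n%:R[%classic)).
  apply: (@le_lt_trans _ _ (@area R (open_ball (n%:R + 1)))).
    apply: le_measure; rewrite ?inE.
    + exact: measurable_preimage_sqr_modulus.
    + by apply: measurable_open_ball; rewrite addr_ge0.
    + move=> p /=; rewrite in_itv /= sqr_modulusE /open_ball /= => h.
      have := modulus_ge0 (of_plane p); have : 0 <= (n%:R : R) by []. nra.
  by rewrite hc ?ltry // ltr_wpDl.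
Qed.

Lemma radial_integral : exists2 c : R, 0 < c & forall (r : R) (g : R -> R), 0 <= r ->
  measurable_fun `[0, r ^+ 2[%classic g -> (forall t, 0 <= t < r ^+ 2 -> 0 <= g t) ->
  (\int[@area R]_(p in open_ball r) (g (sqr_modulus p))%:E =
   c%:E * \int[leb]_(t in `[0%R, (r ^+ 2)%R[) (g t)%:E)%E.
Proof.
have [c c0 hc] := radial_distribution; exists c => // r g r0 mg g0.
have c0' := ltW c0.
rewrite open_ballE //.
rewrite -(@ge0_integral_pushforward _ _ _ _ _ _ measurable_sqr_modulus (@area R) _ (fun t => (g t)%:E)) //.
- rewrite -(@ge0_integral_mscale _ _ _ leb _ _ (NngNum c0')) //.
  + apply: eq_measure_integral; first exact: measurable_sqr_modulus.
    move=> ? A mA AI; rewrite -[LHS]/(@area R (sqr_modulus @^-1` A)) hc //.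
    rewrite -[RHS]/(c%:E * leb A)%E; congr (_ * leb _)%E; apply: setIidl => x /AI /=; by rewrite ?in_itv /= ?andbT => /andP[-> _].
  + exact/measurable_EFinP.
- exact/measurable_EFinP.
- by move=> t; rewrite inE /= in_itv /= => ht; rewrite lee_fin g0.
Qed.

End RadialMeasure.

(** * Beta integrals *)

Section Beta.
Variable R : realType.
Variable alpha : R.
Hypothesis ha : -1 < alpha.
Local Notation T := (measurableTypeR R).
Local Notation leb := (@lebesgue_measure R).

(** The integrand may be singular at one, whence the restriction to smaller intervals. *)
Lemma ftc_below_one (F f : R -> R) : (forall t : R, t < 1 -> is_derive t 1 F (f t)) ->
  (forall t : R, t < 1 -> {for t, continuous f}) -> forall s, 0 < s -> s < 1 ->
  leb.-integrable `[0, s[%classic (EFin \o f) /\ \int[leb]_(t in `[0, s[) f t = F s - F 0.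
Proof.
move=> dF cf s s0 s1.
have csf : {within `[0, s]%classic, continuous f}.
  apply: continuous_in_subspaceT => t; rewrite inE /= in_itv /= => /andP[_ ts].
  by apply: cf; lra.
have intf : leb.-integrable `[0, s]%classic (EFin \o f).
  by apply: continuous_compact_integrable => //; exact: segment_compact.
have intf' : leb.-integrable `[0, s[%classic (EFin \o f).
  apply: integrableS intf => // t /=; rewrite !in_itv /= => /andP[-> /ltW ->] //.
split => //; rewrite Rintegral_itv_bndo_bndc // /Rintegral.
have dF1 (t : R) : t < 1 -> derivable F t 1 by move=> t1; have [] := dF t t1.
have cF (t : R) : t < 1 -> {for t, continuous F}.
  by move=> t1; apply: differentiable_continuous; apply/derivable1_diffP; exact: dF1.
rewrite (@continuous_FTC2 _ f F 0 s) //.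
- split.
  + by move=> t; rewrite in_itv /= => /andP[_ ts]; apply: dF1; lra.
  + by apply: cvg_at_right_filter; apply: cF; lra.
  + by apply: cvg_at_left_filter; apply: cF; lra.
- move=> t; rewrite in_itv /= => /andP[_ ts].
  by rewrite derive1E; have [_ ->] := dF t (lt_trans ts s1).
Qed.

Definition beta (m : nat) (s : R) : R := \int[leb]_(t in `[0, s[) (t ^+ m * (1 - t) `^ alpha).

Lemma derive_one_sub (t : R) : is_derive t 1 (fun t : R => 1 - t : R) (-1).
Proof.
have h := derive_sub (derive_const 1 t) (derive_lin 1 t).
rewrite sub0r in h; move: h; congr (is_derive _ _ _ _).
by apply/funext => x; rewrite mulr1.
Qed.

Lemma derive_one_sub_powR (p t : R) : t < 1 ->
  is_derive t 1 (fun t : R => (1 - t) `^ p) (- (p * (1 - t) `^ (p - 1))).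
Proof.
move=> t1; have h : is_derive (1 - t) 1 (fun x => x `^ p) (p * (1 - t) `^ (p - 1)).
  by apply: is_derive1_powR; lra.
by have := @derive_comp _ _ (fun t => 1 - t) t _ _ h (derive_one_sub t); rewrite mulrN1.
Qed.

Lemma derive_pow (m : nat) (t : R) : is_derive t 1 (fun t : R => t ^+ m.+1) (m.+1%:R * t ^+ m).
Proof.
elim: m => [|m IH].
  by rewrite mulr1; have := derive_lin 1 t; congr (is_derive _ _ _ _); apply/funext => x; rewrite mulr1 expr1.
have h := derive_mul IH (derive_lin 1 t).
have -> : m.+2%:R * t ^+ m.+1 = t ^+ m.+1 * 1 + t * 1 * (m.+1%:R * t ^+ m).
  by rewrite exprS -[m.+2%:R]natr1; ring.
move: h; congr (is_derive _ _ _ _); apply/funext => x.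
by rewrite mulr1 -exprSr.
Qed.

Lemma continuous_beta_integrand (m : nat) (t : R) : t < 1 ->
  {for t, continuous (fun t : R => t ^+ m * (1 - t) `^ alpha)}.
Proof.
move=> t1; apply: differentiable_continuous; apply/derivable1_diffP.
case: m => [|m].
  have [d _] := derive_mul (derive_const 1 t) (derive_one_sub_powR alpha t1).
  by move: d; congr (derivable _ _ _); apply/funext => x; rewrite expr0.
by have [d _] := derive_mul (derive_pow m t) (derive_one_sub_powR alpha t1).
Qed.

Lemma integrable_beta (m : nat) s : s < 1 ->
  leb.-integrable `[0, s[%classic (EFin \o (fun t : R => t ^+ m * (1 - t) `^ alpha)).
Proof.
move=> s1; have [s0|s0] := ltP 0 s; last first.
  rewrite set_itv_ge ?bnd_simp -?leNgt //; exact: integrable_set0.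
have intf : leb.-integrable `[0, s]%classic (EFin \o (fun t : R => t ^+ m * (1 - t) `^ alpha)).
  apply: continuous_compact_integrable => //; first exact: segment_compact.
  apply: continuous_in_subspaceT => t; rewrite inE /= in_itv /= => /andP[_ ts].
  by apply: continuous_beta_integrand; lra.
apply: integrableS intf => // t /=; rewrite !in_itv /= => /andP[-> /ltW ->] //.
Qed.

Lemma beta_zero s : 0 < s -> s < 1 -> (alpha + 1) * beta 0 s = 1 - (1 - s) `^ (alpha + 1).
Proof.
move=> s0 s1.
have dF (t : R) : t < 1 -> is_derive t 1 (fun t : R => - (1 - t) `^ (alpha + 1)) ((alpha + 1) * (t ^+ 0 * (1 - t) `^ alpha)).
  move=> t1; have := derive_sub (derive_const 0 t) (derive_one_sub_powR (alpha + 1) t1).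
  rewrite expr0 mul1r sub0r opprK addrK; congr (is_derive _ _ _ _).
  by apply/funext => x; rewrite sub0r.
have [|_] := ftc_below_one dF _ s0 s1.
  move=> t t1; apply: cvgM; first exact: cvg_cst.
  exact: continuous_beta_integrand.
rewrite RintegralZl //; last exact: integrable_beta.
by rewrite /beta => ->; rewrite subr0 powR1 opprK addrC.
Qed.

(** The derivative of [t ^ (m+1) (1 - t) ^ (alpha+1)] is the combination of the two integrands. *)
Lemma beta_succ m s : 0 < s -> s < 1 ->
  m.+1%:R * beta m s - (alpha + 2 + m%:R) * beta m.+1 s = s ^+ m.+1 * (1 - s) `^ (alpha + 1).
Proof.
move=> s0 s1.
pose f n (t : R) := t ^+ n * (1 - t) `^ alpha.
have dF (t : R) : t < 1 -> is_derive t 1 (fun t : R => t ^+ m.+1 * (1 - t) `^ (alpha + 1))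
    (m.+1%:R * f m t - (alpha + 2 + m%:R) * f m.+1 t).
  move=> t1; have := derive_mul (derive_pow m t) (derive_one_sub_powR (alpha + 1) t1).
  congr (is_derive _ _ _ _); rewrite addrK /f.
  rewrite powRD; last by apply/implyP => _; apply/eqP => ?; lra.
  rewrite powRr1; last by lra.
  by rewrite exprS -natr1; ring.
have cf n (t : R) : t < 1 -> {for t, continuous (f n)} by exact: continuous_beta_integrand.
have [|_] := ftc_below_one dF _ s0 s1.
  move=> t t1; apply: cvgB; (apply: cvgM; first exact: cvg_cst); exact: cf.
have cI (k : R) n : leb.-integrable `[0, s[%classic (EFin \o (fun t : R => k * f n t)).
  have -> : (EFin \o (fun t : R => k * f n t)) = (fun t => (k%:E * (EFin \o f n) t)%E) by [].
  exact: integrableZl (integrable_beta n s1).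
rewrite RintegralB // !RintegralZl //; try exact: integrable_beta.
by rewrite /beta => ->; rewrite expr0n /= mul0r subr0.
Qed.

(** When [s] tends to one the boundary term of [beta_succ] disappears; what remains is the
    recursion of the binomial coefficients, inverted. *)
Lemma beta_limit (s : nat -> R) m : (forall k, 0 < s k < 1) -> s @ \oo --> (1 : R) ->
  (fun k => beta m (s k)) @ \oo --> ((alpha + 1)^-1 / binomial_coef (alpha + 2) m : R).
Proof.
move=> hs s1.
have a1 : alpha + 1 != 0 by apply/eqP => ?; move: ha; lra.
have u0 : (fun k => (1 - s k) `^ (alpha + 1)) @ \oo --> (0 : R).
  have p : 0 < alpha + 1 by move: ha; lra.
  apply: (@cvg_comp _ _ _ (fun k => 1 - s k) (fun x => x `^ (alpha + 1)) _ (0^'+)); last exact: powR_cvg0.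
  have w0 : (fun k => 1 - s k) @ \oo --> (0 : R).
    by rewrite -(subrr (1 : R)); apply: cvgB => //; exact: cvg_cst.
  move=> A /= /w0 /= hA; rewrite /nbhs /=; near=> k.
  have : 0 < 1 - s k by have := hs k; lra.
  by near: k.
elim: m => [|m IH].
  rewrite divr1.
  have -> : (fun k => beta 0 (s k)) = (fun k => (alpha + 1)^-1 * (1 - (1 - s k) `^ (alpha + 1))).
    apply/funext => k; have /andP[k0 k1] := hs k.
    by rewrite -beta_zero // mulKf.
  have h : (fun k => (alpha + 1)^-1 * (1 - (1 - s k) `^ (alpha + 1))) @ \oo --> (alpha + 1)^-1 * (1 - 0).
    by apply: cvgMl_tmp; apply: cvgB => //; exact: cvg_cst.
  by rewrite subr0 mulr1 in h.
have c0 : alpha + 2 + m%:R != 0 :> R.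
  apply/eqP => h; have : 0 <= m%:R :> R by []. move: ha h; lra.
have k0 n : binomial_coef (alpha + 2) n != 0 by rewrite gt_eqF // binomial_coef_gt0 //; move: ha; lra.
have -> : (fun k => beta m.+1 (s k)) = (fun k => (alpha + 2 + m%:R)^-1 * (m.+1%:R * beta m (s k) - s k ^+ m.+1 * (1 - s k) `^ (alpha + 1))).
  apply/funext => k; have /andP[s0 s1'] := hs k.
  by rewrite -(beta_succ m s0 s1') subKr mulKf.
have -> : (alpha + 1)^-1 / binomial_coef (alpha + 2) m.+1 =
    (alpha + 2 + m%:R)^-1 * (m.+1%:R * ((alpha + 1)^-1 / binomial_coef (alpha + 2) m) - 1 ^+ m.+1 * 0).
  have m0 : m.+1%:R != 0 :> R by rewrite pnatr_eq0.
  rewrite expr1n mulr0 subr0 /=; move: (k0 m) m0 c0 a1.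
  move: (binomial_coef _ m) m.+1%:R (_ + _ + _) (_ + 1) => x n y z x0 n0 y0 z0.
  by field; rewrite x0 n0 y0 z0.
apply: cvgMl_tmp.
apply: cvgB; first exact: cvgMl_tmp.
apply: cvgM => //.
apply: (@cvg_comp _ _ _ s (fun x : R => x ^+ m.+1) _ _ _ s1); exact: exprn_continuous.
Unshelve. all: by end_near.
Qed.
End Beta.

(** * Complex-valued integrals *)

Section ComplexIntegral.
Variable R : realType.
Local Notation T := (measurableTypeR R).
Local Notation mu := (@area R).
Variable D : set (T * T).
Hypothesis mD : measurable D.
Implicit Types (F G : R[i] -> R[i]) (k z : R[i]) (W : R[i] -> R).

Definition re_plane F (p : T * T) : R := complex.Re (F (of_plane p)).
Definition im_plane F (p : T * T) : R := complex.Im (F (of_plane p)).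

Definition cmeasurable F := measurable_fun D (re_plane F) /\ measurable_fun D (im_plane F).

Definition cintegrable F :=
  mu.-integrable D (EFin \o re_plane F) /\ mu.-integrable D (EFin \o im_plane F).

Definition cint F : R[i] := Rintegral mu D (re_plane F) +i* Rintegral mu D (im_plane F).

Lemma cmeasurable_cst k : cmeasurable (fun=> k).
Proof. by split; exact: measurable_cst. Qed.

Lemma cmeasurable_id : cmeasurable id.
Proof.
split; apply: measurable_funTS; [exact: measurable_fst|exact: measurable_snd].
Qed.

Lemma cmeasurableD F G : cmeasurable F -> cmeasurable G -> cmeasurable (fun z => F z + G z).
Proof.
move=> [F1 F2] [G1 G2]; split.
  have -> : re_plane (fun z => F z + G z) = (fun p => re_plane F p + re_plane G p).
    by apply/funext => p; rewrite /re_plane ReD.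
  exact: measurable_funD.
have -> : im_plane (fun z => F z + G z) = (fun p => im_plane F p + im_plane G p).
  by apply/funext => p; rewrite /im_plane ImD.
exact: measurable_funD.
Qed.

Lemma cmeasurableM F G : cmeasurable F -> cmeasurable G -> cmeasurable (fun z => F z * G z).
Proof.
move=> [F1 F2] [G1 G2]; split.
  have -> : re_plane (fun z => F z * G z) =
      (fun p => re_plane F p * re_plane G p - im_plane F p * im_plane G p).
    by apply/funext => p; rewrite /re_plane ReM.
  by apply: measurable_funB; exact: measurable_funM.
have -> : im_plane (fun z => F z * G z) =
    (fun p => re_plane F p * im_plane G p + im_plane F p * re_plane G p).
  by apply/funext => p; rewrite /im_plane ImM.
by apply: measurable_funD; exact: measurable_funM.
Qed.

Lemma cmeasurable_conj F : cmeasurable F -> cmeasurable (fun z => (F z)^*).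
Proof.
move=> [F1 F2]; split.
  have -> : re_plane (fun z => (F z)^*) = re_plane F by apply/funext => p; rewrite /re_plane; case: (F _).
  exact: F1.
have -> : im_plane (fun z => (F z)^*) = (fun p => - im_plane F p).
  by apply/funext => p; rewrite /im_plane; case: (F _).
exact: measurable_funN.
Qed.

Lemma cmeasurable_real W : measurable_fun D (W \o @of_plane R) -> cmeasurable (fun z => (W z)%:C).
Proof. by move=> mW; split => //; exact: measurable_cst. Qed.

Lemma cmeasurableX F n : cmeasurable F -> cmeasurable (fun z => F z ^+ n).
Proof.
move=> mF; elim: n => [|n IH]; first exact: cmeasurable_cst.
have -> : (fun z => F z ^+ n.+1) = (fun z => F z * F z ^+ n) by apply/funext => z; rewrite exprS.
exact: cmeasurableM.
Qed.

Lemma cmeasurable_sum (u : nat -> R[i] -> R[i]) n : (forall i, cmeasurable (u i)) ->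
  cmeasurable (fun z => \sum_(i < n) u i z).
Proof.
move=> mu_; elim: n => [|n IH].
  have -> : (fun z => \sum_(i < 0) u i z) = (fun=> 0) by apply/funext => z; rewrite big_ord0.
  exact: cmeasurable_cst.
have -> : (fun z => \sum_(i < n.+1) u i z) = (fun z => \sum_(i < n) u i z + u n z).
  by apply/funext => z; rewrite big_ord_recr.
exact: cmeasurableD.
Qed.

Lemma cmeasurable_sqr_modulus F : cmeasurable F ->
  measurable_fun D (fun p => modulus (F (of_plane p)) ^+ 2).
Proof.
move=> [F1 F2].
have -> : (fun p => modulus (F (of_plane p)) ^+ 2) = (fun p => re_plane F p ^+ 2 + im_plane F p ^+ 2).
  by apply/funext => p; rewrite modulusE.
by apply: measurable_funD; exact: measurable_funX.
Qed.

Lemma cmeasurable_has_sum (u : nat -> R[i] -> R[i]) F : (forall i, cmeasurable (u i)) ->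
  (forall p, D p -> has_sum (u^~ (of_plane p)) (F (of_plane p))) -> cmeasurable F.
Proof.
move=> hu hs; have mS n := cmeasurable_sum n hu; split.
  apply: (@measurable_fun_cvg _ _ _ D (fun n => re_plane (fun z => \sum_(i < n) u i z))).
  - by move=> n; have [] := mS n.
  - move=> p Dp; apply/cvgrPdist_lt => e e0.
    have /has_sumP /(_ e e0) [N hN] := hs p Dp; exists N => //= n Nn.
    rewrite distrC /re_plane -(raddfB (@complex.Re R)); exact: le_lt_trans (normRe_le _) (hN n Nn).
apply: (@measurable_fun_cvg _ _ _ D (fun n => im_plane (fun z => \sum_(i < n) u i z))).
- by move=> n; have [] := mS n.
- move=> p Dp; apply/cvgrPdist_lt => e e0.
  have /has_sumP /(_ e e0) [N hN] := hs p Dp; exists N => //= n Nn.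
  rewrite distrC /im_plane -(raddfB (@complex.Im R)); exact: le_lt_trans (normIm_le _) (hN n Nn).
Qed.

Lemma cintegrable_bound F (B : T * T -> R) : cmeasurable F ->
  mu.-integrable D (EFin \o B) -> (forall p, D p -> modulus (F (of_plane p)) <= B p) ->
  cintegrable F.
Proof.
move=> [F1 F2] iB FB; split; apply: (le_integrable mD _ _ iB).
- exact/measurable_EFinP.
- move=> p Dp; rewrite /= lee_fin; apply: le_trans (ler_norm _).
  exact: le_trans (normRe_le _) (FB p Dp).
- exact/measurable_EFinP.
- move=> p Dp; rewrite /= lee_fin; apply: le_trans (ler_norm _).
  exact: le_trans (normIm_le _) (FB p Dp).
Qed.

Lemma integrable_scale (k : R) (f : T * T -> R) : mu.-integrable D (EFin \o f) ->
  mu.-integrable D (EFin \o (fun p => k * f p)).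
Proof. exact: integrableZl. Qed.

Lemma integrable_add (f h : T * T -> R) : mu.-integrable D (EFin \o f) ->
  mu.-integrable D (EFin \o h) -> mu.-integrable D (EFin \o (fun p => f p + h p)).
Proof. exact: integrableD. Qed.

Lemma re_plane_linear k F G p :
  re_plane (fun z => k * F z + G z) p = complex.Re k * re_plane F p + (- complex.Im k * im_plane F p + re_plane G p).
Proof. by rewrite /re_plane /im_plane ReD ReM; ring. Qed.

Lemma im_plane_linear k F G p :
  im_plane (fun z => k * F z + G z) p = complex.Re k * im_plane F p + (complex.Im k * re_plane F p + im_plane G p).
Proof. by rewrite /re_plane /im_plane ImD ImM; ring. Qed.

Lemma cintegrable_linear k F G : cintegrable F -> cintegrable G -> cintegrable (fun z => k * F z + G z).
Proof.
move=> [F1 F2] [G1 G2]; split.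
  rewrite (funext (re_plane_linear k F G)).
  by apply: integrable_add; [|apply: integrable_add => //]; exact: integrable_scale.
rewrite (funext (im_plane_linear k F G)).
by apply: integrable_add; [|apply: integrable_add => //]; exact: integrable_scale.
Qed.

Lemma cint_linear k F G : cintegrable F -> cintegrable G ->
  cint (fun z => k * F z + G z) = k * cint F + cint G.
Proof.
move=> [F1 F2] [G1 G2]; apply: complex_eq.
  rewrite ReD ReM /= (funext (re_plane_linear k F G)).
  rewrite RintegralD //; [|exact: integrable_scale|by apply: integrable_add => //; exact: integrable_scale].
  rewrite RintegralD //; last exact: integrable_scale.
  by rewrite !RintegralZl //; ring.
rewrite ImD ImM /= (funext (im_plane_linear k F G)).
rewrite RintegralD //; [|exact: integrable_scale|by apply: integrable_add => //; exact: integrable_scale].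
rewrite RintegralD //; last exact: integrable_scale.
by rewrite !RintegralZl //; ring.
Qed.

Lemma eq_cint F G : (forall p, D p -> F (of_plane p) = G (of_plane p)) -> cint F = cint G.
Proof.
by move=> E; congr (_ +i* _); apply: eq_Rintegral => p; rewrite inE /re_plane /im_plane => /E ->.
Qed.

Lemma eq_cintegrable F G : (forall p, D p -> F (of_plane p) = G (of_plane p)) ->
  cintegrable F -> cintegrable G.
Proof.
move=> E [F1 F2]; split; [apply: eq_integrable F1|apply: eq_integrable F2] => // p;
  by rewrite inE /= /re_plane /im_plane => /E ->.
Qed.

Lemma cint0 : cint (fun=> 0) = 0.
Proof.
by rewrite /cint /re_plane /im_plane /= !Rintegral_cst // !mul0r.
Qed.

Lemma cintegrable0 : cintegrable (fun=> 0).
Proof. by split; exact: integrable0. Qed.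

Lemma cintZ k F : cintegrable F -> cint (fun z => k * F z) = k * cint F.
Proof.
move=> iF; have := cint_linear k iF cintegrable0; rewrite cint0 addr0 => <-.
by apply: eq_cint => p _; rewrite addr0.
Qed.

Lemma cintegrableZ k F : cintegrable F -> cintegrable (fun z => k * F z).
Proof.
move=> iF; apply: eq_cintegrable (cintegrable_linear k iF cintegrable0) => p _; exact: addr0.
Qed.

Lemma cint_conj F : cintegrable F -> cint (fun z => (F z)^*) = (cint F)^*.
Proof.
move=> [_ F2]; apply: complex_eq => /=.
  by apply: eq_Rintegral => p _; rewrite /re_plane; case: (F _).
rewrite -[RHS]mulN1r -RintegralZl //; apply: eq_Rintegral => p _.
by rewrite mulN1r /im_plane; case: (F _).
Qed.

Lemma cint_bound F (B : T * T -> R) : cintegrable F -> mu.-integrable D (EFin \o B) ->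
  (forall p, D p -> modulus (F (of_plane p)) <= B p) ->
  modulus (cint F) <= 2 * Rintegral mu D B.
Proof.
move=> [F1 F2] iB FB; apply: le_trans (modulus_le_ReIm _) _.
rewrite mulr_natl mulr2n lerD // /cint /=.
  apply: le_trans (le_normr_Rintegral mD F1) _; apply: le_Rintegral => //.
    exact: integrable_norm.
  by move=> p Dp; apply: le_trans (normRe_le _) (FB p Dp).
apply: le_trans (le_normr_Rintegral mD F2) _; apply: le_Rintegral => //.
  exact: integrable_norm.
by move=> p Dp; apply: le_trans (normIm_le _) (FB p Dp).
Qed.

Lemma cint_sum (u : nat -> R[i] -> R[i]) n : (forall i, cintegrable (u i)) ->
  cintegrable (fun z => \sum_(i < n) u i z) /\
  cint (fun z => \sum_(i < n) u i z) = \sum_(i < n) cint (u i).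
Proof.
move=> hu; elim: n => [|n [IH1 IH2]].
  have -> : (fun z => \sum_(i < 0) u i z) = (fun=> 0) by apply/funext => z; rewrite big_ord0.
  by rewrite big_ord0 cint0; split => //; exact: cintegrable0.
have -> : (fun z => \sum_(i < n.+1) u i z) = (fun z => 1 * u n z + \sum_(i < n) u i z).
  by apply/funext => z; rewrite big_ord_recr mul1r addrC.
split; first exact: cintegrable_linear.
by rewrite cint_linear // IH2 big_ord_recr /= mul1r addrC.
Qed.

Lemma has_sum_cint (u : nat -> R[i] -> R[i]) F W : mu.-integrable D (EFin \o (W \o @of_plane R)) ->
  (forall p, D p -> 0 <= W (of_plane p)) ->
  (forall i, cintegrable (u i)) -> cintegrable F ->
  (forall e : R, 0 < e -> exists N, forall n, (N <= n)%N -> forall p, D p ->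
     modulus (\sum_(i < n) u i (of_plane p) - F (of_plane p)) <= e * W (of_plane p)) ->
  has_sum (fun n => cint (u n)) (cint F).
Proof.
move=> iW W0 iu iF hu; apply/has_sumP => e e0.
set I := Rintegral mu D (W \o @of_plane R).
have I0 : 0 <= I by apply: Rintegral_ge0.
have d0 : 0 < e / (4 * (I + 1)) by rewrite divr_gt0 // mulr_gt0 //; lra.
have [N hN] := hu _ d0; exists N => n Nn.
have [is_ ES] := cint_sum n iu.
rewrite -ES.
have -> : cint (fun z => \sum_(i < n) u i z) - cint F = cint (fun z => -1 * F z + \sum_(i < n) u i z).
  by rewrite cint_linear // mulN1r addrC.
apply: le_lt_trans (cint_bound (cintegrable_linear (-1) iF is_) (integrable_scale (e / (4 * (I + 1))) iW) _) _.
  by move=> p Dp; rewrite mulN1r addrC; exact: hN.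
rewrite RintegralZl // -/I.
have -> : 2 * (e / (4 * (I + 1)) * I) = e * (I / (2 * (I + 1))).
  by field; apply/eqP => h; lra.
rewrite gtr_pMr // ltr_pdivrMr; lra.
Qed.

End ComplexIntegral.

(** * Moments of the Bergman weights *)

Section Moments.
Variable R : realType.
Variable alpha : R.
Hypothesis ha : -1 < alpha.
Local Notation T := (measurableTypeR R).
Local Notation mu := (@area R).
Local Notation wt := (@bergman_weight R alpha).
Local Notation g := (alpha + 2).

Lemma weightE (p : T * T) : wt (of_plane p) = (alpha + 1) * (1 - sqr_modulus p) `^ alpha.
Proof. by rewrite /bergman_weight sqr_modulusE. Qed.

Lemma weight_ge0 z : 0 <= wt z.
Proof. by rewrite mulr_ge0 ?powR_ge0 //; move: ha; lra. Qed.

Lemma measurable_weight (D : set (T * T)) : measurable_fun D (wt \o @of_plane R).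
Proof.
apply: measurable_funTS; rewrite (_ : _ \o _ = (fun p => (alpha + 1) * (1 - sqr_modulus p) `^ alpha)); last first.
  by apply/funext => p; exact: weightE.
apply: measurable_funM => //.
apply: (measurableT_comp (measurable_powR alpha)).
by apply: measurable_funB => //; exact: measurable_sqr_modulus.
Qed.

Definition moment (m : nat) (r : R) : R :=
  Rintegral mu (open_ball r) (fun p => modulus (of_plane p) ^+ 2 ^+ m * wt (of_plane p)).

Lemma moment_integral : exists2 c : R, 0 < c & forall m (r : R), 0 < r -> r < 1 ->
  mu.-integrable (open_ball r) (EFin \o (fun p => modulus (of_plane p) ^+ 2 ^+ m * wt (of_plane p))) /\
  moment m r = c * ((alpha + 1) * beta alpha m (r ^+ 2)).
Proof.
have [c c0 hc] := radial_integral R; exists c => // m r r0 r1.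
pose G (t : R) := t ^+ m * ((alpha + 1) * (1 - t) `^ alpha).
have mG : measurable_fun [set: T] (G : T -> R).
  apply: measurable_funM; first exact: measurable_funX.
  apply: measurable_funM => //; apply: (measurableT_comp (measurable_powR alpha)).
  exact: measurable_funB.
have a1 : 0 <= alpha + 1 by move: ha; lra.
have G0 t : 0 <= t < r ^+ 2 -> 0 <= G t.
  by move=> /andP[t0 _]; rewrite mulr_ge0 ?exprn_ge0 // mulr_ge0 ?powR_ge0.
have E := hc r G (ltW r0) (measurable_funTS mG) G0.
have EG p : G (sqr_modulus p) = modulus (of_plane p) ^+ 2 ^+ m * wt (of_plane p).
  by rewrite weightE /G sqr_modulusE.
have s1 : r ^+ 2 < 1 by rewrite exprn_ilt1 // ltW.
have EB : (\int[lebesgue_measure]_(t in `[0%R, (r ^+ 2)%R[) (G t)%:E = ((alpha + 1) * beta alpha m (r ^+ 2))%:E)%E.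
  rewrite /beta -RintegralZl //; last exact: integrable_beta.
  rewrite /Rintegral fineK.
    by apply: eq_integral => t _; congr EFin; rewrite /G mulrCA.
  apply: integrable_fin_num => //; exact: integrableZl (integrable_beta alpha m s1).
have EI : (\int[mu]_(p in open_ball r) (modulus (of_plane p) ^+ 2 ^+ m * wt (of_plane p))%:E =
    (c * ((alpha + 1) * beta alpha m (r ^+ 2)))%:E)%E.
  rewrite EFinM -EB -E; apply: eq_integral => p _; by rewrite EG.
split; last by rewrite /moment /Rintegral EI.
have mb : measurable (open_ball r) := measurable_open_ball (ltW r0).
apply/integrableP; split.
  apply/measurable_EFinP; rewrite -(funext EG); apply: measurable_funTS.
  have h := measurableT_comp mG (@measurable_sqr_modulus R); exact: h.
rewrite (_ : integral _ _ _ = (c * ((alpha + 1) * beta alpha m (r ^+ 2)))%:E); first exact: ltry.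
rewrite -EI; apply: eq_integral => p _.
by rewrite gee0_abs // lee_fin mulr_ge0 ?weight_ge0 // exprn_ge0 // sqr_ge0.
Qed.

(** Integrals over the disk are limits of integrals over the disks of these radii, where power
    series converge uniformly. *)
Definition radius (k : nat) : R := 1 - k.+2%:R^-1.

Lemma radius_itv k : 0 < radius k < 1.
Proof.
have : 0 < k.+2%:R^-1 :> R by rewrite invr_gt0.
have : k.+2%:R^-1 < 1 :> R by rewrite invf_lt1 ?ltr1n.
by rewrite /radius; move: (_^-1) => x; lra.
Qed.

Lemma radius_cvg : radius @ \oo --> (1 : R).
Proof.
have h := @cvg_harmonic R; rewrite -cvg_shiftS in h.
have h' : (fun k => 1 - [sequence (harmonic n.+1 : R)]_n k) @ \oo --> (1 - 0 : R).
  by apply: cvgB; first exact: cvg_cst.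
by rewrite subr0 in h'.
Qed.

Lemma radius_mono : {homo radius : k l / (k <= l)%N >-> k <= l}.
Proof. by move=> k l kl; rewrite lerD2l lerN2 lef_pV2 ?posrE // ler_nat. Qed.

Lemma radius_above (x : R) : x < 1 -> exists k, x < radius k.
Proof.
move=> x1; have := radius_cvg => /cvgrPdist_lt /(_ (1 - x)).
rewrite subr_gt0 => /(_ x1) [N _ /(_ N (leqnn N))] h; exists N; move: h => /=.
have /andP[_ h1] := radius_itv N; rewrite gtr0_norm; lra.
Qed.

Lemma plane_disk_bigcup : @plane_disk R = \bigcup_k open_ball (radius k).
Proof.
rewrite plane_diskE; apply/seteqP; split => p.
  by move=> /radius_above [k hk]; exists k.
move=> [k _]; rewrite /open_ball /= => h; have /andP[_] := radius_itv k; exact: lt_trans h.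
Qed.

Lemma open_ball_mono : nondecreasing_seq (fun k => open_ball (radius k) : set (T * T)).
Proof.
move=> k l kl; apply/subsetPset => p; rewrite /open_ball /= => h.
exact: lt_le_trans h (radius_mono kl).
Qed.

Lemma measurable_radius_ball k : measurable (open_ball (radius k) : set (T * T)).
Proof. by apply: measurable_open_ball; have /andP[/ltW] := radius_itv k. Qed.

Lemma measurable_plane_disk : measurable (@plane_disk R).
Proof. by rewrite plane_diskE; exact: measurable_open_ball. Qed.

Lemma moment_limit : exists2 c : R, 0 < c &
  (forall m, (fun k => moment m (radius k)) @ \oo --> (c / binomial_coef g m : R)) /\
  (forall m k, 0 <= moment m (radius k) <= c).
Proof.
have [c c0 hc] := moment_integral; exists c => //.
have a1 : 0 < alpha + 1 by move: ha; lra.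
have r2 k : 0 < radius k ^+ 2 < 1.
  by have /andP[k0 k1] := radius_itv k; rewrite exprn_gt0 // exprn_ilt1 // ltW.
have hE m k : moment m (radius k) = c * ((alpha + 1) * beta alpha m (radius k ^+ 2)).
  by have /andP[k0 k1] := radius_itv k; have [] := hc m _ k0 k1.
split => m.
  have l2 : (fun k => radius k ^+ 2) @ \oo --> (1 : R).
    by rewrite -(expr1n R 2); apply: cvgM; exact: radius_cvg.
  have := @beta_limit R alpha ha _ m r2 l2 => h.
  rewrite (funext (hE m)).
  have -> : c / binomial_coef g m = c * ((alpha + 1) * ((alpha + 1)^-1 / binomial_coef g m)).
    by rewrite mulVKf // gt_eqF.
  by apply: cvgMl_tmp; apply: cvgMl_tmp.
move=> k; have /andP[s0 s1] := r2 k.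
rewrite hE; apply/andP; split.
  rewrite mulr_ge0 ?(ltW c0) // mulr_ge0 ?(ltW a1) //; apply: Rintegral_ge0 => t /=.
  by rewrite in_itv /= => /andP[t0 _]; rewrite mulr_ge0 ?exprn_ge0 ?powR_ge0.
rewrite -[leRHS]mulr1 ler_pM2l //.
apply: (@le_trans _ _ ((alpha + 1) * beta alpha 0 (radius k ^+ 2))).
  rewrite ler_pM2l //; apply: le_Rintegral => //; try exact: integrable_beta.
  move=> t /=; rewrite in_itv /= => /andP[t0 t1].
  by rewrite ler_wpM2r ?powR_ge0 // expr0 exprn_ile1 //; lra.
by rewrite beta_zero // gerBl powR_ge0.
Qed.

Lemma integrable_weight : mu.-integrable (@plane_disk R) (EFin \o (wt \o @of_plane R)).
Proof.
have [c c0 [_ hc]] := moment_limit.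
have [c' c'0 hc'] := moment_integral.
have mw := measurable_weight.
apply/integrableP; split; first by apply/measurable_EFinP.
rewrite (eq_integral (EFin \o (wt \o @of_plane R))); last first.
  by move=> p _; rewrite gee0_abs // lee_fin weight_ge0.
rewrite plane_disk_bigcup.
have h := @ge0_nondecreasing_set_cvg_integral _ _ _ (fun k => open_ball (radius k)) (EFin \o (wt \o @of_plane R)) mu
  open_ball_mono measurable_radius_ball.
apply: (@le_lt_trans _ _ c%:E); last exact: ltry.
rewrite -(cvg_lim _ (h _ _)) //.
- apply: lime_le.
    by apply/cvg_ex; eexists; apply: h => //; [move=> i; apply/measurable_EFinP|move=> i p _; rewrite lee_fin weight_ge0].
  near=> k; have /andP[k0 k1] := radius_itv k.
  have /andP[_] := hc 0%N k; rewrite -lee_fin; apply: le_trans.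
  have [i0 _] := hc' 0%N _ k0 k1.
  rewrite /moment /Rintegral fineK; last by apply: integrable_fin_num i0; exact: measurable_radius_ball.
  rewrite le_eqVlt; apply/orP; left; apply/eqP; apply: eq_integral => p _ /=.
  by rewrite expr0 mul1r.
- by move=> i; apply/measurable_EFinP.
- by move=> i p _; rewrite lee_fin weight_ge0.
Unshelve. all: by end_near.
Qed.

End Moments.

(** * Orthogonality of the monomials *)

Section Orthogonality.
Variable R : realType.
Variable alpha : R.
Hypothesis ha : -1 < alpha.
Local Notation T := (measurableTypeR R).
Local Notation mu := (@area R).
Local Notation leb := (@lebesgue_measure R).
Local Notation wt := (@bergman_weight R alpha).
Local Notation image_measure :=
  (measure_function_pushforward__canonical__measure_function_Measure).
Implicit Types (F : R[i] -> R[i]) (f h : R[i] -> R[i]) (z x : R[i]).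

Lemma area_rotation k (A : set (T * T)) : measurable A -> mu (rotation k @^-1` A) = mu A.
Proof.
move=> mA; rewrite -[LHS]/((pi^-1)%:E * (leb \x leb) (rotation k @^-1` A))%E.
by rewrite leb2_rotation.
Qed.

Lemma Rintegral_rotation k (r : R) (f : T * T -> R) : 0 <= r ->
  measurable_fun [set: T * T] f -> mu.-integrable (open_ball r) (EFin \o (f \o rotation k)) ->
  Rintegral mu (open_ball r) (f \o rotation k) = Rintegral mu (open_ball r) f.
Proof.
move=> r0 mf intf.
have mB := measurable_open_ball r0.
have mR := @measurable_rotation R k.
have EB : rotation k @^-1` open_ball r = open_ball r.
  have E p : modulus (of_plane (rotation k p)) = modulus (of_plane p).
    by rewrite of_plane_rotation modulusM modulus_rotation_number mul1r.
  by apply/seteqP; split => p; rewrite /open_ball /preimage /mkset E.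
have Em (g' : T * T -> \bar R) : (\int[image_measure mu mR]_(p in open_ball r) g' p = \int[mu]_(p in open_ball r) g' p)%E.
  apply: eq_measure_integral => A mA _; exact: area_rotation.
have intf' : mu.-integrable (rotation k @^-1` open_ball r) ((EFin \o f) \o rotation k) by rewrite EB.
have mf' : measurable_fun [set: T * T] (EFin \o f) by exact/measurable_EFinP.
have := integral_pushforward mR mf' intf' mB; rewrite EB => E.
by rewrite /Rintegral; congr fine; rewrite -[RHS]Em; exact/esym/E.
Qed.

Lemma cint_rotation k (r : R) F (w : R[i]) : 0 <= r -> cmeasurable [set: T * T] F ->
  cintegrable (open_ball r) F -> (forall z, F (rotation_number k * z) = w * F z) ->
  cint (open_ball r) F = w * cint (open_ball r) F.
Proof.
move=> r0 [m1 m2] iF hF; have mB := measurable_open_ball r0.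
have E p : F (of_plane (rotation k p)) = w * F (of_plane p) by rewrite of_plane_rotation hF.
have [i1 i2] := cintegrableZ mB w iF.
rewrite -cintZ //; apply: complex_eq => /=.
  rewrite -(@Rintegral_rotation k) //.
    by apply: eq_Rintegral => p _; rewrite /re_plane /= E.
  by move: i1; congr integrable; apply/funext => p; rewrite /= /re_plane E.
rewrite -(@Rintegral_rotation k) //.
  by apply: eq_Rintegral => p _; rewrite /im_plane /= E.
by move: i2; congr integrable; apply/funext => p; rewrite /= /im_plane E.
Qed.

Definition monomial n m z : R[i] := z ^+ n * z^* ^+ m * (wt z)%:C.

Lemma cmeasurable_monomial (D : set (T * T)) n m : cmeasurable D (monomial n m).
Proof.
apply: cmeasurableM; last (apply: cmeasurable_real; exact: measurable_weight).
apply: cmeasurableM; apply: cmeasurableX; first exact: cmeasurable_id.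
exact: cmeasurable_conj (cmeasurable_id _).
Qed.

Lemma open_ball_disk (r : R) p : r <= 1 -> open_ball r p -> plane_disk p.
Proof. by move=> r1; rewrite plane_diskE /open_ball /= => h; exact: lt_le_trans h r1. Qed.

Lemma integrable_weight_ball (r : R) : 0 <= r -> r <= 1 -> mu.-integrable (open_ball r) (EFin \o (wt \o @of_plane R)).
Proof.
move=> r0 r1; apply: integrableS (integrable_weight ha) => //.
- exact: measurable_plane_disk.
- exact: measurable_open_ball.
- by move=> p; exact: open_ball_disk.
Qed.

Lemma cintegrable_weighted (r : R) F (B : R) : 0 <= r -> r <= 1 -> cmeasurable (open_ball r) F ->
  (forall p, open_ball r p -> modulus (F (of_plane p)) <= B) ->
  cintegrable (open_ball r) (fun z => F z * (wt z)%:C).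
Proof.
move=> r0 r1 mF FB; have mB := measurable_open_ball r0.
apply: (cintegrable_bound mB _ (integrable_scale mB B (integrable_weight_ball r0 r1))).
  by apply: cmeasurableM mF _; (apply: cmeasurable_real; exact: measurable_weight).
move=> p Dp /=; rewrite modulusM modulusC ger0_norm ?weight_ge0 //.
by rewrite ler_wpM2r ?weight_ge0 // FB.
Qed.

Lemma cintegrable_monomial (r : R) n m : 0 <= r -> r <= 1 -> cintegrable (open_ball r) (monomial n m).
Proof.
move=> r0 r1; apply: (@cintegrable_weighted _ _ 1) => //.
  apply: cmeasurableM; apply: cmeasurableX; first exact: cmeasurable_id.
  exact: cmeasurable_conj (cmeasurable_id _).
move=> p /(open_ball_disk r1) /diskP p1; rewrite modulusM !modulusX modulus_conj -exprD.
by rewrite exprn_ile1 ?modulus_ge0 // ltW.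
Qed.

Lemma cint_monomial_diag (r : R) n : cint (open_ball r) (monomial n n) = (moment alpha n r)%:C.
Proof.
have E z : monomial n n z = (modulus z ^+ 2 ^+ n * wt z)%:C.
  by rewrite /monomial -exprMn mulcJ -rmorphXn -rmorphM.
apply: complex_eq => /=.
  by apply: eq_Rintegral => p _; rewrite /re_plane E.
have -> : im_plane (monomial n n) = fun=> 0 by apply/funext => p; rewrite /im_plane E.
by rewrite /Rintegral integral0.
Qed.

(** A rotation by a root of unity of order greater than [n - m] multiplies the integral by a
    number different from one. The order is at least three because the parametrization of
    rotations omits the half-turn. *)
Lemma cint_monomial_lt (r : R) n m : 0 <= r -> r <= 1 -> (m < n)%N -> cint (open_ball r) (monomial n m) = 0.
Proof.
move=> r0 r1 mn; have mB := measurable_open_ball r0.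
have [w pw] := @primitive_root_exists R (n - m).+2 isT.
have w1 : modulus w = 1 by apply: modulus_root_unity (prim_expr_order pw).
have wN : w != -1.
  apply/eqP => E; have := prim_order_dvd pw 2; rewrite E sqrrN expr1n eqxx => /dvdn_leq.
  by move=> /(_ isT); rewrite !ltnS leqn0 subn_eq0 leqNgt mn.
have [k Ek] := rotation_number_surj w1 wN.
have cw : w * w^* = 1 by rewrite mulcJ w1 expr1n.
have hF z : monomial n m (rotation_number k * z) = w ^+ (n - m) * monomial n m z.
  rewrite -Ek /monomial rmorphM !exprMn /bergman_weight modulusM w1 mul1r.
  have -> : w ^+ n = w ^+ (n - m) * w ^+ m by rewrite -exprD subnK // ltnW.
  have E : w ^+ m * w^* ^+ m = 1 by rewrite -exprMn cw expr1n.
  rewrite -[RHS]mul1r -E; ring.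
have := cint_rotation r0 (cmeasurable_monomial _ n m) (cintegrable_monomial n m r0 r1) hF.
move=> /eqP; rewrite -subr_eq0 -{1}[cint _ _]mul1r -mulrBl mulf_eq0 => /orP[|/eqP //].
rewrite subr_eq0 eq_sym -(prim_order_dvd pw) => /dvdn_leq; rewrite subn_gt0 => /(_ mn).
by rewrite ltnNge leqnSn.
Qed.

Lemma cint_monomial (r : R) n m : 0 <= r -> r <= 1 ->
  cint (open_ball r) (monomial n m) = if n == m then (moment alpha n r)%:C else 0.
Proof.
move=> r0 r1; have mB := measurable_open_ball r0.
have [nm|mn|->] := ltngtP n m; last by rewrite cint_monomial_diag.
  rewrite -[LHS]conjCK -cint_conj //; last exact: cintegrable_monomial.
  have -> : (fun z => (monomial n m z)^*) = monomial m n.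
    apply/funext => z; rewrite /monomial 2!(rmorphM Num.conj) /= conj_real.
    by rewrite (rmorphXn Num.conj) (rmorphXn Num.conj) /= conjCK [X in X * _]mulrC.
  by rewrite cint_monomial_lt // conjC0.
exact: cint_monomial_lt.
Qed.

Lemma uniform_partial_sums f c (r : R) : (forall z, disk z -> has_sum (fun n => c n * z ^+ n) (f z)) ->
  0 < r -> r < 1 -> (exists2 B : R, 0 < B & forall z, modulus z < r -> modulus (f z) <= B) /\
  forall e : R, 0 < e -> exists N, forall n, (N <= n)%N -> forall z, modulus z < r ->
    modulus (\sum_(i < n) c i * z ^+ i - f z) <= e.
Proof.
move=> hf r0 r1.
pose r' := (1 + r) / 2; have r'1 : r' < 1 by rewrite /r'; lra.
have rr' : r < r' by rewrite /r'; lra.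
have r'0 : 0 < r' by lra.
have [M [_ pb _]] := disk_series_expands hf r'0 r'1.
have M0 := power_bound_ge0 r'0 pb.
pose q := r / r'.
have q0 : 0 <= q by rewrite divr_ge0 ?ltW.
have q1 : q < 1 by rewrite ltr_pdivrMr // mul1r.
have ht z n : modulus z < r -> modulus (c n * z ^+ n) <= M * q ^+ n.
  move=> zr; have zr' : modulus z / r' <= q by rewrite ler_pM2r ?invr_gt0 // ltW.
  rewrite modulusM modulusX; apply: le_trans (term_bound n r'0 pb (modulus_ge0 z)) _.
  by rewrite ler_wpM2l // lerXn2r ?nnegrE // divr_ge0 ?modulus_ge0 // ltW.
have dz z : modulus z < r -> disk z by move=> zr; apply/diskP; lra.
have tail z K : modulus z < r -> modulus (f z - \sum_(i < K) c i * z ^+ i) <= M * q ^+ K / (1 - q).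
  by move=> zr; apply: (has_sum_tail q0 q1 _ (hf z (dz z zr))) => n _; exact: ht.
split.
  exists (M / (1 - q) + 1); first by rewrite ltr_wpDl // divr_ge0 // subr_ge0 ltW.
  by move=> z zr; have := tail z 0%N zr; rewrite big_ord0 subr0 expr0 mulr1; lra.
move=> e e0; have e1 : 0 < e * (1 - q) by rewrite mulr_gt0 // subr_gt0.
have [N hN] := geo_cvg0 M q0 q1 e1; exists N => n Nn z zr.
rewrite -modulusN opprB; apply: le_trans (tail z n zr) _.
by rewrite ler_pdivrMr ?subr_gt0 // ltW // hN.
Qed.

Lemma has_sum_single (u : nat -> R[i]) n : (forall m, m != n -> u m = 0) -> has_sum u (u n).
Proof.
move=> hu; apply/has_sumP => e e0; exists n.+1 => k nk.
rewrite (bigD1 (Ordinal nk)) //= big1 ?addr0 ?subrr ?modulus0 // => i.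
by rewrite -val_eqE /= => /hu.
Qed.

Lemma cmeasurable_series f c (r : R) : r <= 1 -> (forall z, disk z -> has_sum (fun n => c n * z ^+ n) (f z)) ->
  cmeasurable (open_ball r) f.
Proof.
move=> r1 hf; apply: (@cmeasurable_has_sum _ _ (fun n z => c n * z ^+ n)).
  by move=> i; apply: cmeasurableM; [exact: cmeasurable_cst|apply: cmeasurableX; exact: cmeasurable_id].
by move=> p /(open_ball_disk r1) /hf.
Qed.

Lemma cint_monomial_series h d (r : R) n : (forall z, disk z -> has_sum (fun n => d n * z ^+ n) (h z)) ->
  0 < r -> r < 1 ->
  cint (open_ball r) (fun z => z ^+ n * (h z)^* * (wt z)%:C) = (d n)^* * (moment alpha n r)%:C.
Proof.
move=> hh r0 r1; have r0' := ltW r0; have r1' := ltW r1; have mB := measurable_open_ball r0'.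
have [[B B0 hB] hu] := uniform_partial_sums hh r0 r1.
pose u m z := (d m)^* * monomial n m z.
have Eu m : cint (open_ball r) (u m) = (d m)^* * cint (open_ball r) (monomial n m).
  by apply: cintZ => //; exact: cintegrable_monomial.
have hs : has_sum (fun m => cint (open_ball r) (u m)) (cint (open_ball r) (u n)).
  apply: has_sum_single => m mn.
  by rewrite Eu cint_monomial // eq_sym (negPf mn) mulr0.
rewrite -[X in _ * X](_ : cint (open_ball r) (monomial n n) = _); last by rewrite cint_monomial_diag.
rewrite -Eu; apply: has_sum_unique hs.
have zr p : open_ball r p -> modulus (of_plane p) < r by [].
apply: (has_sum_cint mB (integrable_weight_ball r0' r1')).
- by move=> p _; exact: weight_ge0.
- by move=> m; apply: cintegrableZ => //; exact: cintegrable_monomial.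
- apply: (cintegrable_weighted r0' r1' (B := B)).
    apply: cmeasurableM; first by apply: cmeasurableX; exact: cmeasurable_id.
    by apply: cmeasurable_conj; exact: cmeasurable_series hh.
  move=> p Dp; rewrite modulusM modulusX modulus_conj -[leRHS]mul1r.
  rewrite ler_pM ?exprn_ge0 ?modulus_ge0 ?hB ?zr //.
  by rewrite exprn_ile1 ?modulus_ge0 // ltW // (lt_trans (zr p Dp)).
- move=> e e0; have [N hN] := hu e e0; exists N => k Nk p Dp.
  have -> : \sum_(i < k) u i (of_plane p) - of_plane p ^+ n * (h (of_plane p))^* * (wt (of_plane p))%:C =
    (of_plane p ^+ n * (\sum_(i < k) d i * of_plane p ^+ i - h (of_plane p))^*) * (wt (of_plane p))%:C.
    rewrite rmorphB rmorph_sum mulrBr mulrBl; congr (_ - _).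
    rewrite mulr_sumr mulr_suml; apply: eq_bigr => i _.
    by rewrite /u /monomial (rmorphM Num.conj) rmorphXn /=; ring.
  rewrite !modulusM modulusX modulus_conj modulusC ger0_norm ?weight_ge0 //.
  rewrite ler_wpM2r ?weight_ge0 // -[leRHS]mul1r.
  rewrite ler_pM ?exprn_ge0 ?modulus_ge0 ?hN ?zr //.
  by rewrite exprn_ile1 ?modulus_ge0 // ltW // (lt_trans (zr p Dp)).
Qed.

(** Term by term integration, first of the expansion of [f], then of that of [h]. *)
Lemma cint_series f c h d (r : R) : (forall z, disk z -> has_sum (fun n => c n * z ^+ n) (f z)) ->
  (forall z, disk z -> has_sum (fun n => d n * z ^+ n) (h z)) -> 0 < r -> r < 1 ->
  has_sum (fun n => c n * (d n)^* * (moment alpha n r)%:C)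
    (cint (open_ball r) (fun z => f z * (h z)^* * (wt z)%:C)).
Proof.
move=> hf hh r0 r1; have r0' := ltW r0; have r1' := ltW r1; have mB := measurable_open_ball r0'.
have [[B B0 hB] hu] := uniform_partial_sums hf r0 r1.
have [[B' B'0 hB'] _] := uniform_partial_sums hh r0 r1.
have zr p : open_ball r p -> modulus (of_plane p) < r by [].
have mh : cmeasurable (open_ball r) (fun z => (h z)^*).
  by apply: cmeasurable_conj; exact: cmeasurable_series hh.
have iu n : cintegrable (open_ball r) (fun z => z ^+ n * (h z)^* * (wt z)%:C).
  apply: (cintegrable_weighted r0' r1' (B := B')).
    by apply: cmeasurableM mh; apply: cmeasurableX; exact: cmeasurable_id.
  move=> p Dp; rewrite modulusM modulusX modulus_conj -[leRHS]mul1r.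
  rewrite ler_pM ?exprn_ge0 ?modulus_ge0 ?hB' ?zr //.
  by rewrite exprn_ile1 ?modulus_ge0 // ltW // (lt_trans (zr p Dp)).
have hs : has_sum (fun n => cint (open_ball r) (fun z => c n * (z ^+ n * (h z)^* * (wt z)%:C)))
    (cint (open_ball r) (fun z => f z * (h z)^* * (wt z)%:C)).
  apply: (has_sum_cint mB (integrable_weight_ball r0' r1')).
  - by move=> p _; exact: weight_ge0.
  - by move=> n; exact: cintegrableZ.
  - apply: (cintegrable_weighted r0' r1' (B := B * B')).
      by apply: cmeasurableM mh; exact: cmeasurable_series hf.
    by move=> p Dp; rewrite modulusM modulus_conj ler_pM ?modulus_ge0 ?hB ?hB' ?zr.
  - move=> e e0; have e1 : 0 < e / B' by rewrite divr_gt0.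
    have [N hN] := hu _ e1; exists N => k Nk p Dp.
    have -> : \sum_(i < k) c i * (of_plane p ^+ i * (h (of_plane p))^* * (wt (of_plane p))%:C) - f (of_plane p) * (h (of_plane p))^* * (wt (of_plane p))%:C =
      (\sum_(i < k) c i * of_plane p ^+ i - f (of_plane p)) * (h (of_plane p))^* * (wt (of_plane p))%:C.
      rewrite !mulrBl; congr (_ - _); rewrite !mulr_suml; apply: eq_bigr => i _; ring.
    rewrite !modulusM modulus_conj modulusC ger0_norm ?weight_ge0 //.
    rewrite ler_wpM2r ?weight_ge0 // -(@divfK _ B' _ e) ?gt_eqF //.
    by rewrite ler_pM ?modulus_ge0 ?hB' ?hN ?zr.
apply: (eq_has_sum hs) => n.
by rewrite cintZ // (cint_monomial_series _ hh r0 r1) mulrA.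
Qed.

End Orthogonality.

(** * The Bergman spaces are reproducing kernel spaces *)

Section BergmanSpace.
Variable R : realType.
Variable alpha : R.
Hypothesis ha : -1 < alpha.
Local Notation T := (measurableTypeR R).
Local Notation mu := (@area R).
Local Notation wt := (@bergman_weight R alpha).
Local Notation g := (alpha + 2).
Local Notation Dk := (@plane_disk R).
Local Notation converges w s := ((w : nat -> R[i]^o) @ \oo --> (s : R[i]^o)).
Implicit Types (F f h : R[i] -> R[i]) (z x : R[i]).

Let mD := @measurable_plane_disk R.

Let g0 : 0 < g.
Proof. by move: ha; lra. Qed.

Lemma converges_unique (w : nat -> R[i]) s t : converges w s -> converges w t -> s = t.
Proof. by move=> h1 h2; apply: (cvg_unique _ h1 h2); exact: norm_hausdorff. Qed.

(** Tannery's theorem. *)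
Lemma tannery (u : nat -> nat -> R[i]) (v : nat -> R[i]) (s : nat -> R[i]) t (M q : R) :
  0 <= q -> q < 1 -> (forall k n, modulus (u k n) <= M * q ^+ n) ->
  (forall n, converges (u^~ n) (v n)) -> (forall k, has_sum (u k) (s k)) -> has_sum v t ->
  converges s t.
Proof.
move=> q0 q1 hu uv hs hv; apply/cvgC_seq => e e0.
have e4 : 0 < e / 4 * (1 - q) by rewrite mulr_gt0 ?divr_gt0 ?subr_gt0.
have [K hK] := geo_cvg0 M q0 q1 e4.
have q1' : 0 < 1 - q by rewrite subr_gt0.
have vb n : modulus (v n) <= M * q ^+ n.
  by apply: le_modulus_cvg (fun k => hu k n); apply/cvgC_seq; exact: uv.
have tu k : modulus (s k - \sum_(i < K) u k i) <= e / 4.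
  apply: le_trans (has_sum_tail q0 q1 (fun n _ => hu k n) (hs k)) _.
  by rewrite ler_pdivrMr // ltW // hK.
have tv : modulus (t - \sum_(i < K) v i) <= e / 4.
  apply: le_trans (has_sum_tail q0 q1 (fun n _ => vb n) hv) _.
  by rewrite ler_pdivrMr // ltW // hK.
have hsum : converges (fun k => \sum_(i < K) u k i) (\sum_(i < K) v i).
  elim: K {hK tu tv} => [|K IH].
    rewrite big_ord0; apply/cvgC_seq => d d0; exists 0%N => n _.
    by rewrite big_ord0 subrr modulus0.
  apply/cvgC_seq => d d0; have d2 : 0 < d / 2 by rewrite divr_gt0.
  have /cvgC_seq /(_ _ d2) [N1 h1] := IH.
  have /cvgC_seq /(_ _ d2) [N2 h2] := uv K.
  exists (maxn N1 N2) => n; rewrite geq_max => /andP[n1 n2].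
  rewrite !big_ord_recr /= opprD addrACA; apply: le_lt_trans (modulusD _ _) _.
  by have := h1 n n1; have := h2 n n2; lra.
have e2 : 0 < e / 2 by rewrite divr_gt0.
have /cvgC_seq /(_ _ e2) [N hN] := hsum; exists N => n Nn.
have -> : s n - t = (s n - \sum_(i < K) u n i) + ((\sum_(i < K) u n i - \sum_(i < K) v i) - (t - \sum_(i < K) v i)).
  ring.
apply: le_lt_trans (modulusD _ _) _.
have := modulusD (\sum_(i < K) u n i - \sum_(i < K) v i) (- (t - \sum_(i < K) v i)).
rewrite modulusN => h1; have := hN n Nn; have := tu n; move: tv h1; lra.
Qed.

Lemma Rintegral_exhaust (f : T * T -> R) : mu.-integrable Dk (EFin \o f) ->
  (fun k => Rintegral mu (open_ball (radius R k)) f) @ \oo --> Rintegral mu Dk f.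
Proof.
move=> intf.
have mB := @measurable_radius_ball R.
have BD k : open_ball (radius R k) `<=` Dk.
  by move=> p; apply: open_ball_disk; have /andP[_ /ltW] := radius_itv R k.
have E k : Rintegral mu (open_ball (radius R k)) f = Rintegral mu Dk (f \_ (open_ball (radius R k))).
  by rewrite -Rintegral_mkcondr; congr (Rintegral _ _ _); apply/esym/setIidr; exact: BD.
have mf : measurable_fun Dk f by apply/measurable_EFinP; have /integrableP[] := intf.
have dom : ((\int[mu]_(p in Dk) (EFin \o (f \_ (open_ball (radius R k)))) p)%E @[k --> \oo] --> (\int[mu]_(p in Dk) (EFin \o f) p)%E).
  apply: (@dominated_cvg _ _ _ mu Dk mD (fun k => EFin \o (f \_ (open_ball (radius R k)))) (EFin \o f) (abse \o (EFin \o f))).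
  - move=> k; apply/measurable_EFinP; apply/measurable_restrict => //.
    by apply: measurable_funS mf => // p [].
  - move=> p; rewrite plane_disk_bigcup => -[k0 _ hk0].
    apply: cvg_near_cst; exists k0 => //= k k0k; rewrite patchE mem_set //.
    have /subsetPset := @open_ball_mono R _ _ k0k; exact.
  - by move=> p _.
  - exact: integrable_abse.
  - move=> k p Dp; rewrite /= patchE; case: ifP => // _.
    by rewrite normr0 lee_fin normr_ge0.
rewrite (funext E) /Rintegral.
apply: (fine_cvg (f := fun k => (\int[mu]_(p in Dk) (EFin \o (f \_ (open_ball (radius R k)))) p)%E)).
by rewrite fineK //; exact: integrable_fin_num.
Qed.

Lemma cint_exhaust F : cintegrable Dk F ->
  converges (fun k => cint (open_ball (radius R k)) F) (cint Dk F).
Proof.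
move=> [/Rintegral_exhaust h1 /Rintegral_exhaust h2]; apply/cvgC_seq => e e0.
have e2 : 0 < e / 2 by rewrite divr_gt0.
have := h1 => /cvgrPdist_lt /(_ _ e2) [N1 _ k1].
have := h2 => /cvgrPdist_lt /(_ _ e2) [N2 _ k2].
exists (maxn N1 N2) => n; rewrite geq_max => /andP[n1 n2].
apply: le_lt_trans (modulus_le_ReIm _) _; rewrite /cint /=.
by have := k1 n n1; have := k2 n n2 => /=; rewrite ![`|Rintegral _ Dk _ - _|]distrC; lra.
Qed.

Lemma cmeasurable_disk f : analytic_on (@disk R) f -> cmeasurable Dk f.
Proof.
move=> af; rewrite plane_diskE; apply: (cmeasurable_series (lexx 1)); exact: taylorP.
Qed.

Lemma in_bergmanP f : in_space (Bergman ha) f <-> analytic_on (@disk R) f /\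
  mu.-integrable Dk (EFin \o (fun p => modulus (f (of_plane p)) ^+ 2 * wt (of_plane p))).
Proof.
rewrite /in_space /=; split=> -[af h]; split=> //.
  have [m1 m2] := cmeasurable_disk af.
  apply/integrableP; split.
    apply/measurable_EFinP; apply: measurable_funM; last exact: measurable_weight.
    by apply: cmeasurable_sqr_modulus; exact: cmeasurable_disk.
  apply: le_lt_trans h; rewrite le_eqVlt; apply/orP; left; apply/eqP.
  by apply: eq_integral => p _; rewrite gee0_abs // lee_fin mulr_ge0 ?sqr_ge0 ?weight_ge0.
have /integrableP[_] := h; apply: le_lt_trans; rewrite le_eqVlt; apply/orP; left; apply/eqP.
by apply: eq_integral => p _; rewrite gee0_abs // lee_fin mulr_ge0 ?sqr_ge0 ?weight_ge0.
Qed.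

Lemma cintegrable_inner f h : in_space (Bergman ha) f -> in_space (Bergman ha) h ->
  cintegrable Dk (fun z => f z * (h z)^* * (wt z)%:C).
Proof.
move=> /in_bergmanP [af iF] /in_bergmanP [ah iH].
apply: (cintegrable_bound mD _ (integrable_add mD iF iH)).
  apply: cmeasurableM; last by apply: cmeasurable_real; exact: measurable_weight.
  by apply: cmeasurableM; [|apply: cmeasurable_conj]; exact: cmeasurable_disk.
move=> p Dp; rewrite !modulusM modulus_conj modulusC ger0_norm ?weight_ge0 // -mulrDl.
rewrite ler_wpM2r ?weight_ge0 //.
by have := modulus_ge0 (f (of_plane p)); have := modulus_ge0 (h (of_plane p)); nra.
Qed.

Lemma bergman_inner f h : inner (Bergman ha) f h = cint Dk (fun z => f z * (h z)^* * (wt z)%:C).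
Proof. by []. Qed.

Lemma bergman_norm f : inner (Bergman ha) f f =
  (Rintegral mu Dk (fun p => modulus (f (of_plane p)) ^+ 2 * wt (of_plane p)))%:C.
Proof.
have E z : f z * (f z)^* * (wt z)%:C = (modulus (f z) ^+ 2 * wt z)%:C by rewrite mulcJ -rmorphM.
rewrite bergman_inner; apply: complex_eq => /=; first by apply: eq_Rintegral => p _; rewrite /re_plane E.
have -> : im_plane (fun z => f z * (f z)^* * (wt z)%:C) = fun=> 0 by apply/funext => p; rewrite /im_plane E.
by rewrite /Rintegral integral0.
Qed.

Lemma kernel_bound x y : disk x -> disk y -> modulus (kernel g x y) <= ((1 - modulus x) `^ g)^-1.
Proof.
move=> dx dy; have /diskP x1 := dx; have /diskP y1 := dy; rewrite modulus_kernel powRN.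
have h : 1 - modulus x <= modulus (1 - x^* * y).
  have := modulus_sub 1 (x^* * y); rewrite modulus1 modulusM modulus_conj.
  by have := modulus_ge0 x; have := modulus_ge0 y; nra.
have x0 : 0 < 1 - modulus x by rewrite subr_gt0.
rewrite lef_pV2 ?posrE ?powR_gt0 //; last exact: lt_le_trans h.
by rewrite ge0_ler_powR ?nnegrE ?modulus_ge0 // ltW.
Qed.

Lemma in_bergman_bounded f (B : R) : analytic_on (@disk R) f ->
  (forall z, disk z -> modulus (f z) <= B) -> in_space (Bergman ha) f.
Proof.
move=> af fB; apply/in_bergmanP; split => //.
apply: (le_integrable mD _ _ (integrable_scale mD (B ^+ 2) (integrable_weight ha))).
  apply/measurable_EFinP; apply: measurable_funM; last exact: measurable_weight.
  by apply: cmeasurable_sqr_modulus; exact: cmeasurable_disk.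
have B0 p : Dk p -> 0 <= B by move=> Dp; exact: le_trans (modulus_ge0 _) (fB _ Dp).
move=> p Dp; rewrite /= lee_fin; apply: le_trans (ler_norm _).
rewrite ger0_norm; last by rewrite mulr_ge0 ?sqr_ge0 ?weight_ge0.
apply: ler_wpM2r; first exact: weight_ge0.
by apply: lerXn2r; rewrite ?nnegrE ?modulus_ge0 ?(B0 p) //; exact: fB.
Qed.

(** The coefficients of [f] and of the kernel grow at most like powers of numbers arbitrarily
    close to one. *)
Lemma kernel_term_bound f x : analytic_on (@disk R) f -> disk x -> exists M q : R,
  [/\ 0 <= M, 0 <= q, q < 1 & forall n, modulus (taylor f n * ((binomial_coef g n)%:C * x ^+ n)) <= M * q ^+ n].
Proof.
move=> af /diskP x1; have x0 := modulus_ge0 x.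
pose s := (1 + modulus x) / 2.
have s0 : 0 < s by rewrite /s; lra.
have s1 : s < 1 by rewrite /s; lra.
have [M1 [_ p1 _]] := disk_series_expands (taylorP af) s0 s1.
have [M2 p2] := binomial_coef_bound g0 s0 s1.
have M10 := power_bound_ge0 s0 p1; have M20 := power_bound_ge0 s0 p2.
exists (M1 * M2), (modulus x / s ^+ 2); split.
- exact: mulr_ge0.
- by rewrite divr_ge0 // sqr_ge0.
- rewrite ltr_pdivrMr ?exprn_gt0 // mul1r /s; nra.
move=> n; rewrite !modulusM modulusX exprMn exprVn.
have h : modulus (taylor f n) * modulus ((binomial_coef g n)%:C) * s ^+ 2 ^+ n <= M1 * M2.
  have -> : modulus (taylor f n) * modulus ((binomial_coef g n)%:C) * s ^+ 2 ^+ n =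
    (modulus (taylor f n) * s ^+ n) * (modulus ((binomial_coef g n)%:C) * s ^+ n).
    by rewrite expr2 exprMn; ring.
  by apply: ler_pM; rewrite ?mulr_ge0 ?modulus_ge0 ?exprn_ge0 ?(ltW s0).
have sn : 0 < s ^+ 2 ^+ n by rewrite !exprn_gt0.
rewrite mulrA [in leRHS]mulrA [leRHS]mulrAC ler_wpM2r ?exprn_ge0 //.
by rewrite ler_pdivlMr.
Qed.

(** Over the disk of radius [r], the integral of [f] times the conjugate of [K_x] is the sum of
    [f_n binomial_coef(g, n) x ^ n moment(n, r)], by orthogonality. As [r] tends to one,
    [moment(n, r)] tends to [c / binomial_coef(g, n)], and the sum to [c f(x)]. *)
Lemma bergman_reproducing : exists c : R, reproducing (Bergman ha) c.
Proof.
have [c c0 [cl cb]] := moment_limit ha; exists c; split.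
- exact: c0.
- move=> f h E /in_bergmanP [af iF]; apply/in_bergmanP; split; first exact: eqD_analytic af.
  by apply: eq_integrable iF => // p; rewrite inE /= => /E ->.
- by move=> f h h' E; rewrite !bergman_inner; apply: eq_cint => p /E ->.
- move=> k f h /in_bergmanP [af iF] /in_bergmanP [ah iH]; apply/in_bergmanP.
  have al := linear_analytic k af ah; split => //.
  apply: (le_integrable mD _ _ (integrable_add mD (integrable_scale mD (2 * modulus k ^+ 2) iF) (integrable_scale mD 2 iH))).
    apply/measurable_EFinP; apply: measurable_funM; last exact: measurable_weight.
    exact: (cmeasurable_sqr_modulus (cmeasurable_disk al)).
  move=> p Dp /=; rewrite lee_fin; apply: le_trans (ler_norm _).
  rewrite ger0_norm; last by rewrite mulr_ge0 ?sqr_ge0 ?weight_ge0.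
  apply: le_trans (ler_wpM2r (weight_ge0 ha _) (modulus_linear_sqr k (f (of_plane p)) (h (of_plane p)))) _.
  by rewrite mulrDl !mulrA.
- move=> k f h f' hf hh hf'; rewrite !bergman_inner -cint_linear //; try exact: cintegrable_inner.
  by apply: eq_cint => p _; ring.
- move=> f h hf hh; rewrite !bergman_inner -cint_conj //; last exact: cintegrable_inner.
  apply: eq_cint => p _; rewrite 2!(rmorphM Num.conj) /= conjCK conj_real; ring.
- by move=> f hf; rewrite bergman_norm ler0c; apply: Rintegral_ge0 => p _; rewrite mulr_ge0 ?sqr_ge0 ?weight_ge0.
- move=> x dx; apply: (in_bergman_bounded (kernel_analytic g0 dx)) => y dy; exact: kernel_bound.
- move=> f x hf dx; rewrite bergman_inner.
  have hK : in_space (Bergman ha) (kernel g x).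
    by apply: (in_bergman_bounded (kernel_analytic g0 dx)) => y dy; exact: kernel_bound.
  have [af _] := hf.
  have l1 := cint_exhaust (cintegrable_inner hf hK).
  have [M [q [M0 q0 q1 hq]]] := kernel_term_bound af dx.
  apply: (converges_unique l1).
  pose d n := (binomial_coef g n)%:C * x^* ^+ n.
  pose u k n := taylor f n * (d n)^* * (moment alpha n (radius R k))%:C.
  have Ed n : (d n)^* = (binomial_coef g n)%:C * x ^+ n.
    by rewrite /d (rmorphM Num.conj) (rmorphXn Num.conj) /= conj_real conjCK.
  have hd z : disk z -> has_sum (fun n => d n * z ^+ n) (kernel g x z).
    by move=> dz; apply: kernel_series => //; exact: disk_closed.
  apply: (@tannery u (fun n => c%:C * (taylor f n * x ^+ n)) _ _ (M * c) q q0 q1).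
  + move=> k n; rewrite /u modulusM modulusC Ed.
    have /andP[m0 mc] := cb n k; rewrite ger0_norm // [leRHS]mulrAC.
    by apply: ler_pM => //; exact: modulus_ge0.
  + move=> n; have kn : binomial_coef g n != 0 by rewrite gt_eqF // binomial_coef_gt0.
    have -> : c%:C * (taylor f n * x ^+ n) = taylor f n * (d n)^* * (c / binomial_coef g n)%:C.
      have Ek : (c / binomial_coef g n)%:C = c%:C / (binomial_coef g n)%:C.
        by rewrite (rmorphM (real_complex R)) (fmorphV (real_complex R)).
      have kn' : (binomial_coef g n)%:C != 0 by rewrite -modulus_eq0 modulusC normr_eq0.
      rewrite Ed Ek; move: kn' (x ^+ n) (taylor f n) => kn' y t.
      by move: (_%:C) (binomial_coef _ _)%:C kn' => C K K0; field.
    have /cvgrPdist_lt hm := cl n.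
    apply/cvgC_seq => e e0.
    set A := taylor f n * (d n)^*.
    have A0 : 0 < modulus A + 1 by rewrite ltr_wpDl ?modulus_ge0.
    have [N _ hN] := hm _ (divr_gt0 e0 A0); exists N => k Nk.
    rewrite /u -/A -mulrBr -rmorphB modulusM modulusC distrC.
    have := hN k Nk; rewrite /= ltr_pdivlMr //; apply: le_lt_trans.
    by rewrite mulrC ler_wpM2l // lerDl.
  + move=> k; have /andP[k0 k1] := radius_itv R k.
    exact: (cint_series ha (taylorP af) hd k0 k1).
  + exact: has_sumZ (taylorP af dx).
Qed.

End BergmanSpace.

(** * Orbits of real affine maps *)

Section Dynamics.
Variable R : realType.
Local Notation converges w s := ((w : nat -> R[i]^o) @ \oo --> (s : R[i]^o)).
Implicit Types (z w x y t B : R[i]).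

(** The limit of the orbits of [t |-> A t + B] that avoid its fixed point [B / (1 - A)], read in
    the coordinate [zeta + 1 / t]: the fixed point if [A < 1], and infinity, which corresponds
    to [zeta], otherwise. *)
Definition orbit_limit (A : R) B (zeta : R[i]) : R[i] :=
  if A < 1 then zeta + (B / (1 - A)%:C)^-1 else zeta.

Lemma converges_shift_inv zeta (t : nat -> R[i]) :
  (forall K : R, exists N, forall n, (N <= n)%N -> K < modulus (t n)) ->
  converges (fun n => zeta + (t n)^-1) zeta.
Proof.
move=> ht; apply/cvgC_seq => e e0; have [N hN] := ht e^-1; exists N => n /hN h.
have t0 : 0 < modulus (t n) by apply: lt_trans h; rewrite invr_gt0.
by rewrite addrC addKr modulusV invf_plt ?posrE.
Qed.

Lemma affine_orbit (A : R) B (t : nat -> R[i]) : (forall n, t n.+1 = A%:C * t n + B) ->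
  forall n, A != 1 -> t n - B / (1 - A)%:C = (A ^+ n)%:C * (t 0%N - B / (1 - A)%:C).
Proof.
move=> ht n A1; have A1' : (1 - A)%:C != 0 by rewrite -modulus_eq0 modulusC normr_eq0 subr_eq0 eq_sym.
elim: n => [|n IH]; first by rewrite expr0 mul1r.
rewrite exprS (rmorphM (real_complex R)) -mulrA -IH ht.
have E : (1 - A)%:C = 1 - A%:C by rewrite rmorphB rmorph1.
rewrite E in A1' *; field; exact: A1'.
Qed.

Lemma affine_orbit_one B (t : nat -> R[i]) : (forall n, t n.+1 = 1%:C * t n + B) ->
  forall n, t n = t 0%N + n%:R%:C * B.
Proof.
move=> ht; elim=> [|n IH]; first by rewrite mul0r addr0.
by rewrite ht IH -natr1 (rmorphD (real_complex R)) !rmorph1; ring.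
Qed.

Lemma power_unbounded (A K d : R) : 1 < A -> 0 < d -> exists N, forall n, (N <= n)%N -> K < A ^+ n * d.
Proof.
move=> A1 d0.
have q0 : 0 <= A^-1 by rewrite invr_ge0; lra.
have q1 : A^-1 < 1 by rewrite invf_lt1 //; lra.
have [N hN] := geo_cvg0 (`|K| + 1) q0 q1 d0; exists N => n /hN.
have An : 0 < A ^+ n by rewrite exprn_gt0 //; lra.
rewrite exprVn ltr_pdivrMr // mulrC => h; apply: le_lt_trans (ler_norm K) _; lra.
Qed.

(** For [A] different from one, the distance to the fixed point is multiplied by [A] at each
    step; for [A = 1], the orbit is an arithmetic progression with nonzero difference. *)
Lemma orbit_cvg (A : R) B zeta (t : nat -> R[i]) : 0 < A -> B != 0 ->
  (forall n, t n != 0) -> (forall n, t n.+1 = A%:C * t n + B) -> t 0%N != B / (1 - A)%:C ->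
  converges (fun n => zeta + (t n)^-1) (orbit_limit A B zeta).
Proof.
move=> A0 B0 tn ht t0; rewrite /orbit_limit.
set f := B / (1 - A)%:C in t0 *.
have d0 : 0 < modulus (t 0%N - f) by rewrite modulus_gt0 subr_eq0.
have [A1|A1|A1] := ltgtP A 1.
- have A1' : A != 1 by rewrite lt_eqF.
  have f0 : f != 0.
    by rewrite mulf_neq0 // invr_eq0 -modulus_eq0 modulusC normr_eq0 subr_eq0 eq_sym.
  have mf : 0 < modulus f by rewrite modulus_gt0.
  have E n : modulus (t n - f) = modulus (t 0%N - f) * A ^+ n.
    by rewrite (affine_orbit ht n A1') modulusM modulusC ger0_norm ?exprn_ge0 ?(ltW A0) // mulrC.
  apply/cvgC_seq => e e0.
  have m2 : 0 < modulus f / 2 by rewrite divr_gt0.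
  have e2 : 0 < e * modulus f * (modulus f / 2) by rewrite !mulr_gt0.
  have [N1 h1] := geo_cvg0 (modulus (t 0%N - f)) (ltW A0) A1 m2.
  have [N2 h2] := geo_cvg0 (modulus (t 0%N - f)) (ltW A0) A1 e2.
  exists (maxn N1 N2) => n; rewrite geq_max => /andP[/h1 + /h2]; rewrite -E => k1 k2.
  have tf : modulus f / 2 < modulus (t n).
    have := modulus_sub f (f - t n); rewrite opprB addrCA subrr addr0 modulusB; lra.
  have -> : zeta + (t n)^-1 - (zeta + f^-1) = (f - t n) / (f * t n).
    by field; rewrite f0 tn.
  rewrite modulusM modulusV modulusM modulusB ltr_pdivrMr; last by rewrite mulr_gt0 // modulus_gt0.
  by apply: lt_le_trans k2 _; rewrite -mulrA ler_pM2l // ler_pM2l // ltW.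
- apply: converges_shift_inv => K.
  have [N hN] := power_unbounded (K + modulus f) A1 d0; exists N => n /hN.
  have A1' : A != 1 by rewrite gt_eqF.
  have := affine_orbit ht n A1'; rewrite -/f => E.
  have := modulus_sub (t n - f) (- f); rewrite opprK subrK E modulusM modulusC modulusN.
  by rewrite ger0_norm ?exprn_ge0 ?(ltW A0) //; lra.
- apply: converges_shift_inv => K.
  have {}ht n : t n.+1 = 1%:C * t n + B by rewrite ht A1.
  have B0' : 0 < modulus B by rewrite modulus_gt0.
  exists (Num.truncn ((`|K| + modulus (t 0%N)) / modulus B)).+1 => n nN.
  rewrite (affine_orbit_one ht).
  have h : (`|K| + modulus (t 0%N)) / modulus B < n%:R.
    have h : (`|K| + modulus (t 0%N)) / modulus B < (Num.truncn ((`|K| + modulus (t 0%N)) / modulus B)).+1%:R.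
      by rewrite truncnS_gt // num_real.
    by apply: lt_le_trans h _; rewrite ler_nat.
  rewrite ltr_pdivrMr // in h.
  have := modulus_sub (n%:R%:C * B) (- t 0%N); rewrite opprK modulusN modulusM modulusC ger0_norm //.
  by rewrite [_ + t 0%N]addrC; have := ler_norm K; lra.
Qed.

End Dynamics.

(** * Dynamics of an automorphism without interior fixed point *)

Section NoIncrease.
Variable R : realType.
Local Notation converges w s := ((w : nat -> R[i]^o) @ \oo --> (s : R[i]^o)).
Implicit Types (z w x y a lam zeta xi : R[i]).

Definition continuous_at_point (M : R[i] -> R) x :=
  forall e : R, 0 < e -> exists2 d : R, 0 < d & forall z, modulus (z - x) < d -> `|M z - M x| < e.

Lemma cvg_continuous_at (M : R[i] -> R) (w : nat -> R[i]) x : converges w x ->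
  continuous_at_point M x -> (fun n => M (w n)) @ \oo --> (M x : R).
Proof.
move=> /cvgC_seq hw cM; apply/cvgrPdist_lt => e e0.
have [d d0 hd] := cM e e0; have [N hN] := hw d d0.
by exists N => //= n /hN /hd; rewrite distrC.
Qed.

Lemma blaschke_sub a x y : disk a -> modulus x <= 1 -> modulus y <= 1 ->
  blaschke a x - blaschke a y = (a^* * a - 1) * (x - y) / ((1 - a^* * x) * (1 - a^* * y)).
Proof.
move=> da x1 y1; have hx := denominator_neq0 da x1; have hy := denominator_neq0 da y1.
by rewrite /blaschke; field; rewrite hx hy.
Qed.

Lemma blaschke_circle a z : disk a -> modulus z = 1 -> modulus (blaschke a z) = 1.
Proof.
move=> da z1; have := modulus_blaschke da; move=> /(_ z); rewrite z1 => /(_ (lexx 1)).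
rewrite expr1n subrr mulr0 mul0r => /eqP; rewrite subr_eq0 => /eqP h.
by apply/eqP; rewrite -(@eqrXn2 _ 2) ?modulus_ge0 // -h expr1n.
Qed.

(** The fixed point equation is quadratic and the product of its roots has modulus one, so one
    of the roots lies in the closed disk. *)
Lemma fixed_point_exists a lam : disk a -> a != 0 -> modulus lam = 1 ->
  exists2 zeta, modulus zeta <= 1 & lam * blaschke a zeta = zeta.
Proof.
move=> da a0 lam1.
have ac0 : a^* != 0 by rewrite conjC_eq0.
pose s := sqrtC ((1 + lam) ^+ 2 - 4 * lam * (a^* * a)).
have s2 : s ^+ 2 = (1 + lam) ^+ 2 - 4 * lam * (a^* * a) by rewrite sqrtCK.
pose root e : R[i] := (1 + lam + e) / (2 * a^*).
have two0 : (2 : R[i]) != 0 by rewrite pnatr_eq0.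
have quad e : e ^+ 2 = s ^+ 2 -> a^* * root e ^+ 2 - (1 + lam) * root e + lam * a = 0.
  move=> e2; have : a^* * root e ^+ 2 - (1 + lam) * root e + lam * a =
    (e ^+ 2 - ((1 + lam) ^+ 2 - 4 * lam * (a^* * a))) / (4 * a^*).
    by rewrite /root; field; rewrite ac0.
  by rewrite e2 s2 subrr mul0r.
have prod : modulus (root s) * modulus (root (- s)) = 1.
  rewrite -modulusM.
  have -> : root s * root (- s) = ((1 + lam) ^+ 2 - s ^+ 2) / (4 * a^* ^+ 2).
    by rewrite /root; field; rewrite ac0.
  rewrite s2 opprB addrCA subrr addr0.
  have -> : 4 * lam * (a^* * a) / (4 * a^* ^+ 2) = lam * (a / a^*) by field; rewrite ac0.
  rewrite modulusM lam1 mul1r modulusM modulusV modulus_conj divff //.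
  by rewrite modulus_eq0.
have fixed zeta : a^* * zeta ^+ 2 - (1 + lam) * zeta + lam * a = 0 -> modulus zeta <= 1 ->
    lam * blaschke a zeta = zeta.
  move=> q z1; have h := denominator_neq0 da z1.
  apply: (mulIf h); rewrite /blaschke mulrA divfK //.
  apply/eqP; rewrite -subr_eq0 -q; apply/eqP; ring.
have [h|h] := leP (modulus (root s)) 1.
  by exists (root s) => //; apply: fixed => //; exact: quad.
exists (root (- s)); last apply: fixed; try by (apply: quad; rewrite sqrrN).
  by have := modulus_ge0 (root (- s)); nra.
by have := modulus_ge0 (root (- s)); nra.
Qed.

Section Orbits.
Variables (a lam : R[i]).
Hypotheses (da : disk a) (lam1 : modulus lam = 1).
Let Phi z := lam * blaschke a z.
Let Psi z := blaschke a (lam^-1 * z).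

Let lam0 : lam != 0.
Proof. by rewrite -modulus_eq0 lam1 oner_eq0. Qed.

Let modPhi z : modulus (Phi z) = modulus (blaschke a z).
Proof. by rewrite modulusM lam1 mul1r. Qed.

Let modlamV z : modulus (lam^-1 * z) = modulus z.
Proof. by rewrite modulusM modulusV lam1 invr1 mul1r. Qed.

Let closed_blaschke z : modulus z <= 1 -> modulus (blaschke a z) <= 1.
Proof.
rewrite le_eqVlt => /orP[/eqP z1|z1]; first by rewrite blaschke_circle.
by apply: disk_closed; apply: blaschke_disk => //; exact/diskP.
Qed.

Let PhiK z : modulus z <= 1 -> Phi (Psi z) = z.
Proof. by move=> z1; rewrite /Phi /Psi blaschkeK ?modlamV // mulrA divff // mul1r. Qed.

(** Sending the fixed point to infinity makes the automorphism affine. The multiplier is real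
    because [phi zeta = zeta] with [|zeta| = 1] forces [lam = - q / conj(q)] for [q = 1 -
    conj(a) zeta]. *)
Lemma affine_conjugate zeta z : modulus zeta = 1 -> Phi zeta = zeta -> modulus z <= 1 -> z != zeta ->
  Phi z != zeta /\
  (Phi z - zeta)^-1 = (modulus (1 - a^* * zeta) ^+ 2 / (1 - modulus a ^+ 2))%:C * (z - zeta)^-1
     - a^* * (1 - a^* * zeta) / (lam * (a^* * a - 1)).
Proof.
move=> z1 Pz zz1 nz; have z1' : modulus zeta <= 1 by rewrite z1.
have q0 := denominator_neq0 da z1'; have qz0 := denominator_neq0 da zz1.
have a1 := one_sub_sqr_gt0 da.
have aa : a^* * a - 1 = - (1 - modulus a ^+ 2)%:C.
  by rewrite conj_mul rmorphB rmorph1 opprB.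
have aa0 : a^* * a - 1 != 0.
  by rewrite aa oppr_eq0 -modulus_eq0 modulusC normr_eq0 gt_eqF.
have d0 : z - zeta != 0 by rewrite subr_eq0.
have E : Phi z - zeta = lam * ((a^* * a - 1) * (z - zeta) / ((1 - a^* * z) * (1 - a^* * zeta))).
  by rewrite -{1}Pz /Phi -mulrBr blaschke_sub.
split; first by rewrite -subr_eq0 E !mulf_neq0 // invr_eq0 mulf_neq0.
have zz : zeta * zeta^* = 1 by rewrite mulcJ z1 expr1n.
have zc0 : zeta^* != 0 by rewrite conjC_eq0 -modulus_eq0 z1 oner_eq0.
have qc : (1 - a^* * zeta)^* = 1 - a * zeta^*.
  by rewrite rmorphB rmorph1 (rmorphM Num.conj) /= conjCK.
have zeta0 : zeta != 0 by rewrite -modulus_eq0 z1 oner_eq0.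
have qcE : (1 - a^* * zeta)^* = - (1 - a^* * zeta) / lam.
  have h : lam * (a - zeta) = zeta * (1 - a^* * zeta).
    by rewrite -{2}Pz /Phi /blaschke -mulrA divfK.
  apply: (mulfI lam0); apply: (mulfI zeta0); rewrite [in RHS]mulrC.
  rewrite qc; move: (a^*) (zeta^*) zz h lam0 => b c zz h l0.
  have -> : zeta * (lam * (1 - a * c)) = lam * (zeta - a * (zeta * c)) by ring.
  rewrite zz mulr1 -[zeta - a]opprB mulrN h; field; exact: l0.
have -> : (modulus (1 - a^* * zeta) ^+ 2 / (1 - modulus a ^+ 2))%:C =
   (1 - a^* * zeta) ^+ 2 / (lam * (a^* * a - 1)).
  rewrite (rmorphM (real_complex R)) (fmorphV (real_complex R)) /= -mulcJ qcE.
  have -> : (1 - modulus a ^+ 2)%:C = - (a^* * a - 1) by rewrite aa opprK.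
  move: (1 - a^* * zeta) (a^* * a - 1) aa0 lam0 => q k k0 l0; field.
  by rewrite l0 k0.
rewrite E; move: (a^*) aa0 lam0 q0 qz0 d0 => b k0 l0 q0' qz0' d0'; field.
by rewrite k0 l0 q0' qz0' d0'.
Qed.

Let PhiE z : modulus z <= 1 -> modulus (Phi z) <= 1.
Proof. by rewrite modPhi; exact: closed_blaschke. Qed.

Let PsiE z : modulus z <= 1 -> modulus (Psi z) <= 1.
Proof. by move=> z1; rewrite closed_blaschke // modlamV. Qed.

Section Expanding.
Variable M : R[i] -> R.
Hypothesis cM : forall z, modulus z <= 1 -> continuous_at_point M z.
Hypothesis M_disk : forall z, disk z -> M z < M (Phi z).
Hypothesis M_circle : forall z, modulus z = 1 -> M (Phi z) = M z.

(** The limit does not depend on the starting point, be it in the disk or on the circle. *)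
Lemma orbit_value_limit (F : R[i] -> R[i]) (A : R) B zeta z : modulus zeta = 1 -> 0 < A -> B != 0 ->
  (forall x, modulus x <= 1 -> modulus (F x) <= 1) ->
  (forall x, modulus x <= 1 -> x != zeta -> F x != zeta /\ (F x - zeta)^-1 = A%:C * (x - zeta)^-1 + B) ->
  modulus z <= 1 -> z != zeta -> (z - zeta)^-1 != B / (1 - A)%:C ->
  (fun n => M (iter n F z)) @ \oo --> (M (orbit_limit A B zeta) : R).
Proof.
move=> z1 A0 B0 Fd FE zd zz zf.
have It n : modulus (iter n F z) <= 1 /\ iter n F z != zeta.
  by elim: n => //= n [i1 i2]; split; [exact: Fd|have [] := FE _ i1 i2].
have cv : converges (fun n => iter n F z) (orbit_limit A B zeta).
  have h := @orbit_cvg R A B zeta (fun n => (iter n F z - zeta)^-1) A0 B0.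
  have E : (fun n => iter n F z) = (fun n => zeta + (iter n F z - zeta)^-1^-1).
    by apply/funext => n; rewrite invrK addrC subrK.
  rewrite E; apply: h => [n|n|].
  - by rewrite invr_eq0 subr_eq0; have [] := It n.
  - by have [i1 i2] := It n; have [_] := FE _ i1 i2.
  - exact: zf.
apply: (cvg_continuous_at cv); apply: cM.
apply: (@le_modulus_cvg _ (fun n => iter n F z)); first by move/cvgC_seq: cv.
by move=> n; have [] := It n.
Qed.

Lemma inverse_affine zeta (A : R) B : 0 < A -> Phi zeta = zeta ->
  (forall x, modulus x <= 1 -> x != zeta -> Phi x != zeta /\ (Phi x - zeta)^-1 = A%:C * (x - zeta)^-1 + B) ->
  forall x, modulus x <= 1 -> x != zeta ->
    Psi x != zeta /\ (Psi x - zeta)^-1 = (A^-1)%:C * (x - zeta)^-1 + - (B / A%:C).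
Proof.
move=> A0 Pz hP x x1 xz.
have A0' : A%:C != 0 by rewrite -modulus_eq0 modulusC normr_eq0 gt_eqF.
have yz : Psi x != zeta by apply: contraNneq xz => yz; rewrite -(PhiK x1) yz Pz.
split=> //; have [_] := hP _ (PsiE x1) yz; rewrite PhiK // => ->.
rewrite (fmorphV (real_complex R)) /=; move: (_ - _)^-1 (A%:C) A0' => t k k0; field; exact: k0.
Qed.

(** A fixed point in the disk is excluded by the strict increase, so there is one on the circle.
    The function has the same limit [M L1] along all forward orbits and the same limit [M L2]
    along all backward orbits. Orbits on the circle show that [M L1 = M L2], while the orbit of
    the origin shows that [M L2 < M L1]. *)
Lemma no_strict_increase : False.
Proof.
have fixed_disk z : disk z -> Phi z <> z by move=> dz E; have := M_disk dz; rewrite E ltxx.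
have d0 : disk (0 : R[i]) by apply/diskP; rewrite modulus0.
have a0 : a != 0.
  apply/eqP => a0; apply: (fixed_disk 0 d0).
  by rewrite /Phi /blaschke a0 subrr mul0r mulr0.
have [zeta z1 Pz] := fixed_point_exists da a0 lam1.
have {}z1 : modulus zeta = 1.
  apply/eqP; rewrite eq_le z1 leNgt; apply/negP => /diskP dz; exact: fixed_disk Pz.
have z1' : modulus zeta <= 1 by rewrite z1.
have a1 := one_sub_sqr_gt0 da.
have q0 := denominator_neq0 da z1'.
pose A := modulus (1 - a^* * zeta) ^+ 2 / (1 - modulus a ^+ 2).
pose B := - (a^* * (1 - a^* * zeta) / (lam * (a^* * a - 1))).
have A0 : 0 < A by rewrite divr_gt0 // exprn_gt0 // modulus_gt0.
have aa0 : a^* * a - 1 != 0.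
  have -> : a^* * a - 1 = - (1 - modulus a ^+ 2)%:C by rewrite conj_mul rmorphB rmorph1 opprB.
  by rewrite oppr_eq0 -modulus_eq0 modulusC normr_eq0 gt_eqF.
have B0 : B != 0.
  by rewrite oppr_eq0 mulf_neq0 ?invr_eq0 ?mulf_neq0 // conjC_eq0.
have hP x : modulus x <= 1 -> x != zeta -> Phi x != zeta /\ (Phi x - zeta)^-1 = A%:C * (x - zeta)^-1 + B.
  by move=> x1 xz; exact: affine_conjugate.
have hQ := inverse_affine A0 Pz hP.
have A0V : 0 < A^-1 by rewrite invr_gt0.
have A0c : A%:C != 0 by rewrite -modulus_eq0 modulusC normr_eq0 gt_eqF.
have B0V : - (B / A%:C) != 0 by rewrite oppr_eq0 mulf_neq0 // invr_eq0.
have fpE : - (B / A%:C) / (1 - A^-1)%:C = B / (1 - A)%:C.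
  have [->|A1] := eqVneq A 1; first by rewrite !invr1 !subrr (rmorph0 (real_complex R)) invr0 !mulr0.
  have A1c : 1 - A%:C != 0.
    rewrite -(rmorph1 (real_complex R)) -rmorphB -modulus_eq0 modulusC normr_eq0 subr_eq0 eq_sym //.
  have A1c' : A%:C - 1 != 0 by rewrite -oppr_eq0 opprB.
  rewrite !rmorphB !rmorph1 (fmorphV (real_complex R)) /=.
  by field; rewrite A0c A1c A1c'.
set L1 := orbit_limit A B zeta; set L2 := orbit_limit A^-1 (- (B / A%:C)) zeta.
have limits z : modulus z <= 1 -> z != zeta -> (z - zeta)^-1 != B / (1 - A)%:C ->
    (fun n => M (iter n Phi z)) @ \oo --> (M L1 : R) /\ (fun n => M (iter n Psi z)) @ \oo --> (M L2 : R).
  move=> zd zz zf; split; first exact: (orbit_value_limit z1 A0 B0 PhiE hP zd zz zf).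
  by apply: (orbit_value_limit z1 A0V B0V PsiE hQ zd zz); rewrite fpE.
(* On the circle, the two limits agree. *)
have circle : M L1 = M L2.
  have key xi : modulus xi = 1 -> xi != zeta -> (xi - zeta)^-1 != B / (1 - A)%:C -> M L1 = M L2.
    move=> x1 xz xf; have x1' : modulus xi <= 1 by rewrite x1.
    have [l1 l2] := limits xi x1' xz xf.
    have c1 n : modulus (iter n Phi xi) = 1 /\ M (iter n Phi xi) = M xi.
      by elim: n => //= n [i1 <-]; rewrite modPhi blaschke_circle // M_circle.
    have c2 n : modulus (iter n Psi xi) = 1 /\ M (iter n Psi xi) = M xi.
      elim: n => //= n [i1 <-]; have i1' : modulus (iter n Psi xi) <= 1 by rewrite i1.
      have m1 : modulus (Psi (iter n Psi xi)) = 1 by rewrite blaschke_circle // modlamV.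
      by split => //; rewrite -[in RHS](PhiK i1') M_circle.
    have e1 : (fun n => M (iter n Phi xi)) = fun=> M xi by apply/funext => n; have [] := c1 n.
    have e2 : (fun n => M (iter n Psi xi)) = fun=> M xi by apply/funext => n; have [] := c2 n.
    rewrite e1 in l1; rewrite e2 in l2.
    have := cvg_lim (@norm_hausdorff _ _) l1; have := cvg_lim (@norm_hausdorff _ _) l2.
    by move=> <- <-.
  (* At most one of the points [- zeta] and [i zeta] is fixed. *)
  have zeta0 : zeta != 0 by rewrite -modulus_eq0 z1 oner_eq0.
  have i2 : ('i : R[i]) ^+ 2 = -1 by exact: sqrCi.
  have mi : modulus ('i : R[i]) = 1.
    by apply/eqP; rewrite -(@eqrXn2 _ 2) ?modulus_ge0 // -modulusX i2 modulusN modulus1 expr1n.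
  have i1 : ('i : R[i]) - 1 != 0.
    rewrite subr_eq0; apply/eqP => h; have := i2; rewrite h expr1n => /eqP.
    by rewrite -addr_eq0 -mulr2n pnatr_eq0.
  have [h|h] := eqVneq ((- zeta - zeta)^-1) (B / (1 - A)%:C); last first.
    apply: (key (- zeta)) => //; first by rewrite modulusN.
    by rewrite -subr_eq0 -opprD oppr_eq0 -mulr2n mulrn_eq0.
  apply: (key ('i * zeta)).
  - by rewrite modulusM mi z1 mulr1.
  - by rewrite -subr_eq0 -{2}[zeta]mul1r -mulrBl mulf_neq0.
  rewrite -h -subr_eq0; apply/eqP => /eqP; rewrite subr_eq0 => /eqP /invr_inj /eqP.
  rewrite (inj_eq (addIr _)) -mulN1r (inj_eq (mulIf zeta0)) => /eqP hi.
  have := i2; rewrite hi sqrrN expr1n => /eqP.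
  by rewrite -addr_eq0 -mulr2n pnatr_eq0.
(* In the disk, they are separated by the first step of the orbit. *)
have zz : (0 : R[i]) != zeta by rewrite eq_sym -modulus_eq0 z1 oner_eq0.
have zf : (0 - zeta)^-1 != B / (1 - A)%:C.
  apply/eqP => h; apply: (fixed_disk 0 d0).
  have m0 : modulus (0 : R[i]) <= 1 by rewrite modulus0.
  have [_] := hP 0 m0 zz.
  have [A1|A1] := eqVneq A 1.
    move: h; rewrite A1 subrr (rmorph0 (real_complex R)) invr0 mulr0 => /eqP; rewrite invr_eq0 sub0r oppr_eq0 => /eqP zeta0.
    by move: zz; rewrite zeta0 eqxx.
  have A1c : 1 - A%:C != 0.
    rewrite -(rmorph1 (real_complex R)) -rmorphB -modulus_eq0 modulusC normr_eq0 subr_eq0 eq_sym //.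
  have -> : A%:C * (0 - zeta)^-1 + B = (0 - zeta)^-1.
    by rewrite h rmorphB rmorph1; field.
  by move/invr_inj => /addIr.
have m0 : modulus (0 : R[i]) <= 1 by rewrite modulus0.
have [l1 l2] := limits 0 m0 zz zf.
have up n : disk (iter n.+1 Phi 0) /\ M (Phi 0) <= M (iter n.+1 Phi 0).
  have Pd x : disk x -> disk (Phi x).
    by move=> dx; apply/diskP; rewrite modPhi; apply/diskP; exact: blaschke_disk.
  elim: n => [|n [i1 i2]]; first by split => //; exact: Pd.
  split; first exact: Pd.
  by apply: (le_trans i2); apply: ltW; exact: M_disk.
have down n : disk (iter n Psi 0) /\ M (iter n Psi 0) <= M 0.
  elim: n => // n [i1 i2] /=.
  have dP : disk (Psi (iter n Psi 0)).
    by apply: blaschke_disk => //; apply/diskP; rewrite modlamV; exact/diskP.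
  split=> //; apply: le_trans i2; have := M_disk dP; rewrite PhiK; [exact: ltW|exact: disk_closed].
have b1 : M (Phi 0) <= M L1.
  have h := cvg_lim (@norm_hausdorff _ _) l1; rewrite -h.
  apply: limr_ge; first by apply/cvg_ex; eexists; exact: l1.
  by exists 1%N => // -[|n] //= _; have [] := up n.
have b2 : M L2 <= M 0.
  have h := cvg_lim (@norm_hausdorff _ _) l2; rewrite -h.
  apply: limr_le; first by apply/cvg_ex; eexists; exact: l2.
  by exists 0%N => // n _; have [] := down n.
by have := M_disk d0; move: b1 b2; rewrite circle; lra.
Qed.

End Expanding.
End Orbits.
End NoIncrease.

(** * Boundary behaviour of kernels and symbols *)

Section BoundaryModulus.
Variable R : realType.
Implicit Types (z x u a : R[i]).

Lemma continuous_at_pointP (M : R[i] -> R) x :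
  continuous_at_point M x <-> ((M : R[i]^o -> R) @ (x : R[i]^o) --> M x).
Proof.
split=> [cM P /nbhs_ballP [e /= e0 he]|cM e e0].
  have [d d0 hd] := cM e e0.
  change (\forall z \near (x : R[i]^o), P (M z)); apply/nearC.
  by exists d => // z /hd h; apply: he; rewrite /ball /= distrC.
have /nearC [d d0 hd] : \forall z \near (x : R[i]^o), ball (M x) e (M z).
  by apply: cM; exact: nbhsx_ballx.
by exists d => // z /hd; rewrite /ball /= distrC.
Qed.

Lemma eq_continuous_at (M N : R[i] -> R) x : M =1 N -> continuous_at_point M x -> continuous_at_point N x.
Proof. by move=> /funext ->. Qed.

Lemma modulus_continuous_at f x : analytic_at f x -> continuous_at_point (fun z => modulus (f z)) x.
Proof.
move=> af e e0; have [d d0 hd] := analytic_continuous af e0.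
by exists d => // z /hd; apply: le_lt_trans; exact: modulus_dist.
Qed.

Lemma cpowr_denominator_continuous (g : R) a x : 0 < g -> disk a -> modulus x <= 1 ->
  continuous_at_point (fun z => modulus (cpowr (1 - a^* * z) g)) x.
Proof.
move=> g0 da x1.
pose S z := (cpowr (1 - z) g)^-1.
have aS : analytic_on (@disk R) S.
  apply: (disk_series_analytic (c := fun n => (binomial_coef g n)%:C)) => z /diskP z1.
  exact: binomial_series.
have dx : disk (a^* * x) by apply/diskP; exact: mul_conj_lt1.
have /analytic_onP /(_ _ dx) /modulus_continuous_at cS := aS.
have cS' : continuous_at_point (fun z => modulus (S (a^* * z))) x.
  move=> e /cS [d d0 hd]; exists d => // z zd; apply: hd.
  rewrite -mulrBr modulusM modulus_conj; apply: le_lt_trans zd.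
  have /diskP /ltW a1 := da; by rewrite -[leRHS]mul1r ler_wpM2r ?modulus_ge0.
apply: (@eq_continuous_at (fun z => (modulus (S (a^* * z)))^-1)).
  by move=> z; rewrite -modulusV /S invrK.
move/continuous_at_pointP: cS' => cS'; apply/continuous_at_pointP.
apply: cvgV cS'; rewrite modulus_eq0 invr_eq0; exact: cpowr_kernel_neq0.
Qed.

Lemma continuous_atM (M N : R[i] -> R) x : continuous_at_point M x -> continuous_at_point N x ->
  continuous_at_point (fun z => M z * N z) x.
Proof.
move=> /continuous_at_pointP cM /continuous_at_pointP cN; apply/continuous_at_pointP.
exact: (cvgM cM cN).
Qed.

Lemma continuous_at_sqr (M : R[i] -> R) x : continuous_at_point M x -> continuous_at_point (fun z => M z ^+ 2) x.
Proof. by move=> cM; exact: (continuous_atM cM cM). Qed.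

Lemma symbol_continuous (H : disk_space R) psi a x : disk a -> analytic_on_closed_disk psi -> modulus x <= 1 ->
  continuous_at_point (fun z => modulus (symbol H psi a z) ^+ 2) x.
Proof.
move=> da [U [_ cU /analytic_onP aU]] x1.
have ax : analytic_at psi x.
  by apply/aU/cU; rewrite /closed_disk /=; move: x1; rewrite -lecR; case: (x).
apply: (@eq_continuous_at (fun z => (modulus (cpowr (1 - a^* * z) (space_exponent H)) * modulus (psi z)) ^+ 2)).
  by move=> z; rewrite -modulusM.
apply: continuous_at_sqr; apply: continuous_atM (modulus_continuous_at ax).
by apply: cpowr_denominator_continuous => //; exact: space_exponent_gt0.
Qed.

Lemma continuous_bounded (M : R[i] -> R) : (forall z, modulus z <= 1 -> continuous_at_point M z) ->
  exists B : R, forall z, modulus z <= 1 -> M z <= B.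
Proof.
move=> cM; have [|N hN] := @closed_disk_uniform R 1 (fun n z => M z <= n%:R).
  move=> z z1; have [d d0 hd] := cM z z1 1 ltr01; exists d => //.
  exists (Num.truncn (`|M z| + 1)).+1 => z' n z'd nn.
  have := hd z' z'd; rewrite ltr_norml => /andP[_ h1].
  have h2 : `|M z| + 1 < (Num.truncn (`|M z| + 1)).+1%:R by rewrite truncnS_gt // num_real.
  have h3 : ((Num.truncn (`|M z| + 1)).+1%:R : R) <= n%:R by rewrite ler_nat.
  by have := ler_norm (M z); lra.
by exists N%:R => z; exact: hN.
Qed.

Section Bergman.
Variables (alpha : R) (ha : -1 < alpha) (c : R).
Hypothesis rep : reproducing (Bergman ha) c.
Local Notation H := (Bergman ha).
Local Notation g := (alpha + 2).
Local Notation wt := (@bergman_weight R alpha).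
Local Notation mu := (@area R).
Local Notation Dk := (@plane_disk R).
Local Notation energy f := (Rintegral mu Dk (fun p => modulus (f (of_plane p)) ^+ 2 * wt (of_plane p))).

Let g0 : 0 < g.
Proof. by move: ha; lra. Qed.

Let c0 : 0 < c := rep_gt0 rep.

Lemma kernel_energy u : disk u -> energy (kernel g u) = c * (1 - modulus u ^+ 2) `^ (- g).
Proof.
move=> du; have hK := rep_kernel_in rep du.
have := rep_kernel rep hK du; rewrite bergman_norm kernel_diag //.
by rewrite -rmorphM => /(congr1 (@complex.Re R)).
Qed.

Lemma modulus_near_circle u x z : modulus x = 1 -> modulus z <= 1 ->
  modulus (z - x) - modulus (u - x) <= modulus (1 - u^* * z).
Proof.
move=> x1 z1; have xx : x^* * x = 1 by rewrite conj_mul x1 expr1n.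
have -> : 1 - u^* * z = (x^* * (x - z)) - (u - x)^* * z by rewrite rmorphB /= -xx; ring.
apply: le_trans (modulus_sub _ _); rewrite !modulusM !modulus_conj x1 mul1r modulusB.
have := modulus_ge0 (u - x); nra.
Qed.

Lemma kernel_far u x z (d : R) : modulus x = 1 -> disk u -> disk z -> 0 < d -> d <= modulus (z - x) ->
  modulus (u - x) <= d / 2 -> modulus (kernel g u z) <= ((d / 2) `^ g)^-1.
Proof.
move=> x1 du dz d0 zx ux; rewrite modulus_kernel powRN.
have h := modulus_near_circle u x1 (disk_closed dz).
have d2 : 0 < d / 2 by rewrite divr_gt0.
have m0 : 0 < modulus (1 - u^* * z) by lra.
rewrite lef_pV2 ?posrE ?powR_gt0 //.
rewrite ge0_ler_powR ?nnegrE ?modulus_ge0 ?(ltW g0) ?(ltW d2) //; lra.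
Qed.

(** Away from [x], the kernels [K_u] stay bounded as [u] tends to [x], whereas their norms blow
    up: the difference is at most [e] times the energy, from the neighbourhood of [x], plus a
    constant, from its complement. *)
Lemma concentration f x (B A e d : R) : modulus x = 1 -> 0 < d -> 0 <= e -> 0 <= A ->
  analytic_on (@disk R) f -> (forall z, disk z -> modulus (f z) ^+ 2 <= B) ->
  (forall z, disk z -> modulus (z - x) < d -> `|modulus (f z) ^+ 2 - A| <= e) ->
  exists C : R, forall u, disk u -> modulus (u - x) <= d / 2 ->
    in_space H (fun y => f y * kernel g u y) ->
    `|energy (fun y => f y * kernel g u y) - A * energy (kernel g u)| <= e * energy (kernel g u) + C.
Proof.
move=> x1 d0 e0 A0 af fB fe.
have mD := @measurable_plane_disk R.
pose k := (((d / 2) `^ g)^-1) ^+ 2.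
pose I := Rintegral mu Dk (wt \o @of_plane R).
exists ((B + A) * k * I) => u du ux hf.
have /in_bergmanP [_ i1] := hf; have /in_bergmanP [_ i2] := rep_kernel_in rep du.
have iw := integrable_weight ha.
have j2 := integrable_scale mD A i2; have j3 := integrable_scale mD e i2.
have j4 := integrable_scale mD ((B + A) * k) iw.
have E2 : A * energy (kernel g u) = Rintegral mu Dk (fun p => A * (modulus (kernel g u (of_plane p)) ^+ 2 * wt (of_plane p))).
  by rewrite RintegralZl.
have E3 : e * energy (kernel g u) + (B + A) * k * I =
   Rintegral mu Dk (fun p => e * (modulus (kernel g u (of_plane p)) ^+ 2 * wt (of_plane p)) + (B + A) * k * (wt \o @of_plane R) p).
  by rewrite RintegralD // RintegralZl // RintegralZl.
have iB := integrableB mD i1 j2.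
rewrite E2 E3 -RintegralB //.
apply: le_trans (le_normr_Rintegral mD iB) _.
apply: le_Rintegral => //.
- exact: integrable_norm iB.
- exact: integrable_add.
move=> p Dp /=; set z := of_plane p.
have w0 := weight_ge0 ha z; have K0 := sqr_ge0 (modulus (kernel g u z)).
have fz0 := sqr_ge0 (modulus (f z)); have fzB := fB z Dp.
rewrite modulusM exprMn.
have -> : modulus (f z) ^+ 2 * modulus (kernel g u z) ^+ 2 * wt z - A * (modulus (kernel g u z) ^+ 2 * wt z) =
  (modulus (f z) ^+ 2 - A) * (modulus (kernel g u z) ^+ 2 * wt z) by ring.
rewrite normrM (ger0_norm (mulr_ge0 K0 w0)).
have k0 : 0 <= k by exact: sqr_ge0.
have KW := mulr_ge0 K0 w0.
have B0 : 0 <= B := le_trans fz0 fzB.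
have BA0 : 0 <= B + A by rewrite addr_ge0.
have BA : 0 <= (B + A) * k * wt z by apply: mulr_ge0 => //; exact: mulr_ge0.
have [zd|zd] := ltP (modulus (z - x)) d.
  by apply: le_trans (ler_wpM2r KW (fe z Dp zd)) _; rewrite lerDl.
have hk : modulus (kernel g u z) ^+ 2 <= k.
  by rewrite /k lerXn2r ?nnegrE ?modulus_ge0 ?invr_ge0 ?powR_ge0 // (kernel_far x1).
have hn : `|modulus (f z) ^+ 2 - A| <= B + A.
  by rewrite ler_norml; apply/andP; split; lra.
have h1 : `|modulus (f z) ^+ 2 - A| * (modulus (kernel g u z) ^+ 2 * wt z) <= (B + A) * (k * wt z).
  by apply: ler_pM => //; rewrite ler_wpM2r.
by apply: le_trans h1 _; rewrite [leLHS]mulrA lerDr; exact: mulr_ge0.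
Qed.

End Bergman.
End BoundaryModulus.

(** * Constancy of the symbol and the theorem *)

Section BergmanNormal.
Variable R : realType.
Variables (alpha : R) (ha : -1 < alpha) (c : R).
Local Notation H := (Bergman ha).
Local Notation g := (alpha + 2).
Local Notation converges w s := ((w : nat -> R[i]^o) @ \oo --> (s : R[i]^o)).
Hypothesis rep : reproducing H c.
Variables (phi psi : R[i] -> R[i]) (a lam : R[i]).
Hypotheses (da : disk a) (lam1 : modulus lam = 1).
Hypothesis phiE : forall z, disk z -> phi z = lam * blaschke a z.
Hypothesis apsi : analytic_on_closed_disk psi.
Hypothesis normal : normal_operator H (weighted_composition_op psi phi).
Local Notation w := (symbol H psi a).
Local Notation N := (fun z => modulus (w z) ^+ 2).

Let c0 : 0 < c := rep_gt0 rep.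

Lemma symbol_analytic : analytic_on (@disk R) w.
Proof.
have d0 : disk (0 : R[i]) by apply/diskP; rewrite modulus0.
have [aw _] := symbol_kernel_in rep da lam1 phiE normal d0.
by apply: eqD_analytic aw => z _; rewrite kernel0 mulr1.
Qed.

Lemma blaschke_lipschitz : exists2 K : R, 0 < K & forall x y : R[i], modulus x <= 1 -> modulus y <= 1 ->
  modulus (blaschke a x - blaschke a y) <= K * modulus (x - y).
Proof.
have /diskP a1 := da; have b0 : 0 < 1 - modulus a by rewrite subr_gt0.
exists ((modulus (a^* * a - 1) + 1) / (1 - modulus a) ^+ 2).
  by rewrite divr_gt0 ?exprn_gt0 // ltr_wpDl ?modulus_ge0.
move=> x y x1 y1; rewrite blaschke_sub // modulusM modulusV !modulusM mulrAC.
rewrite ler_wpM2r ?modulus_ge0 //.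
have hx := modulus_denominator a x1; have hy := modulus_denominator a y1.
have k0 := modulus_ge0 (a^* * a - 1).
apply: ler_pM => //; first by rewrite invr_ge0 mulr_ge0 // modulus_ge0.
  by rewrite lerDl.
have p0 : 0 < modulus (1 - a^* * x) by lra.
have p1 : 0 < modulus (1 - a^* * y) by lra.
by rewrite lef_pV2 ?posrE ?mulr_gt0 ?exprn_gt0 // expr2 ler_pM // ltW.
Qed.

(** The energy of [w K_u] is [|w(phi u)|^2] times that of [K_u] by normality, and approximately
    [|w(x)|^2] times that of [K_u], for [u] close to [x], by concentration. Both factors are
    continuous up to the circle. *)
Lemma boundary_modulus x : modulus x = 1 -> N (lam * blaschke a x) = N x.
Proof.
move=> x1; have x1' : modulus x <= 1 by rewrite x1.
have cN z : modulus z <= 1 -> continuous_at_point N z by exact: symbol_continuous.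
have [B hB] := continuous_bounded cN.
have [K K0 hK] := blaschke_lipschitz.
pose Phi z := lam * blaschke a z.
have Phi_sub u : modulus u <= 1 -> modulus (Phi u - Phi x) <= K * modulus (u - x).
  by move=> u1; rewrite /Phi -mulrBr modulusM lam1 mul1r; exact: hK.
have Px1 : modulus (Phi x) <= 1 by rewrite modulusM lam1 mul1r blaschke_circle.
apply/eqP; apply: contraT => ne.
pose e := `|N (Phi x) - N x| / 4.
have e0 : 0 < e by rewrite divr_gt0 // normr_gt0 subr_eq0.
have [d d0 hd] := cN x x1' e e0.
have [d' d'0 hd'] := cN (Phi x) Px1 e e0.
have [||z dz|z dz zx|C hC] := @concentration _ alpha ha c rep w x B (N x) e d x1 d0 (ltW e0).
- exact: sqr_ge0.
- exact: symbol_analytic.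
- by apply: hB; exact: disk_closed.
- by apply: ltW; exact: hd.
have C1 : 0 < `|C| + 1 by rewrite ltr_wpDl.
(* A distance to [x] at which the three estimates below hold. *)
pose t := Num.min (Num.min (d / 2) (d' / (2 * K))) (e * c / (2 * (`|C| + 1))).
have t0 : 0 < t.
  by rewrite !lt_min !divr_gt0 //; apply: mulr_gt0.
have [n hn] : exists n, 1 - t < radius R n by apply: radius_above; lra.
have /andP[r0 r1] := radius_itv R n.
set r := radius R n in hn r0 r1.
pose u := r%:C * x.
have mu1 : modulus u = r by rewrite modulusM modulusC x1 mulr1 gtr0_norm.
have du : disk u by apply/diskP; rewrite mu1.
have ux : modulus (u - x) = 1 - r.
  have -> : u - x = (r - 1)%:C * x by rewrite rmorphB rmorph1 mulrBl mul1r.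
  by rewrite modulusM modulusC x1 mulr1 ltr0_norm ?subr_lt0 // opprB.
have rt : 1 - r < t by lra.
have t1 : t <= d / 2 by rewrite /t !ge_min lexx.
have t2 : t <= d' / (2 * K) by rewrite /t !ge_min lexx orbT.
have t3 : t <= e * c / (2 * (`|C| + 1)) by rewrite /t !ge_min lexx orbT.
have hw := symbol_kernel_in rep da lam1 phiE normal du.
have udx : modulus (u - x) <= d / 2 by rewrite ux; lra.
have := hC u du udx hw.
have -> : Rintegral (@area R) (@plane_disk R)
    (fun p => modulus (w (of_plane p) * kernel g u (of_plane p)) ^+ 2 * bergman_weight alpha (of_plane p)) =
    c * (N (Phi u) * (1 - modulus u ^+ 2) `^ (- g)).
  have := symbol_kernel_norm rep da lam1 phiE normal du; rewrite bergman_norm phiE //.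
  by move=> /(congr1 (@complex.Re R)).
rewrite (kernel_energy rep du).
set P := (1 - modulus u ^+ 2) `^ (- g).
have s0 := one_sub_sqr_gt0 du.
have P0 : 0 < P by rewrite powR_gt0.
have -> : c * (N (Phi u) * P) - N x * (c * P) = (N (Phi u) - N x) * (c * P) by ring.
have cP : 0 < c * P by rewrite mulr_gt0.
rewrite normrM (gtr0_norm cP) => h1.
have hP : 1 <= P * (2 * t).
  have : P^-1 <= 2 * t.
    rewrite /P powRN invrK; apply: (@le_trans _ _ (1 - modulus u ^+ 2)).
      apply: ge1r_powR; first by rewrite s0 gerBl sqr_ge0.
      by move: ha; lra.
    by rewrite mu1; nra.
  by move/(ler_wpM2l (ltW P0)); rewrite divff ?gt_eqF.
have hCe : C <= e * (c * P).
  apply: le_trans (ler_norm C) _.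
  have q : t * (2 * (`|C| + 1)) <= e * c by rewrite -ler_pdivlMr // mulr_gt0.
  have q1 : P * (t * (2 * (`|C| + 1))) <= P * (e * c) by rewrite ler_pM2l.
  have := normr_ge0 C; nra.
have h2 : `|N (Phi u) - N x| <= 2 * e.
  by rewrite -(ler_pM2r cP); lra.
have h3 : `|N (Phi u) - N (Phi x)| < e.
  apply: hd'; apply: le_lt_trans (Phi_sub u (disk_closed du)) _.
  rewrite ux; apply: (@lt_le_trans _ _ (K * t)); first by rewrite ltr_pM2l.
  rewrite -ler_pdivlMl //; apply: le_trans t2 _.
  have -> : d' / (2 * K) = K^-1 * d' / 2 by field; rewrite gt_eqF.
  have : 0 < K^-1 * d' by rewrite mulr_gt0 // invr_gt0.
  by lra.
have : `|N (Phi x) - N x| <= `|N (Phi u) - N x| + `|N (Phi u) - N (Phi x)|.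
  have -> : N (Phi x) - N x = (N (Phi u) - N x) - (N (Phi u) - N (Phi x)) by ring.
  exact: ler_normB.
have : `|N (Phi x) - N x| = 4 * e by rewrite /e mulrC divfK.
by move: h2 h3; lra.
Qed.

(** If [|w(u)| = |w(phi u)|] for some [u], the case of equality of [symbol_le] applies.
    Otherwise [|w|] increases strictly under [phi] in the disk and is invariant on the circle,
    which the dynamics forbids. *)
Lemma bergman_symbol_constant u v : disk u -> disk v -> w u = w v.
Proof.
have [[z dz E]|strict] := pselect (exists2 z, disk z & modulus (w z) = modulus (w (phi z))).
  have [_ h] := symbol_le rep da lam1 phiE normal dz.
  by move=> du dv; rewrite (h E u du) (h E v dv).
exfalso; apply: (@no_strict_increase R a lam da lam1 N).
- by move=> z z1; exact: symbol_continuous.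
- move=> z dz; rewrite -phiE //.
  have [h _] := symbol_le rep da lam1 phiE normal dz.
  rewrite ltr_pXn2r ?nnegrE ?modulus_ge0 // lt_neqAle h andbT.
  by apply/eqP => E; apply: strict; exists z.
- exact: boundary_modulus.
Qed.

End BergmanNormal.

Theorem proposition4p4 (R : realType) (H : disk_space R)
    (phi psi : R[i] -> R[i]) (a : R[i])
    (ha : disk a)
    (hphi : is_automorphism phi) (hphia : phi a = 0)
    (hpsi : analytic_on_closed_disk psi) (hpsi0 : ~ eqD psi (fun=> 0))
    (hnormal : normal_operator H (weighted_composition_op psi phi)) :
  is_eigenvector H (composition_op phi) 1
    (fun z => cpowr (1 - a^* * z) (space_exponent H) * psi z).
Proof.
have [lam lam1 phiE] := automorphism_form ha hphi hphia.
have d0 : disk (0 : R[i]) by apply/diskP; rewrite modulus0.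
case: H hnormal => [|alpha halpha] normal.
  refine (eigenvector_of_constant (hardy_reproducing R) ha lam1 phiE hpsi0 _).
  have const y : disk y -> symbol Hardy psi a y = symbol Hardy psi a (phi 0).
    have [_ [_ _ surj]] := hphi; move=> /surj [u du <-].
    exact: (isometry_symbol_constant (hardy_reproducing R) ha lam1 phiE normal (@hardy_shift_isometric R) erefl du).
  by move=> u v du dv; rewrite (const u du) (const v dv).
have [c rep] := bergman_reproducing halpha.
refine (eigenvector_of_constant rep ha lam1 phiE hpsi0 _) => u v du dv.
exact: (bergman_symbol_constant rep ha lam1 phiE hpsi normal).
Qed.
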